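(* Let $m\ge 2$. (i) Let $x:M^m\to\mathbb{S}^{m+2}$ be an umbilic-free Wintgen ideal submanifold of codimension two, with mean curvature spheres $[\xi]=[\xi_1-i\xi_2]\in Q^{m+2}_+$. Then the mean curvature spheres form a holomorphic and 1-isotropic curve in $Q^{m+2}_+$. That is, locally the Gauss map $[\xi]:M^m\to Q^{m+2}_+$ factors as the projection of $M^m$ onto a quotient surface $\overline{M}$ (the space of leaves of the integrable distribution $\mathbb{D}^{\bot}$) followed by an immersion $[\xi]:\overline{M}\to Q^{m+2}_+$, and $\overline{M}$ carries a Riemann surface structure such that, for local complex coordinates $z$ of $\overline{M}$ and local lifts $\xi$, $$\xi_{\bar z}\parallel \xi,\qquad \langle \xi_z,\xi_z\rangle=0 .$$ (ii) Conversely, let $\overline{M}$ be a Riemann surface and let $[\xi]:\overline{M}\to Q^{m+2}_+\subset\mathbb{C}P^{m+3}$ be a holomorphic 1-isotropic curve. Then the envelope $\widehat{M}^m$ of the corresponding 2-parameter family of $m$-spheres is, at its regular points, an $m$-dimensional Wintgen ideal submanifold of $\mathbb{S}^{m+2}$.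
   Context: **Wintgen ideal submanifolds (codimension two).** A submanifold $x:M^m\to\mathbb{S}^{m+2}$ is Wintgen ideal if equality holds in the DDVV inequality at every point; equivalently (and this is taken as the definition), at every point there are an orthonormal basis $\{e_1,\dots,e_m\}$ of the tangent space and an orthonormal basis $\{n_1,n_2\}$ of the normal space such that the shape operators have matrices $A_{n_1}=\lambda_1 I_m+\mu_0(E_{12}+E_{21})$ and $A_{n_2}=\lambda_2 I_m+\mu_0(E_{11}-E_{22})$ for some real $\lambda_1,\lambda_2,\mu_0$, where $E_{ij}$ are the matrix units. If $M$ is umbilic-free ($\mu_0\neq0$ everywhere), the canonical distribution $\mathbb{D}=\mathrm{Span}\{e_1,e_2\}$ is well defined; $\mathbb{D}^{\bot}=\mathrm{Span}\{e_3,\dots,e_m\}$ is its orthogonal complement in $TM$. **Light-cone model.** $\mathbb{R}^{m+4}_1$ is $\mathbb{R}^{m+4}$ with $\langle Y,Z\rangle=-Y_0Z_0+Y_1Z_1+\cdots+Y_{m+3}Z_{m+3}$, extended complex bilinearly to $\mathbb{C}^{m+4}_1=\mathbb{R}^{m+4}_1\otimes\mathbb{C}$. A point $y\in\mathbb{S}^{m+2}\subset\mathbb{R}^{m+3}$ is identified with the light-like line $[(1,y)]$. An (oriented) spacelike 2-plane $\mathrm{Span}_{\mathbb{R}}\{\xi_1,\xi_2\}$ with $\{\xi_1,\xi_2\}$ an oriented orthonormal basis represents the (oriented) round $m$-sphere in $\mathbb{S}^{m+2}$ consisting of the light-like lines orthogonal to it, and is identified with the point $[\xi_1-i\xi_2]$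 of $$Q^{m+2}_+=\{[Z]\in\mathbb{C}P^{m+3}:\langle Z,Z\rangle=0,\ \langle Z,\bar Z\rangle>0\}.$$ **Mean curvature sphere.** For a local oriented orthonormal normal frame $\{n_1,n_2\}$ of $x$ with mean curvature vector $H=\frac1m\mathrm{tr}(II)=H^1n_1+H^2n_2$, set $\xi_r=(H^r,\,n_r+H^rx)\in\mathbb{R}^{m+4}_1$, $r=1,2$. The spacelike plane $\mathrm{Span}\{\xi_1,\xi_2\}$ represents the mean curvature sphere at $x$: the unique round $m$-sphere tangent to $M$ at $x$ with the same mean curvature vector there. The Gauss map is $[\xi]=[\xi_1-i\xi_2]:M^m\to Q^{m+2}_+$. **Holomorphic 1-isotropic curves in $Q^{m+2}_+$.** A complex (holomorphic) curve is a holomorphic immersion $[\xi]:\overline{M}\to Q^{m+2}_+$ of a Riemann surface; in terms of a local lift $\xi$ and a local coordinate $z$, $\xi_{\bar z}=\lambda\xi$ for a local complex function $\lambda$ (written $\xi_{\bar z}\parallel\xi$). It is 1-isotropic if $d\xi$ is isotropic, i.e. $\langle\xi_z,\xi_z\rangle=0$. **Envelope.** Given a curve $[\xi]=[\xi_1-i\xi_2]:\overline{M}\to Q^{m+2}_+$ ($\xi_1,\xi_2$ orthonormal), the corresponding 2-parameter family of $m$-spheres is $q\mapsto\mathrm{Span}_{\mathbb{R}}\{\xi_1(q),\xi_2(q)\}$. Its envelope $\widehat{M}^m$ consists of the pairs $(q,[Y])$ with $q\in\overline{M}$ and $[Y]$ a light-like line in the orthogonal complement of $\mathrm{Span}_{\mathbb{R}}\{\xi_1,\xi_2,d\xi_1,d\xi_2\}$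 at $q$ (the span being 4-dimensional and spacelike), with the map $(q,[Y])\mapsto[Y]\in\mathbb{S}^{m+2}$. Regular points are those near which this map is an immersion. *)

(* Defs.v *)
(* MathComp-Analysis, over an abstract [R : realType]. *)
From HB Require Import structures.
From mathcomp Require Import all_boot all_order all_algebra.
From mathcomp Require Import complex.
From mathcomp Require Import all_classical all_reals all_analysis.
Set Implicit Arguments.
Unset Strict Implicit.
Unset Printing Implicit Defensive.
Import Order.TTheory GRing.Theory Num.Theory.
Import numFieldNormedType.Exports.
Local Open Scope classical_set_scope.
Local Open Scope ring_scope.

Section Smooth.
Variable R : realType.

(* Meant for open [D]: the derivatives are the unrestricted ones. *)
Fixpoint Ck_on (V W : normedModType R) (k : nat) (D : set V) (f : V -> W) : Prop :=
  match k with
  | 0%N => forall a, D a -> {for a, continuous f}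
  | k'.+1 => (forall a, D a -> differentiable f a) /\
             (forall v : V, Ck_on k' D ('D_v f))
  end.

Definition smooth_on (V W : normedModType R) (D : set V) (f : V -> W) : Prop :=
  forall k, Ck_on k D f.

Definition immersive_at (V W : normedModType R) (f : V -> W) (a : V) : Prop :=
  forall v : V, 'D_v f a = 0 -> v = 0.

End Smooth.

(* A homeomorphism from an open subset [cdom] of [T] onto an open subset [ccod]
   of [V]; the values of [cfwd] off [cdom] and of [cinv] off [ccod] are junk. *)
Record chart (T V : topologicalType) := Chart {
  cdom : set T;
  cfwd : T -> V;
  cinv : V -> T;
  cdom_open : open cdom;
  ccod_open : open (cfwd @` cdom);
  cfwdK : forall p, cdom p -> cinv (cfwd p) = p;
  cfwd_continuous : forall p, cdom p -> {for p, continuous cfwd};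
  cinv_continuous : forall a, (cfwd @` cdom) a -> {for a, continuous cinv}
}.

Definition ccod (T V : topologicalType) (c : chart T V) : set V :=
  cfwd c @` cdom c.

Section Manifold.
Variable R : realType.

(* [A] is a C^oo atlas of dimension [p] on [T]. *)
Definition smooth_manifold (p : nat) (T : topologicalType)
    (A : set (chart T 'rV[R]_p)) : Prop :=
  [/\ hausdorff_space T,
      @second_countable T,
      forall q : T, exists2 c, A c & cdom c q
    & forall c d, A c -> A d ->
        smooth_on (ccod c `&` cinv c @^-1` cdom d) (cfwd d \o cinv c)].

(* The plane of the complex variable z = u + iv is 'rV[R]_2, with coordinates
   (u, v). *)
Definition eu : 'rV[R]_2 := delta_mx 0 0.
Definition ev : 'rV[R]_2 := delta_mx 0 1.

(* Multiplication by i. *)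
Definition Jmul (w : 'rV[R]_2) : 'rV[R]_2 := w 0 0 *: ev - w 0 1 *: eu.

Definition holomorphic_on (D : set 'rV[R]_2) (f : 'rV[R]_2 -> 'rV[R]_2) : Prop :=
  forall a, D a -> differentiable f a /\ 'D_ev f a = Jmul ('D_eu f a).

(* The smoothness required of the transition maps by [smooth_manifold] is
   redundant here; it makes the underlying real surface available directly. *)
Definition riemann_surface (T : topologicalType)
    (B : set (chart T 'rV[R]_2)) : Prop :=
  smooth_manifold B /\
  (forall c d, B c -> B d ->
     holomorphic_on (ccod c `&` cinv c @^-1` cdom d) (cfwd d \o cinv c)).

Definition smooth_fun (p : nat) (T : topologicalType) (W : normedModType R)
    (A : set (chart T 'rV[R]_p)) (D : set T) (f : T -> W) : Prop :=
  forall c, A c -> smooth_on (ccod c `&` cinv c @^-1` D) (f \o cinv c).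

(* Continuity is required separately: it makes [f @^-1` cdom d] open. *)
Definition smooth_into (q : nat) (V : normedModType R) (S : topologicalType)
    (B : set (chart S 'rV[R]_q)) (D : set V) (f : V -> S) : Prop :=
  (forall a, D a -> {for a, continuous f}) /\
  (forall d, B d -> smooth_on (D `&` f @^-1` cdom d) (cfwd d \o f)).

Definition smooth_map (p q : nat) (T S : topologicalType)
    (A : set (chart T 'rV[R]_p)) (B : set (chart S 'rV[R]_q))
    (D : set T) (f : T -> S) : Prop :=
  forall c, A c -> smooth_into B (ccod c `&` cinv c @^-1` D) (f \o cinv c).

End Manifold.

Section SphereSubmanifold.
Variables (R : realType) (m n : nat).
Implicit Types (f : 'rV[R]_m -> 'rV[R]_n) (a : 'rV[R]_m).
Implicit Types (nu : 'rV[R]_n) (E : 'M[R]_m).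

Definition dotr (k : nat) (u v : 'rV[R]_k) : R := (u *m v^T) 0 0.

(* [f] is a local parametrization of a submanifold of the unit sphere of R^n.
   Tangent vectors at [f a] are represented by their coordinate rows [v]; the
   vector itself is ['D_v f a = v *m 'J f a]. *)
Definition metric f a : 'M[R]_m := 'J f a *m ('J f a)^T.

(* [nu] is tangent to the sphere and orthogonal to the submanifold. *)
Definition normal_at f a nu : Prop :=
  dotr nu (f a) = 0 /\ forall v : 'rV[R]_m, dotr nu ('D_v f a) = 0.

Definition normal_frame f a nu1 nu2 : Prop :=
  [/\ normal_at f a nu1, normal_at f a nu2,
      dotr nu1 nu1 = 1, dotr nu2 nu2 = 1 & dotr nu1 nu2 = 0].

(* The matrix of <II, nu> in the coordinate basis. As [nu] is normal in the
   sphere, the tangential and radial parts of the second derivatives drop out. *)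
Definition sff f a nu : 'M[R]_m :=
  \matrix_(i, j) dotr ('D_(delta_mx 0 i) ('D_(delta_mx 0 j) f) a) nu.

(* The shape operator A_nu in coordinates, acting on rows on the right:
   <A_nu v, w> = <II(v, w), nu>. *)
Definition shape_op f a nu : 'M[R]_m := sff f a nu *m invmx (metric f a).

(* <H, nu> for the mean curvature vector H = (1/m) tr II. *)
Definition mean_curv f a nu : R := m%:R^-1 * \tr (shape_op f a nu).

(* The matrix unit E_(k+1)(l+1). *)
Definition munit (k l : nat) : 'M[R]_m :=
  \matrix_(i, j) ((i == k :> nat) && (j == l :> nat))%:R.

(* The rows of [E] are e_1, ..., e_m; the last two conditions read
   A_nu e_i = \sum_j M i j e_j with the (symmetric) matrix M prescribed for
   A_nu. *)
Definition wintgen_frame f a E nu1 nu2 (l1 l2 mu : R) : Prop :=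
  [/\ E *m metric f a *m E^T = 1%:M,
      normal_frame f a nu1 nu2,
      E *m shape_op f a nu1 = (l1%:M + mu *: (munit 0 1 + munit 1 0)) *m E
    & E *m shape_op f a nu2 = (l2%:M + mu *: (munit 0 0 - munit 1 1)) *m E].

Definition wintgen_at f a : Prop :=
  exists E nu1 nu2 l1 l2 mu, wintgen_frame f a E nu1 nu2 l1 l2 mu.

Definition wintgen_umbilic_free_at f a : Prop :=
  forall E nu1 nu2 l1 l2 mu, wintgen_frame f a E nu1 nu2 l1 l2 mu -> mu != 0.

(* The distribution Span{e_3, ..., e_m}; it does not depend on the frame at
   points where mu != 0. *)
Definition Dperp f a : set 'rV[R]_m :=
  [set v | exists E nu1 nu2 l1 l2 mu, wintgen_frame f a E nu1 nu2 l1 l2 mu /\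
     exists2 c : 'rV[R]_m, (forall j : 'I_m, (j < 2)%N -> c 0 j = 0)
                         & v = c *m E].

Definition wintgen_ideal_on (U : set 'rV[R]_m) f : Prop :=
  smooth_on U f /\
  forall a, U a -> [/\ dotr (f a) (f a) = 1, immersive_at f a & wintgen_at f a].

Variables (M : topologicalType) (A : set (chart M 'rV[R]_m)).
Implicit Types x : M -> 'rV[R]_n.

Definition wintgen_ideal x : Prop :=
  forall c, A c -> wintgen_ideal_on (ccod c) (x \o cinv c).

Definition wintgen_umbilic_free x : Prop :=
  forall c, A c -> forall a, ccod c a -> wintgen_umbilic_free_at (x \o cinv c) a.

Definition smooth_normal_frame x (W : set M) (n1 n2 : M -> 'rV[R]_n) : Prop :=
  [/\ open W, smooth_fun A W n1, smooth_fun A W n2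
    & forall c, A c -> forall a, ccod c a -> W (cinv c a) ->
        normal_frame (x \o cinv c) a (n1 (cinv c a)) (n2 (cinv c a))].

(* The leaves of the restriction of D^perp to the open set [U]: the sets of
   points that can be joined inside [U] by a smooth curve tangent to D^perp. *)
Definition same_leaf x (U : set M) (p q : M) : Prop :=
  exists gamma : R -> M,
  [/\ gamma 0 = p, gamma 1 = q, forall t, U (gamma t),
      smooth_into A [set: R^o] gamma
    & forall c, A c -> forall t, cdom c (gamma t) ->
        Dperp (x \o cinv c) (cfwd c (gamma t))
              ('D_(1 : R^o) (cfwd c \o gamma : R^o -> 'rV[R]_m) t)].

End SphereSubmanifold.

Section LightCone.

(* <Y, Z> on K^(1+n)_1; complex bilinear for K = R[i]. *)
Definition lor (K : comNzRingType) (n : nat) (Y Z : 'rV[K]_(1 + n)) : K :=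
  - (Y 0 0 * Z 0 0) + \sum_(i < n) Y 0 (rshift 1 i) * Z 0 (rshift 1 i).

Variable R : realType.
Local Notation C := (complex R).

(* X + iY, and the real and imaginary parts of a complex vector. *)
Definition cvec (k : nat) (X Y : 'rV[R]_k) : 'rV[C]_k :=
  \row_j Complex (X 0 j) (Y 0 j).
Definition revec (k : nat) (Z : 'rV[C]_k) : 'rV[R]_k :=
  map_mx (@complex.Re R) Z.
Definition imvec (k : nat) (Z : 'rV[C]_k) : 'rV[R]_k :=
  map_mx (@complex.Im R) Z.

(* Derivatives of vector-valued complex functions along real directions, and
   with respect to z and \bar z. *)
Definition cderive (V : normedModType R) (k : nat) (v : V) (f : V -> 'rV[C]_k)
    (a : V) : 'rV[C]_k :=
  cvec ('D_v (@revec k \o f) a) ('D_v (@imvec k \o f) a).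

Definition d_z (k : nat) (f : 'rV[R]_2 -> 'rV[C]_k) (a : 'rV[R]_2) : 'rV[C]_k :=
  2^-1 *: (cderive (eu R) f a - 'i *: cderive (ev R) f a).
Definition d_zbar (k : nat) (f : 'rV[R]_2 -> 'rV[C]_k) (a : 'rV[R]_2) :
    'rV[C]_k :=
  2^-1 *: (cderive (eu R) f a + 'i *: cderive (ev R) f a).

Variable n : nat.

(* A point [Z] of CP^n is the complex line spanned by [Z]. *)
Definition cline : Type := {vspace 'rV[C]_(1 + n)}.

Definition Qplus : set cline :=
  [set L | exists Z : 'rV[C]_(1 + n),
     [/\ L = <[Z]>%VS, lor Z Z = 0 & 0 < lor Z (map_mx Num.conj Z)]].

(* The class [xi1 - i xi2]. *)
Definition sphere_point (xi1 xi2 : 'rV[R]_(1 + n)) : cline :=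
  <[cvec xi1 (- xi2)]>%VS.

(* xi_r = (H^r, n_r + H^r x). *)
Definition mcs_lift (m : nat) (f : 'rV[R]_m -> 'rV[R]_n) (a : 'rV[R]_m)
    (nu : 'rV[R]_n) : 'rV[R]_(1 + n) :=
  row_mx (mean_curv f a nu)%:M (nu + mean_curv f a nu *: f a).

Definition gauss_map (m : nat) (f : 'rV[R]_m -> 'rV[R]_n) (a : 'rV[R]_m)
    (nu1 nu2 : 'rV[R]_n) : cline :=
  sphere_point (mcs_lift f a nu1) (mcs_lift f a nu2).

Variables (S : topologicalType) (B : set (chart S 'rV[R]_2)) (g : S -> cline).

Definition local_lift (W : set S) (Z : S -> 'rV[C]_(1 + n)) : Prop :=
  [/\ open W, smooth_fun B W (@revec _ \o Z), smooth_fun B W (@imvec _ \o Z)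
    & forall q, W q -> g q = <[Z q]>%VS].

Definition smooth_curve : Prop :=
  (forall q, Qplus (g q)) /\
  (forall q, exists W Z, local_lift W Z /\ W q).

(* The tangent space of CP^n at [Z] is C^(1+n) / CZ, so that [g] is an immersion
   when no nonzero real tangent vector is sent into C Z by the differential of a
   lift. *)
Definition holomorphic_curve : Prop :=
  smooth_curve /\
  forall W Z, local_lift W Z -> forall d, B d ->
  forall a, ccod d a -> W (cinv d a) ->
    (exists l : C, d_zbar (Z \o cinv d) a = l *: Z (cinv d a)) /\
    (forall v : 'rV[R]_2,
       (exists l : C, cderive v (Z \o cinv d) a = l *: Z (cinv d a)) -> v = 0).

Definition one_isotropic : Prop :=
  forall W Z, local_lift W Z -> forall d, B d ->
  forall a, ccod d a -> W (cinv d a) ->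
    lor (d_z (Z \o cinv d) a) (d_z (Z \o cinv d) a) = 0.

Definition orthonormal_lift (W : set S) (xi1 xi2 : S -> 'rV[R]_(1 + n)) : Prop :=
  [/\ open W, smooth_fun B W xi1, smooth_fun B W xi2
    & forall q, W q ->
       [/\ lor (xi1 q) (xi1 q) = 1, lor (xi2 q) (xi2 q) = 1,
           lor (xi1 q) (xi2 q) = 0 & g q = sphere_point (xi1 q) (xi2 q)]].

(* The row space is Span{xi1, xi2, d xi1, d xi2}. *)
Definition span_mx (xi1 xi2 : 'rV[R]_2 -> 'rV[R]_(1 + n)) (a : 'rV[R]_2) :
    'M[R]_(1 + (1 + (2 + 2)), 1 + n) :=
  col_mx (xi1 a) (col_mx (xi2 a) (col_mx ('J xi1 a) ('J xi2 a))).

Definition spacelike (k : nat) (P : 'M[R]_(k, 1 + n)) : Prop :=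
  forall w : 'rV[R]_(1 + n), (w <= P)%MS -> w != 0 -> 0 < lor w w.

(* The light-like line [(1, y)] is represented by the point [y] of the sphere.
   The conditions do not depend on the chart or on the orthonormal lift. *)
Definition envelope : set (S * 'rV[R]_n) :=
  [set p | dotr p.2 p.2 = 1 /\
     exists d W xi1 xi2,
     [/\ B d, cdom d p.1, orthonormal_lift W xi1 xi2, W p.1
       & let P := span_mx (xi1 \o cinv d) (xi2 \o cinv d) (cfwd d p.1) in
         [/\ \rank P = 4%N, spacelike P
           & forall i, lor (row_mx (1%:M : 'M[R]_1) p.2) (row i P) = 0]]].

(* Local parametrization of the envelope as an m-dimensional embedded
   submanifold of S x R^n; the last condition says that [F] is a homeomorphism
   onto an open subset of the envelope. *)
Definition envelope_param (m : nat) (U : set 'rV[R]_m)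
    (F : 'rV[R]_m -> S * 'rV[R]_n) : Prop :=
  [/\ open U,
      smooth_into B U (fst \o F) /\ smooth_on U (snd \o F),
      forall a, U a -> forall d, B d -> cdom d (F a).1 ->
        forall v : 'rV[R]_m, 'D_v (cfwd d \o (fst \o F)) a = 0 ->
          'D_v (snd \o F) a = 0 -> v = 0,
      {in U &, injective F}
    & forall V, open V -> V `<=` U ->
        exists2 O, open O & F @` V = O `&` envelope].

End LightCone.

(* Main.v *)
Require Import Defs.
From HB Require Import structures.
From mathcomp Require Import all_boot all_order all_algebra.
From mathcomp Require Import complex.
From mathcomp Require Import all_classical all_reals all_analysis.
From mathcomp Require Import ring lra.
Set Implicit Arguments.
Unset Strict Implicit.
Unset Printing Implicit Defensive.
Import Order.TTheory GRing.Theory Num.Theory.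
Import numFieldNormedType.Exports.
Local Open Scope classical_set_scope.
Local Open Scope ring_scope.

(** Part (i). Let X = (1, x) be the light-like lift of the immersion and
    xi = xi_1 - i xi_2 the lift of its Gauss map. In a chart, xi is orthogonal
    to X, to the derivatives of X and to itself, and <d_i xi, d_j X> is, up to
    sign, the trace-free complex second fundamental form h = h_1 - i h_2. The
    Wintgen condition with mu_0 <> 0 says that h = q phi^T phi for a covector
    phi that is null for the metric, and D^perp is then the kernel of phi
    ([wintgen_conformal_form]). Expanding in the frame formed by X, its
    derivatives and xi_1, xi_2 ([polar_product]), nullity of phi gives
    <d_i xi, d_j xi> = 0 near the point. This tensor vanishes identically, so the
    argument that determines Christoffel symbols gives <d_k d_i xi, d_j xi> = 0
    ([christoffel]), whereas <d_k d_i xi, X> = q phi_i phi_k is nonzero for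
    suitable i and k. A combination of the d_i xi that phi kills is a combination
    of xi and X; pairing it with d_k d_i xi excludes X. Hence
    d xi = phi kappa + l xi with kappa isotropic ([gauss_structure]): modulo xi
    the differential of the Gauss map is phi, with values in one complex line.

    Normalize the lift by dividing by a nonzero coordinate. A suitable other
    coordinate of it is then a submersion h onto a planar disc (a ball of the
    maximum norm) whose kernel is D^perp, and on a box around the point the fibres of h are joined by curves
    inside the box ([submersion_box]), so they are the leaves of D^perp. The
    normalized lift is constant on them, and as a function of h its derivative is
    complex linear with isotropic values ([local_fibration]). The disc is the
    leaf space; it is realized as the plane with one chart onto the disc.

    Part (ii). Let xi = X1 - i X2 be an orthonormal lift of the curve. By the
    Cauchy-Riemann equation and isotropy, X1, X2 and the components e1, e2 of the
    derivatives orthogonal to them have Gram matrix diag(1, 1, tau, tau)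
    ([lift_gram]), so that the span of X1, X2, dX1, dX2 is a spacelike 4-space
    exactly when tau > 0. In coordinates (z, y) with Y = (1, y) the envelope is
    given there by |y|^2 = 1 and by the vanishing of the products of Y with X1,
    X2, d_u X1, d_u X2. These five equations are independent because Y is
    light-like and so not in a spacelike subspace ([env_map_submersion]); the
    straightening theorem gives the parametrizations ([envelope_submanifold]).
    The equations do not depend on the lift ([orth_transfer]).

    On a regular piece, differentiating <xi, Y> = 0 and <d_u xi, Y> = 0 shows
    that the spheres are tangent to the envelope and that, up to a multiple of
    the metric in each component, its complex second fundamental form is
    - dz (x) omega with omega = <d_u xi, dY>. Being symmetric, it is a multiple of
    omega (x) omega, and omega is null since d_u xi is isotropic
    ([env_covector_null]). A null covector provides e1, e2 of a Wintgen frame,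
    and a rotation of the normals absorbs the argument of the coefficient
    ([wintgen_of_null_form]). *)

(** * Calculus in normed modules *)

Lemma diff_epsP (R : realType) (V W : normedModType R) (f : V -> W) a :
  differentiable f a <-> exists df : {linear V -> W}, continuous df /\
   forall e : R, 0 < e -> \forall h \near (0 : V),
     `|f (h + a) - f a - df h| <= e * `|h|.
Proof.
split=> [df|[df [dfc dfe]]].
  exists ('d f a); split; first exact: diff_continuous.
  move=> e e0; have /diff_locallyP[_ /eqaddoP/(_ _ e0) E] := df.
  by apply: filterS E => h /=; rewrite opprD addrA.
have E : f \o shift a = cst (f a) + df +o_ (0 : V) id.
  apply/eqaddoP => e /dfe; apply: filterS => h /=.
  by rewrite opprD addrA.
by apply/diff_locallyP; rewrite (diff_unique dfc E); split.
Qed.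

Lemma diff_eps (R : realType) (V W : normedModType R) (f : V -> W) a (e : R) :
  differentiable f a -> 0 < e ->
  \forall h \near (0 : V), `|f (h + a) - f a - 'D_h f a| <= e * `|h|.
Proof.
move=> df e0; have /diff_locallyP[_ /eqaddoP/(_ _ e0) E] := df.
by apply: filterS E => h /=; rewrite (deriveE _ df) opprD addrA.
Qed.

Lemma shift_cvg (R : realType) (V : normedModType R) (a : V) :
  (fun h : V => h + a) @ (0 : V) --> a.
Proof. by rewrite -{2}(add0r a); apply: cvgD; [exact: cvg_id|exact: cvg_cst]. Qed.

Lemma near_eq_differentiable (R : realType) (V W : normedModType R)
    (f g : V -> W) a :
  (\forall x \near a, f x = g x) -> differentiable f a -> differentiable g a.
Proof.
move=> fg /diff_epsP[df [dfc dfe]]; apply/diff_epsP; exists df; split=> // e e0.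
have fga := nbhs_singleton fg.
have fg0 : \forall h \near (0 : V), f (h + a) = g (h + a).
  exact: (@shift_cvg R V a _ fg).
by apply: filterS2 fg0 (dfe _ e0) => h <-; rewrite fga.
Qed.

Lemma derive_comp (R : realType) (U V W : normedModType R)
    (f : U -> V) (g : V -> W) a v :
  differentiable f a -> differentiable g (f a) ->
  'D_v (g \o f) a = 'D_('D_v f a) g (f a).
Proof.
move=> df dg; have dfg := differentiable_comp df dg.
by rewrite (deriveE _ dfg) (deriveE _ dg) (deriveE _ df) (diff_comp df dg).
Qed.

Lemma rV_delta_sum (R : pzSemiRingType) n (v : 'rV[R]_n) : v = \sum_j v 0 j *: delta_mx 0 j.
Proof.
rewrite {1}(matrix_sum_delta v) big_ord1.
by apply: eq_bigr => j _.
Qed.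

Lemma derive_rV_sum (R : realType) n (W : normedModType R) (f : 'rV[R]_n -> W) a v :
  differentiable f a -> 'D_v f a = \sum_j v 0 j *: 'D_(delta_mx 0 j) f a.
Proof.
move=> df; rewrite {1}(rV_delta_sum v) (deriveE _ df) linear_sum.
by apply: eq_bigr => j _; rewrite linearZ (deriveE _ df).
Qed.

Lemma differentiable_rVP (R : realType) (V : normedModType R) n (f : V -> 'rV[R]_n) a :
  differentiable f a <-> forall j, differentiable (fun x => f x 0 j : R) a.
Proof.
split=> [df j|df].
  apply: (@differentiable_comp _ _ _ _ f (fun M : 'rV[R]_n => M 0 j : R)) => //.
  exact: differentiable_coord.
have -> : f = \sum_(j < n) (fun x => f x 0 j *: (delta_mx 0 j : 'rV[R]_n)).
  apply/funext => x; rewrite {1}(rV_delta_sum (f x)).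
  by rewrite fct_sumE.
apply: differentiable_sum => j; exact: differentiableZl.
Qed.

Lemma derive_coord (R : realType) (V : normedModType R) n (f : V -> 'rV[R]_n) a v j :
  differentiable f a -> ('D_v f a) 0 j = 'D_v (fun x => f x 0 j) a.
Proof. by move=> df; rewrite derive_mx ?mxE //; exact: diff_derivable. Qed.

Lemma Ck_onS (R : realType) k (V W : normedModType R) (D : set V) (f : V -> W) :
  Ck_on k.+1 D f -> Ck_on k D f.
Proof.
elim: k f => [|k IH] f /= [df Cf]; first by move=> a Da; apply/differentiable_continuous/df.
by split=> // v; apply: IH.
Qed.

Lemma Ck_on_subset (R : realType) k (V W : normedModType R) (D E : set V) (f : V -> W) :
  D `<=` E -> Ck_on k E f -> Ck_on k D f.
Proof.
move=> DE; elim: k f => [|k IH] f /=; first by move=> cf a /DE; exact: cf.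
by move=> [df Cf]; split=> [a /DE /df//|v]; apply: IH.
Qed.

Lemma Ck_on_eq (R : realType) k (V W : normedModType R) (D : set V) (f g : V -> W) :
  open D -> {in D, f =1 g} -> Ck_on k D f -> Ck_on k D g.
Proof.
move=> oD; elim: k f g => [|k IH] f g fg /=.
  move=> cf a Da; rewrite /prop_for /continuous_at -fg ?inE //.
  apply: cvg_trans (cf _ Da); apply: near_eq_cvg; near=> x.
  by apply: fg; rewrite inE; near: x; apply: open_nbhs_nbhs.
have ne a : D a -> \forall x \near a, f x = g x.
  by move=> Da; near=> x; apply: fg; rewrite inE; near: x; apply: open_nbhs_nbhs.
move=> [df Cf]; split=> [a Da|v].
  by apply: near_eq_differentiable (df _ Da); exact: ne.
apply: IH (Cf v) => a; rewrite inE => Da.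
by apply: near_eq_derive; exact: ne.
Unshelve. all: by end_near. Qed.

Lemma Ck_cst (R : realType) k (V W : normedModType R) (D : set V) (c : W) :
  Ck_on k D (fun _ => c).
Proof.
elim: k c => [|k IH] c /=; first by move=> a _; exact: cvg_cst.
split=> [a _|v]; first exact: differentiable_cst.
by rewrite (_ : 'D_v _ = fun _ => 0) //; apply/funext => a; exact: derive_cst.
Qed.

Lemma Ck_add (R : realType) k (V W : normedModType R) (D : set V) (f g : V -> W) :
  open D -> Ck_on k D f -> Ck_on k D g -> Ck_on k D (fun x => f x + g x).
Proof.
move=> oD; elim: k f g => [|k IH] f g /=.
  by move=> cf cg a Da; apply: cvgD; [exact: cf|exact: cg].
move=> [df Cf] [dg Cg]; split=> [a Da|v].
  by apply: differentiableD; [exact: df|exact: dg].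
apply: Ck_on_eq (IH _ _ (Cf v) (Cg v)) => // a; rewrite inE => Da.
by apply/esym/deriveD; apply/diff_derivable; [exact: df|exact: dg].
Qed.

Lemma Ck_mul (R : realType) k (V : normedModType R) (D : set V) (f g : V -> R) :
  open D -> Ck_on k D f -> Ck_on k D g -> Ck_on k D (fun x => f x * g x).
Proof.
move=> oD; elim: k f g => [|k IH] f g.
  by move=> cf cg a Da; apply: cvgM; [exact: cf|exact: cg].
move=> Cf' Cg'; have /= [df Cf] := Cf'; have /= [dg Cg] := Cg'.
split=> [a Da|v].
  by apply: differentiableM; [exact: df|exact: dg].
apply: (Ck_on_eq _ _ (Ck_add oD (IH _ _ (Ck_onS Cf') (Cg v)) (IH _ _ (Ck_onS Cg') (Cf v)))) => // a.
rewrite inE => Da.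
by apply/esym/deriveM; apply/diff_derivable; [exact: df|exact: dg].
Qed.

Lemma Ck_opp (R : realType) k (V : normedModType R) (D : set V) (f : V -> R) :
  open D -> Ck_on k D f -> Ck_on k D (fun x => - f x).
Proof.
move=> oD Cf; apply: (Ck_on_eq _ _ (Ck_mul oD (@Ck_cst R k V R D (-1)) Cf)) => // a _.
by rewrite mulN1r.
Qed.

Lemma Ck_inv (R : realType) k (V : normedModType R) (D : set V) (f : V -> R) :
  open D -> (forall a, D a -> f a != 0) ->
  Ck_on k D f -> Ck_on k D (fun x => (f x)^-1).
Proof.
move=> oD f0; elim: k => [|k IH].
  by move=> cf a Da; apply: cvgV; [exact: f0|exact: cf].
move=> Cf'; have /= [df Cf] := Cf'; have Ci := IH (Ck_onS Cf').
split=> [a Da|v].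
  by apply: differentiableV; [exact: df|exact: f0].
apply: (Ck_on_eq _ _ (Ck_opp oD (Ck_mul oD (Ck_mul oD Ci Ci) (Cf v)))) => // a.
rewrite inE => Da; rewrite [RHS]deriveV; last 2 first.
- exact: f0.
- exact/diff_derivable/df.
by rewrite scaleNr -expr2 exprVn.
Qed.

Lemma Ck_sum (R : realType) k (V W : normedModType R) (D : set V) (I : Type)
    (s : seq I) (P : pred I) (f : I -> V -> W) :
  open D -> (forall i, P i -> Ck_on k D (f i)) ->
  Ck_on k D (fun x => \sum_(i <- s | P i) f i x).
Proof.
move=> oD Cf; elim: s => [|i s IH].
  by apply: Ck_on_eq (Ck_cst k D 0) => // a _; rewrite big_nil.
case Pi: (P i); last by apply: Ck_on_eq IH => // a _; rewrite big_cons Pi.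
by apply: Ck_on_eq (Ck_add oD (Cf _ Pi) IH) => // a _; rewrite big_cons Pi.
Qed.

Lemma Ck_prod (R : realType) k (V : normedModType R) (D : set V) (I : Type)
    (s : seq I) (P : pred I) (f : I -> V -> R) :
  open D -> (forall i, P i -> Ck_on k D (f i)) ->
  Ck_on k D (fun x => \prod_(i <- s | P i) f i x).
Proof.
move=> oD Cf; elim: s => [|i s IH].
  by apply: Ck_on_eq (@Ck_cst R k V R D 1) => // a _; rewrite big_nil.
case Pi: (P i); last by apply: Ck_on_eq IH => // a _; rewrite big_cons Pi.
by apply: Ck_on_eq (Ck_mul oD (Cf _ Pi) IH) => // a _; rewrite big_cons Pi.
Qed.

Lemma Ck_rVP (R : realType) k (V : normedModType R) n (D : set V) (f : V -> 'rV[R]_n) :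
  open D -> Ck_on k D f <-> forall j, Ck_on k D (fun x => f x 0 j : R).
Proof.
move=> oD; elim: k f => [|k IH] f /=.
  split=> [cf j a Da|cf a Da].
    apply: (@continuous_comp _ _ _ f (fun M : 'rV[R]_n => M 0 j : R)); first exact: cf.
    exact: coord_continuous.
  apply/cvgrPdist_le => e e0; near=> x.
  rewrite /Num.Def.normr/= mx_normrE (bigmax_le _ (ltW e0))//= => -[i j] _.
  rewrite /= !mxE ord1 {i}; move: j; near: x; apply: filter_forall => j.
  exact: ((cvgrPdist_le _ _).1 (cf j a Da)).
split=> [[df Cf] j|Cf].
  split=> [a Da|v]; first by move/differentiable_rVP : (df _ Da); exact.
  apply: (Ck_on_eq _ _ (((IH _).1 (Cf v)) j)) => // a; rewrite inE => Da.
  by rewrite derive_coord //; exact: df.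
have df a : D a -> differentiable f a.
  by move=> Da; apply/differentiable_rVP => j; exact: (Cf j).1.
split=> // v; apply/IH => j; apply: (Ck_on_eq _ _ ((Cf j).2 v)) => // a; rewrite inE => Da.
by rewrite derive_coord //; exact: df.
Unshelve. all: by end_near. Qed.

Lemma Ck_compR (R : realType) k (V : normedModType R) n (D : set V) (E : set 'rV[R]_n)
    (f : V -> 'rV[R]_n) (g : 'rV[R]_n -> R) :
  open D -> (forall a, D a -> E (f a)) ->
  Ck_on k D f -> Ck_on k E g -> Ck_on k D (g \o f).
Proof.
move=> oD DE; elim: k g => [|k IH] g.
  by move=> cf cg a Da; apply: continuous_comp; [exact: cf|exact/cg/DE].
move=> Cf' Cg'; have /= [df Cf] := Cf'; have /= [dg Cg] := Cg'.
split=> [a Da|v]; first by apply: differentiable_comp; [exact: df|exact/dg/DE].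
have H j : Ck_on k D (fun x => ('D_v f x) 0 j * ('D_(delta_mx 0 j) g \o f) x).
  apply: Ck_mul => //; first by move: j; apply/Ck_rVP.
  by apply: IH => //; exact: Ck_onS.
apply: (Ck_on_eq _ _ (@Ck_sum _ _ _ _ D _ (index_enum 'I_n) xpredT _ oD (fun j _ => H j))) => // a.
rewrite inE => Da; rewrite [RHS]derive_comp; [|exact: df|exact/dg/DE].
by rewrite derive_rV_sum //; exact/dg/DE.
Qed.

Lemma Ck_comp (R : realType) k (V : normedModType R) n p (D : set V) (E : set 'rV[R]_n)
    (f : V -> 'rV[R]_n) (g : 'rV[R]_n -> 'rV[R]_p) :
  open D -> open E -> (forall a, D a -> E (f a)) ->
  Ck_on k D f -> Ck_on k E g -> Ck_on k D (g \o f).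
Proof.
move=> oD oE DE Cf /(Ck_rVP _ _ oE) Cg; apply/Ck_rVP => // j.
exact: (Ck_compR oD DE Cf (Cg j)).
Qed.

Lemma Ck_id (R : realType) k n (D : set 'rV[R]_n) : Ck_on k D id.
Proof.
case: k => [|k] /=; first by move=> a _; exact: cvg_id.
split=> [a _|v].
  by apply: (@linear_differentiable _ _ _ idfun) => x; exact: cvg_id.
rewrite (_ : 'D_v id = fun _ => v); first exact: Ck_cst.
by apply/funext => a; exact: derive_id.
Qed.

Lemma Ck_id1 (R : realType) k (D : set R^o) : Ck_on k D (fun x : R^o => x : R).
Proof.
case: k => [|k] /=; first by move=> a _; exact: cvg_id.
split=> [a _|v].
  by apply: (@linear_differentiable _ _ _ idfun) => x; exact: cvg_id.
rewrite (_ : 'D_v _ = fun _ => v); first exact: Ck_cst.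
by apply/funext => a; exact: derive_id.
Qed.

Lemma Ck_mulmxr (R : realType) k (V : normedModType R) n p (D : set V)
    (f : V -> 'rV[R]_n) (A : 'M[R]_(n, p)) :
  open D -> Ck_on k D f -> Ck_on k D (fun x => f x *m A).
Proof.
move=> oD /(Ck_rVP _ _ oD) Cf; apply/Ck_rVP => // j.
apply: (Ck_on_eq _ _ (@Ck_sum _ _ _ _ D _ (index_enum 'I_n) xpredT
   (fun i x => f x 0 i * A i j) oD _)) => // [a _|i _]; first by rewrite mxE.
by apply: Ck_mul => //; exact: Ck_cst.
Qed.

Lemma smooth_differentiable (R : realType) (V W : normedModType R) (D : set V) (f : V -> W) a :
  smooth_on D f -> D a -> differentiable f a.
Proof. by move=> /(_ 1)[df _]; exact: df. Qed.

Lemma smooth_derive (R : realType) (V W : normedModType R) (D : set V) (f : V -> W) v :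
  smooth_on D f -> smooth_on D ('D_v f).
Proof. by move=> sf k; have [_] := sf k.+1; exact. Qed.

Lemma smooth_J_row (R : realType) m n (f : 'rV[R]_m -> 'rV[R]_n) a i j :
  differentiable f a -> ('J f a) i j = ('D_(delta_mx 0 i) f a) 0 j.
Proof. by move=> df; rewrite deriveEjacobian // -rowE [RHS]mxE. Qed.

Lemma Ck_det (R : realType) k (V : normedModType R) n (D : set V) (M : V -> 'M[R]_n) :
  open D -> (forall i j, Ck_on k D (fun x => M x i j : R)) ->
  Ck_on k D (fun x => \det (M x) : R).
Proof.
move=> oD CM; apply: Ck_sum => // s _; apply: Ck_mul => //; first exact: Ck_cst.
by apply: Ck_prod.
Qed.

Lemma Ck_invmx (R : realType) k (V : normedModType R) n (D : set V) (M : V -> 'M[R]_n) :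
  open D -> (forall a, D a -> M a \in unitmx) ->
  (forall i j, Ck_on k D (fun x => M x i j : R)) ->
  forall i j, Ck_on k D (fun x => invmx (M x) i j : R).
Proof.
move=> oD uM CM i j.
apply: (@Ck_on_eq _ _ _ _ _ (fun x => (\det (M x))^-1 * ((-1) ^+ (j + i) * \det (row' j (col' i (M x)))))) => //.
  by move=> a; rewrite inE => Da; rewrite /invmx uM // !mxE.
apply: Ck_mul => //.
  apply: Ck_inv => // [a Da|]; last exact: Ck_det.
  by rewrite -unitfE -unitmxE uM.
apply: Ck_mul => //; first exact: Ck_cst.
apply: Ck_det => // i' j'.
by apply: Ck_on_eq (CM (lift j i') (lift i j')) => // a _; rewrite !mxE.
Qed.

(** * Symmetry of second derivatives *)

Lemma derive_shift_arg (R : realType) (V W : normedModType R) (f : V -> W) w a u :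
  'D_u (fun x => f (x + w)) a = 'D_u f (a + w).
Proof.
have E : (fun h : R => h^-1 *: (f (h *: u + a + w) - f (a + w))) =
         (fun h : R => h^-1 *: (f (h *: u + (a + w)) - f (a + w))).
  by apply/funext => h; rewrite addrA.
by rewrite /derive /= E.
Qed.

Lemma is_derive_line (R : realType) (V W : normedModType R) (f : V -> W) p u (r : R) :
  differentiable f (p + r *: u) ->
  is_derive (r : R^o) 1 (fun r : R^o => f (p + r *: u)) ('D_u f (p + r *: u)).
Proof.
move=> df.
have E : (fun h : R => h^-1 *: (f (p + (h *: (1 : R^o) + r) *: u) - f (p + r *: u))) =
         (fun h : R => h^-1 *: (f (h *: u + (p + r *: u)) - f (p + r *: u))).
  apply/funext => h; congr (_ *: (f _ - _)).
  by rewrite scalerDl [h *: (1 : R^o)]mulr1 addrCA addrA.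
split; rewrite /derivable /derive /= E //.
exact: (diff_derivable df).
Qed.

Lemma mean_value_line (R : realType) (V : normedModType R) (f : V -> R) p u :
  (forall r : R, 0 <= r <= 1 -> differentiable f (p + r *: u)) ->
  exists2 c : R, 0 < c < 1 & f (p + u) - f p = 'D_u f (p + c *: u).
Proof.
move=> df.
have [||c] := @MVT R (fun r => f (p + r *: u)) (fun r => 'D_u f (p + r *: u)) 0 1 ltr01.
- move=> r; rewrite in_itv /= => /andP[r0 r1]; apply: is_derive_line; apply: df.
  by rewrite !ltW.
- apply: continuous_in_subspaceT => r; rewrite inE /= in_itv /= => r01.
  have [D _] := is_derive_line (df r r01).
  by apply: differentiable_continuous; apply/derivable1_diffP.
rewrite in_itv /= => c01; rewrite scale1r scale0r addr0 subr0 mulr1 => E.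
by exists c.
Qed.

(** The mixed second difference evaluated by two successive applications of the mean
    value theorem; the left side is symmetric in u and v, which is what [schwarzR]
    exploits. *)
Lemma second_difference (R : realType) (V : normedModType R) (D : set V) (f : V -> R) a u v :
  Ck_on 2 D f ->
  (forall r t : R, 0 <= r <= 1 -> 0 <= t <= 1 -> D (a + r *: u + t *: v)) ->
  exists c d : R, [/\ 0 < c < 1, 0 < d < 1 &
    f (a + u + v) - f (a + u) - f (a + v) + f a = 'D_v ('D_u f) (a + c *: u + d *: v)].
Proof.
move=> [df ddf] H.
have i0 : 0 <= (0 : R) <= 1 by rewrite lexx ler01.
have i1 : 0 <= (1 : R) <= 1 by rewrite lexx ler01.
have d1 (r : R) : 0 <= r <= 1 -> differentiable f (a + r *: u + v).
  by move=> r01; apply: df; rewrite -[v]scale1r; exact: H.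
have d0 (r : R) : 0 <= r <= 1 -> differentiable f (a + r *: u).
  by move=> r01; apply: df; rewrite -[X in D X]addr0 -[X in _ + X](scale0r v); exact: H.
have dsh (r : R) : 0 <= r <= 1 -> differentiable (fun x => f (x + v)) (a + r *: u).
  move=> r01; apply: (@differentiable_comp _ _ _ _ (fun x => x + v) f); last exact: d1.
  apply: differentiableD; last exact: differentiable_cst.
  by apply: (@linear_differentiable _ _ _ idfun) => x; exact: cvg_id.
have [|c c01 E] := @mean_value_line R V (fun x => f (x + v) - f x) a u.
  by move=> r r01; apply: differentiableB; [exact: dsh|exact: d0].
have c01' : 0 <= c <= 1 by case/andP: c01 => *; rewrite !ltW.
rewrite [RHS in _ = RHS](_ : _ = 'D_u f (a + c *: u + v) - 'D_u f (a + c *: u)) in E; last first.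
  rewrite -(derive_shift_arg f v); apply: deriveB; apply: diff_derivable; [exact: dsh|exact: d0].
have [|d d01 E2] := @mean_value_line R V ('D_u f) (a + c *: u) v.
  by move=> t t01; have [+ _] := ddf u; apply; exact: H.
exists c, d; split=> //; rewrite -E2 -E.
by rewrite opprB [RHS]addrA [RHS]addrAC.
Qed.

Lemma derive_derive_scale (R : realType) (V : normedModType R) (D : set V) (f : V -> R) u v (s t : R) x :
  open D -> Ck_on 2 D f -> D x ->
  'D_(t *: v) ('D_(s *: u) f) x = t * s * 'D_v ('D_u f) x.
Proof.
move=> oD [df ddf] Dx.
have dc (g : V -> R) w (k : R) y : differentiable g y -> 'D_(k *: w) g y = k * 'D_w g y.
  by move=> dg; rewrite !(deriveE _ dg) linearZ.
have E : \forall y \near x, 'D_(s *: u) f y = s * 'D_u f y.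
  near=> y; apply: dc; apply: df; near: y; exact: open_nbhs_nbhs.
have du : differentiable ('D_u f) x by apply: (ddf u).1.
rewrite (near_eq_derive _ E) dc; last first.
  by apply: (differentiableZ (f := 'D_u f)).
rewrite -mulrA; congr (_ * _).
by apply: (deriveZ (f := 'D_u f)); exact: diff_derivable.
Unshelve. all: by end_near. Qed.

(** The second difference over a small parallelogram equals a mixed derivative at
    nearby points in either order; continuity of both lets the parallelogram shrink. *)
Lemma schwarzR (R : realType) (V : normedModType R) (D : set V) (f : V -> R) a u v :
  open D -> Ck_on 2 D f -> D a -> 'D_v ('D_u f) a = 'D_u ('D_v f) a.
Proof.
move=> oD Cf Da.
have [df ddf] := Cf.
have cuv : {for a, continuous ('D_v ('D_u f))} by have [_ /(_ v)] := ddf u; apply.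
have cvu : {for a, continuous ('D_u ('D_v f))} by have [_ /(_ u)] := ddf v; apply.
apply/eqP; rewrite -subr_eq0 -normr_le0; apply/ler_addgt0Pr => e e0.
rewrite add0r.
have e20 : 0 < e / 2 by rewrite divr_gt0.
have : \forall x \near a, [/\ D x, `|'D_v ('D_u f) a - 'D_v ('D_u f) x| < e / 2 &
                           `|'D_u ('D_v f) a - 'D_u ('D_v f) x| < e / 2].
  have nD : \forall x \near a, D x by exact: open_nbhs_nbhs.
  have nu : \forall x \near a, `|'D_v ('D_u f) a - 'D_v ('D_u f) x| < e / 2.
    exact: ((cvgrPdist_lt _ _).1 cuv _ e20).
  have nv : \forall x \near a, `|'D_u ('D_v f) a - 'D_u ('D_v f) x| < e / 2.
    exact: ((cvgrPdist_lt _ _).1 cvu _ e20).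
  by apply: filterS3 nD nu nv => x *; split.
move=> /nbhs_ballP[d /= d0 Hd].
have n0 : 0 < `|u| + `|v| + 1 by rewrite ltr_wpDl // addr_ge0.
(* The scale s makes the parallelogram with sides s u, s v fit in the ball. *)
have [s s0 sd] : exists2 s : R, 0 < s & s * (2 * (`|u| + `|v| + 1)) = d.
  exists (d / (2 * (`|u| + `|v| + 1))); first by rewrite divr_gt0 // mulr_gt0.
  by rewrite divfK // gt_eqF // mulr_gt0.
have inb (r t : R) : 0 <= r <= 1 -> 0 <= t <= 1 -> ball a d (a + r *: (s *: u) + t *: (s *: v)).
  move=> /andP[r0 r1] /andP[t0 t1]; rewrite -ball_normE /= -addrA opprD addNKr normrN.
  have nr : `|r *: (s *: u)| <= s * `|u|.
    by rewrite !normrZ (ger0_norm r0) (gtr0_norm s0) ler_piMl // mulr_ge0 // ltW.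
  have nt : `|t *: (s *: v)| <= s * `|v|.
    by rewrite !normrZ (ger0_norm t0) (gtr0_norm s0) ler_piMl // mulr_ge0 // ltW.
  apply: le_lt_trans (ler_normD _ _) _; apply: le_lt_trans (lerD nr nt) _.
  by have := mulr_gt0 s0 n0; rewrite -sd; nra.
have [|c1 [c2 [c1i c2i E1]]] := @second_difference R V D f a (s *: u) (s *: v) Cf.
  by move=> r t r01 t01; have [] := Hd _ (inb r t r01 t01).
have [|k1 [k2 [k1i k2i E2]]] := @second_difference R V D f a (s *: v) (s *: u) Cf.
  by move=> r t r01 t01; rewrite addrAC; have [] := Hd _ (inb t r t01 r01).
have W (c : R) : 0 < c < 1 -> 0 <= c <= 1 by case/andP => *; rewrite !ltW.
have [Dx xA _] := Hd _ (inb c1 c2 (W _ c1i) (W _ c2i)).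
have [Dy _ yB] := Hd _ (inb k2 k1 (W _ k2i) (W _ k1i)).
rewrite (derive_derive_scale _ _ _ _ oD Cf Dx) in E1.
rewrite addrAC in Dy yB; rewrite (derive_derive_scale _ _ _ _ oD Cf Dy) in E2.
have s20 : s * s != 0 by rewrite mulf_neq0 // gt_eqF.
move: xA yB E1 E2.
move: ('D_v ('D_u f) (a + c1 *: (s *: u) + c2 *: (s *: v))) => X.
move: ('D_u ('D_v f) (a + k1 *: (s *: v) + k2 *: (s *: u))) => Y.
move: ('D_v ('D_u f) a) ('D_u ('D_v f) a) => A B.
rewrite [a + s *: v + s *: u]addrAC => xA yB E1 E2.
have E : X = Y by apply: (mulfI s20); rewrite -E1 -E2; ring.
rewrite -E distrC in yB; rewrite (splitr e) -(subrKA X).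
by apply: le_trans (ler_normD _ _) _; rewrite lerD // ltW.
Unshelve. all: by end_near. Qed.

Lemma schwarz (R : realType) (V : normedModType R) n (D : set V) (f : V -> 'rV[R]_n) a u v :
  open D -> Ck_on 2 D f -> D a -> 'D_v ('D_u f) a = 'D_u ('D_v f) a.
Proof.
move=> oD Cf Da; have [df ddf] := Cf.
have Cj := (Ck_rVP 2 _ oD).1 Cf.
have H w w' j : ('D_w ('D_w' f) a) 0 j = 'D_w ('D_w' (fun x => f x 0 j)) a.
  rewrite derive_coord; last by apply: (ddf w').1.
  apply: near_eq_derive; near=> x; rewrite derive_coord //; apply: df.
  near: x; exact: open_nbhs_nbhs.
apply/rowP => j.
exact: (etrans (H v u j) (etrans (schwarzR u v oD (Cj j) Da) (esym (H u v j)))).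
Unshelve. all: by end_near. Qed.

(** * The inverse function theorem *)

(** Joins the complete and the normed structures of matrices, as the fixed point
    theorem requires. *)
HB.instance Definition _ (R : realType) (m n : nat) := NormedModule.on 'M[R]_(m, n).

Lemma coord_le_norm (R : realType) n (v : 'rV[R]_n) j : `|v 0 j| <= `|v|.
Proof. by rewrite /Num.Def.normr/= mx_normrE; apply: (le_bigmax _ (fun i => `|v i.1 i.2|) (0, j)). Qed.

Lemma norm_rV_le (R : realType) n (v : 'rV[R]_n) (e : R) :
  0 <= e -> (forall j, `|v 0 j| <= e) -> `|v| <= e.
Proof.
by move=> e0 H; rewrite /Num.Def.normr/= mx_normrE (bigmax_le _ e0)//= => -[i j] _; rewrite ord1.
Qed.

Lemma norm_mulmx_le (R : realType) n p (B : 'M[R]_(n, p)) :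
  exists2 C : R, 0 < C & forall v : 'rV[R]_n, `|v *m B| <= C * `|v|.
Proof.
pose C := 1 + \sum_i \sum_j `|B i j|.
have C0 : 0 < C by rewrite ltr_pwDl // sumr_ge0 // => i _; rewrite sumr_ge0.
exists C => // v; apply: norm_rV_le => [|j]; first by rewrite mulr_ge0 // ltW.
rewrite mxE; apply: le_trans (ler_norm_sum _ _ _) _.
rewrite mulrDl mul1r mulr_suml; apply: ler_wpDl => //.
apply: ler_sum => i _; rewrite normrM mulrC ler_pM //; last exact: coord_le_norm.
by rewrite (bigD1 j) //= lerDl sumr_ge0.
Qed.

Lemma continuous_mulmxr (R : realType) n p (B : 'M[R]_(n, p)) :
  continuous (fun v : 'rV[R]_n => v *m B).
Proof.
move=> a; have oT : open [set: 'rV[R]_n] by exact: openT.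
exact: (@Ck_mulmxr R 0 'rV[R]_n n p setT id B oT (Ck_id 0 _) a I).
Qed.

(** The factor n comes from bounding each coordinate by the sum of n partial
    derivatives in the maximum norm. *)
Lemma lipschitz_partials (R : realType) n p (r : 'rV[R]_n -> 'rV[R]_p) a (rho e : R) :
  0 <= e -> (forall x, ball a rho x -> differentiable r x) ->
  (forall x i j, ball a rho x -> `|('D_(delta_mx 0 i) r x) 0 j| <= e) ->
  forall x y, ball a rho x -> ball a rho y -> `|r y - r x| <= n%:R * e * `|y - x|.
Proof.
move=> e0 dr pr x y bx yb.
have C0 : 0 <= n%:R * e * `|y - x| by rewrite !mulr_ge0.
apply: norm_rV_le => // j.
have inb (t : R) : 0 <= t <= 1 -> ball a rho (x + t *: (y - x)).
  move=> /andP[t0 t1]; move: bx yb; rewrite -!ball_normE /= => bx yb.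
  have -> : a - (x + t *: (y - x)) = (1 - t) *: (a - x) + t *: (a - y).
    by apply/rowP => i; rewrite !mxE; ring.
  apply: le_lt_trans (ler_normD _ _) _; rewrite !normrZ !ger0_norm ?subr_ge0 //.
  have [->|tn0] := eqVneq t 0; first by rewrite subr0 mul1r mul0r addr0.
  have tp : 0 < t by rewrite lt_def tn0.
  have h1 : 0 <= (1 - t) * (rho - `|a - x|) by rewrite mulr_ge0 // subr_ge0 // ltW.
  have h2 : 0 < t * (rho - `|a - y|) by rewrite mulr_gt0 // subr_gt0.
  by nra.
have dj t : 0 <= t <= 1 -> differentiable (fun z => r z 0 j) (x + t *: (y - x)).
  by move=> /inb/dr /differentiable_rVP; exact.
have [c /andP[c0 c1]] := mean_value_line dj.
have /inb cb : 0 <= c <= 1 by rewrite !ltW.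
rewrite subrKC !mxE => ->; rewrite -derive_coord; last exact: dr.
rewrite derive_rV_sum; last exact: dr.
rewrite summxE; apply: le_trans (ler_norm_sum _ _ _) _.
rewrite -mulrA -[X in X%:R * _](card_ord n) mulr_natl -sumr_const.
apply: ler_sum => i _; rewrite mxE normrM mulrC ler_pM //; first exact: pr.
exact: coord_le_norm.
Qed.

(** Where the derivative is the identity, f - id has small derivative nearby; hence
    f is a perturbation of the identity by a contraction, and its derivative stays
    injective. *)
Lemma half_lipschitz_near (R : realType) n (D : set 'rV[R]_n) (f : 'rV[R]_n -> 'rV[R]_n) a :
  open D -> smooth_on D f -> D a -> (forall v, 'D_v f a = v) ->
  exists2 rho : R, 0 < rho & ball a rho `<=` D /\
   (forall x y, ball a rho x -> ball a rho y ->
     `|(f y - y) - (f x - x)| <= 2^-1 * `|y - x|) /\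
   (forall x v, ball a rho x -> 'D_v f x = 0 -> v = 0).
Proof.
move=> oD sf Da dfa.
(* The bound e on the partial derivatives is such that n e <= 1 / 2, also for n = 0. *)
pose r := fun x => f x - x; pose e : R := (2 * n.+1%:R)^-1.
have e0 : 0 < e by rewrite invr_gt0 mulr_gt0.
have did x : differentiable (id : 'rV[R]_n -> 'rV[R]_n) x by have [+ _] := Ck_id 1 (setT : set 'rV[R]_n); exact.
have df x : D x -> differentiable f x by exact: smooth_differentiable.
have dr x : D x -> differentiable r x by move=> Dx; apply: differentiableB => //; exact: df.
have Dr x v : D x -> 'D_v r x = 'D_v f x - v.
  move=> Dx; rewrite -[X in _ - X](derive_id x v); apply: deriveB; apply: diff_derivable => //; exact: df.
have near1 (i j : 'I_n) : \forall x \near a, `|('D_(delta_mx 0 i) r x) 0 j| <= e.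
  have nD : \forall x \near a, D x by exact: open_nbhs_nbhs.
  have ci := smooth_derive (delta_mx 0 i) sf 0%N _ Da.
  have cj : {for a, continuous (fun x => ('D_(delta_mx 0 i) f x) 0 j)}.
    by apply: (@continuous_comp _ _ _ _ (fun M : 'rV[R]_n => M 0 j : R)) => //; exact: coord_continuous.
  have : \forall x \near a, `|('D_(delta_mx 0 i) f a) 0 j - ('D_(delta_mx 0 i) f x) 0 j| <= e.
    exact: ((cvgrPdist_le _ _).1 cj _ e0).
  apply: filterS2 nD => x Dx; rewrite Dr // !mxE (dfa _) !mxE.
  by rewrite distrC.
have : \forall x \near a, D x /\ forall i j, `|('D_(delta_mx 0 i) r x) 0 j| <= e.
  apply: filterI; first exact: open_nbhs_nbhs.
  have near2 i : \forall x \near a, forall j : 'I_n, `|('D_(delta_mx 0 i) r x) 0 j| <= e.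
    exact: filter_forall (near1 i).
  exact: filter_forall near2.
move=> /nbhs_ballP[rho /= rho0 H]; exists rho => //.
have ne : n%:R * e <= 2^-1.
  rewrite /e invfM mulrCA ler_piMr ?invr_ge0 // ler_pdivrMr ?ltr0Sn // mul1r.
  by rewrite ler_nat.
split; first by move=> x /H[].
split.
  move=> x y bx yb; apply: le_trans (@lipschitz_partials R n n r a rho e (ltW e0) _ _ x y bx yb) _.
  - by move=> z /H[/dr].
  - by move=> z i j /H[_]; exact.
  - by rewrite ler_wpM2r.
move=> x v /H[Dx pr] dv0.
have : `|v| <= 2^-1 * `|v|.
  have nv : `|'D_v r x| = `|v| by rewrite Dr // dv0 sub0r normrN.
  rewrite -{1}nv; apply: norm_rV_le => [|j]; first by rewrite mulr_ge0 // invr_ge0.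
  rewrite derive_rV_sum; last exact: dr.
  rewrite summxE; apply: le_trans (ler_norm_sum _ _ _) _.
  apply: le_trans (_ : n%:R * e * `|v| <= _); last by rewrite ler_wpM2r.
  rewrite -mulrA -[X in X%:R * _](card_ord n) mulr_natl -sumr_const.
  apply: ler_sum => i _; rewrite mxE normrM mulrC ler_pM //.
  exact: coord_le_norm.
rewrite -subr_ge0 -{2}[`|v|]mul1r -mulrBl => h.
by apply/eqP; rewrite -normr_le0; have := normr_ge0 v; nra.
Qed.

Lemma smooth_comp (R : realType) (V : normedModType R) n p (D : set V) (E : set 'rV[R]_n)
    (f : V -> 'rV[R]_n) (g : 'rV[R]_n -> 'rV[R]_p) :
  open D -> open E -> (forall a, D a -> E (f a)) ->
  smooth_on D f -> smooth_on E g -> smooth_on D (g \o f).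
Proof. by move=> oD oE DE sf sg k; apply: (Ck_comp oD oE DE (sf k) (sg k)). Qed.

Lemma Ck_J (R : realType) k m n (D : set 'rV[R]_m) (f : 'rV[R]_m -> 'rV[R]_n) i j :
  open D -> smooth_on D f -> Ck_on k D (fun x => ('J f x) i j : R).
Proof.
move=> oD sf; have := smooth_derive (delta_mx 0 i) sf k.
move=> /(Ck_rVP _ _ oD)/(_ j); apply: Ck_on_eq => // a; rewrite inE => Da.
by rewrite smooth_J_row //; exact: smooth_differentiable sf Da.
Qed.

(** Banach fixed point theorem for x |-> y - r x on the closed ball of radius
    rho / 2, which it preserves because y is within rho / 4 of the image of the center. *)
Lemma contraction_solve (R : realType) n (r : 'rV[R]_n -> 'rV[R]_n) a y (rho : R) :
  0 < rho ->
  (forall x x', ball a rho x -> ball a rho x' -> `|r x' - r x| <= 2^-1 * `|x' - x|) ->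
  `|y - (a + r a)| <= rho / 4 ->
  exists2 x, ball a rho x & x + r x = y.
Proof.
move=> rho0 Lr yr; pose U := [set x : 'rV[R]_n | `|x - a| <= rho / 2].
have UB x : U x -> ball a rho x.
  by rewrite /U -ball_normE /= distrC => h; apply: le_lt_trans h _; rewrite ltr_pdivrMr // ltr_pMr // ltr1n.
have aa : ball a rho a by exact: ballxx.
have TU x : U x -> U (y - r x).
  move=> Ux; rewrite /U /=.
  have -> : y - r x - a = (y - (a + r a)) - (r x - r a).
    by apply/rowP => i; rewrite !mxE; ring.
  apply: le_trans (ler_normB _ _) _.
  have := Lr _ _ aa (UB _ Ux); have : `|x - a| <= rho / 2 := Ux.
  by lra.
pose T := fun x => y - r x.
have [|||p Up pE] := @banach_fixed_point R _ U (mkfun_fun (f := T) (fun x Ux => TU x Ux)).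
- exists (2^-1)%:nng; split; first by rewrite /= invf_lt1 // ltr1n.
  move=> [x x'] [/= Ux Ux'].
  have -> : T x - T x' = - (r x - r x') by apply/rowP => i; rewrite !mxE; ring.
  rewrite normrN; apply: Lr; exact: UB.
- have cn : continuous (fun x : 'rV[R]_n => `|x - a|).
    move=> x; apply: (@continuous_comp _ _ _ (fun x : 'rV[R]_n => x - a) Num.norm).
      have oT : open [set: 'rV[R]_n] by exact: openT.
      exact: (@Ck_add R 0 'rV[R]_n 'rV[R]_n setT id (fun _ => - a) oT (Ck_id 0 _) (Ck_cst 0 _ _) x I).
    exact: norm_continuous.
  have H : closed ((fun x : 'rV[R]_n => `|x - a|) @^-1` [set t | t <= rho / 2]).
    by apply: preimage_closed; [move=> x _; exact: cn|exact: closed_le].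
  exact: H.
- by exists a; rewrite /U /= subrr normr0 divr_ge0 // ltW.
by exists p; [exact: UB|rewrite {1}pE /= /T subrK].
Qed.

(** The case of derivative the identity suffices: [straightening] modifies the given
    map so that its derivative is the identity. The inverse is Lipschitz, hence
    differentiable, and its derivative is the composite of itself with the inverse
    of the Jacobian, which bootstraps smoothness. *)
Lemma inverse_function (R : realType) n (D : set 'rV[R]_n) (f : 'rV[R]_n -> 'rV[R]_n) a :
  open D -> smooth_on D f -> D a -> (forall v, 'D_v f a = v) ->
  exists (U V : set 'rV[R]_n) (g : 'rV[R]_n -> 'rV[R]_n),
   [/\ open U, U a, U `<=` D, open V &
     [/\ forall x, U x -> V (f x) /\ g (f x) = x,
         forall y, V y -> U (g y) /\ f (g y) = y & smooth_on V g]].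
Proof.
move=> oD sf Da dfa.
have [rho rho0 [BD [Lr inv]]] := half_lipschitz_near oD sf Da dfa.
have r40 : 0 < rho / 4 by rewrite divr_gt0.
pose V := ball (f a) (rho / 4).
have oV : open V by rewrite /V; exact: ball_open.
pose B := ball a rho.
have oB : open B by exact: ball_open.
have cf x : D x -> {for x, continuous f} by exact: (sf 0%N).
pose U := B `&` f @^-1` V.
have oU : open U.
  rewrite openE => x [Bx Vx]; apply: filterI; first exact: open_nbhs_nbhs.
  by apply: (cf x (BD _ Bx)); exact: open_nbhs_nbhs.
have ex y : exists x, V y -> B x /\ f x = y.
  have [Vy|] := pselect (V y); last by exists a.
  have [|x Bx E] := @contraction_solve R n (fun x => f x - x) a y rho rho0 Lr.
    rewrite subrKC; move: Vy; rewrite /V -ball_normE /= distrC; exact: ltW.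
  by exists x => _; split=> //; rewrite -E subrKC.
pose g y := xget a [set x | V y -> B x /\ f x = y].
have gP y : V y -> B (g y) /\ f (g y) = y.
  by rewrite /g; case: xgetP => [x _ //|H Vy]; have [x /H] := ex y.
have Lg y y' : V y -> V y' -> `|g y - g y'| <= 2 * `|y - y'|.
  move=> /gP[By fy] /gP[By' fy'].
  have := Lr _ _ By' By; rewrite fy fy'.
  have -> : g y - g y' = (y - y') - ((y - g y) - (y' - g y')).
    by apply/rowP => i; rewrite !mxE; ring.
  move: (ler_normB (y - y') ((y - g y) - (y' - g y'))).
  by lra.
have fgK x : U x -> V (f x) /\ g (f x) = x.
  move=> [Bx Vx]; split=> //; have [Bg fg] := gP _ Vx.
  have := Lr _ _ Bx Bg; rewrite fg.
  have -> : f x - g (f x) - (f x - x) = - (g (f x) - x).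
    by apply/rowP => i; rewrite !mxE; ring.
  rewrite normrN => h; apply/eqP; rewrite -subr_eq0 -normr_le0.
  by have := normr_ge0 (g (f x) - x); lra.
have gU y : V y -> U (g y) /\ f (g y) = y.
  by move=> Vy; have [Bg fg] := gP _ Vy; split=> //; split=> //; rewrite /preimage /= fg.
have df x : B x -> differentiable f x by move=> /BD; exact: smooth_differentiable.
have uJ x : B x -> 'J f x \in unitmx.
  move=> Bx; rewrite -row_free_unit -kermx_eq0 -submx0.
  apply/rV_subP => v /sub_kermxP vJ; rewrite -deriveEjacobian in vJ; last exact: df.
  by rewrite (inv _ _ Bx vJ) sub0mx.
have dg y : V y -> differentiable g y.
  move=> Vy; have [Bx fx] := gP _ Vy; set x := g y in Bx fx *.
  pose A := invmx ('J f x).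
  apply/diff_epsP; exists (mulmxr A); split; first exact: continuous_mulmxr.
  move=> e e0; have [C C0 HC] := norm_mulmx_le A.
  have e'0 : 0 < e / (2 * C) by rewrite divr_gt0 // mulr_gt0.
  have nV : \forall k \near (0 : 'rV[R]_n), V (k + y).
    apply: (@shift_cvg R 'rV[R]_n y V); exact: open_nbhs_nbhs.
  have [d /= d0 Hd] := (nbhs_ballP _ _).1 (diff_eps (df _ Bx) e'0).
  have nd : \forall k \near (0 : 'rV[R]_n), `|k| < d / 2.
    have d20 : 0 < d / 2 by rewrite divr_gt0.
    have := nbhsx_ballx (0 : 'rV[R]_n) _ d20; apply: filterS => k.
    by rewrite -ball_normE /= sub0r normrN.
  apply: filterS2 nV nd => k Vk kd.
  have [Bk fk] := gP _ Vk; pose h := g (k + y) - x.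
  have hk : `|h| <= 2 * `|k| by have := Lg _ _ Vk Vy; rewrite addrK.
  have /Hd : ball 0 d h.
    by rewrite -ball_normE /= sub0r normrN; apply: le_lt_trans hk _; lra.
  rewrite /= deriveEjacobian; last exact: df.
  rewrite subrK fk fx addrK => rem.
  have -> : g (k + y) - x - k *m A = - ((k - h *m 'J f x) *m A).
    by rewrite mulmxBl -mulmxA mulmxV ?uJ // mulmx1 opprB.
  rewrite normrN; apply: le_trans (HC _) _.
  apply: le_trans (ler_wpM2l (ltW C0) rem) _.
  have -> : C * (e / (2 * C) * `|h|) = e * (`|h| / 2) by field; rewrite gt_eqF.
  by apply: ler_wpM2l; [exact: ltW|move: hk; lra].
have Dg y v : V y -> 'D_v g y = v *m invmx ('J f (g y)).
  move=> Vy; have [Bx fx] := gP _ Vy.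
  have : 'D_v (f \o g) y = v.
    rewrite -[RHS](derive_id y v); apply: near_eq_derive.
    have : \forall z \near y, V z by exact: open_nbhs_nbhs.
    by apply: filterS => z /gP[_].
  rewrite derive_comp; [|exact: dg|exact: df].
  rewrite deriveEjacobian => [H|]; last exact: df.
  exact: (canRL (mulmxK (uJ _ Bx)) H).
exists U, V, g; split=> //.
- by split; [exact: ballxx|rewrite /preimage /V; exact: ballxx].
- by move=> x [/BD].
split=> //; elim=> [|k IH].
  by move=> y /dg; exact: differentiable_continuous.
split=> // v.
have sfB : smooth_on B f by move=> k'; exact: Ck_on_subset (sf k').
have H : Ck_on k B (fun x => v *m invmx ('J f x)).
  apply/Ck_rVP => // j.
  apply: (Ck_on_eq _ _ (@Ck_sum _ _ _ _ B _ (index_enum 'I_n) xpredT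
     (fun i x => v 0 i * invmx ('J f x) i j) oB _)) => // [x _|i _]; first by rewrite mxE.
  apply: Ck_mul => //; first exact: Ck_cst.
  by apply: Ck_invmx => // i' j'; exact: Ck_J.
apply: (Ck_on_eq oV _ (Ck_comp oV oB _ IH H)) => [y|y /gP[]//].
by rewrite inE => Vy; rewrite Dg.
Qed.

(** With K a right inverse of the derivative, the map x |-> x - b0 corrected by K
    applied to the nonlinear part of T has derivative the identity at b0 and turns
    T into a linear map. *)
Lemma straightening (R : realType) N k (D : set 'rV[R]_N) (T : 'rV[R]_N -> 'rV[R]_k) b0
    (K : 'M[R]_(k, N)) :
  open D -> smooth_on D T -> D b0 -> K *m 'J T b0 = 1%:M ->
  exists (U V : set 'rV[R]_N) (f g : 'rV[R]_N -> 'rV[R]_N),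
   [/\ open U, U b0, U `<=` D, open V & f b0 = 0] /\
   [/\ forall x, U x -> V (f x) /\ g (f x) = x,
       forall y, V y -> U (g y) /\ f (g y) = y, smooth_on U f, smooth_on V g
     & forall x, U x -> T x = T b0 + f x *m 'J T b0].
Proof.
move=> oD sT Db0 KP; set P := 'J T b0 in KP *.
pose f x := (x - b0) + (T x - T b0 - (x - b0) *m P) *m K.
have sf : smooth_on D f.
  move=> p; have cx : Ck_on p D (fun x : 'rV[R]_N => x - b0).
    by apply: Ck_add => //; [exact: Ck_id|exact: Ck_cst].
  apply: Ck_add => //; apply: Ck_mulmxr => //; apply: Ck_add => //.
    by apply: Ck_add => //; exact: Ck_cst.
  apply: (@Ck_on_eq _ _ _ _ _ (fun x : 'rV[R]_N => (x - b0) *m (- P))) => //.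
    by move=> x _; rewrite mulmxN.
  exact: Ck_mulmxr.
have dT := smooth_differentiable sT Db0.
have df0 v : 'D_v f b0 = v.
  have did : differentiable (fun x : 'rV[R]_N => x - b0) b0.
    have [+ _] : Ck_on 1 [set: 'rV[R]_N] (fun x : 'rV[R]_N => x - b0).
      by apply: Ck_add; [exact: openT|exact: Ck_id|exact: Ck_cst].
    exact.
  have Did : 'D_v (fun x : 'rV[R]_N => x - b0) b0 = v.
    rewrite -[RHS](derive_id b0 v).
    by rewrite (derive_shift_arg id (- b0)) !derive_id.
  have dm p q (h : 'rV[R]_N -> 'rV[R]_p) (A : 'M[R]_(p, q)) : differentiable h b0 ->
     differentiable (fun x => h x *m A) b0 /\ 'D_v (fun x => h x *m A) b0 = 'D_v h b0 *m A.
    move=> dh; have lA (x : 'rV[R]_p) : differentiable (mulmxr A) x.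
      by apply: linear_differentiable; exact: continuous_mulmxr.
    split; first exact: (differentiable_comp dh (lA _)).
    rewrite [LHS](derive_comp v dh (lA _)) (deriveE _ (lA _)).
    by rewrite diff_lin //; exact: continuous_mulmxr.
  have [d1 D1] := dm _ _ _ P did.
  have dTc : differentiable (fun x => T x - T b0) b0.
    by apply: differentiableB => //; exact: differentiable_cst.
  have DTc : 'D_v (fun x => T x - T b0) b0 = v *m P.
    rewrite -deriveEjacobian // -[RHS]subr0 -(derive_cst (T b0) b0 v).
    by apply: deriveB; apply: diff_derivable => //; exact: differentiable_cst.
  have d2 : differentiable (fun x => T x - T b0 - (x - b0) *m P) b0 by exact: differentiableB.
  have D2 : 'D_v (fun x => T x - T b0 - (x - b0) *m P) b0 = 0.
    rewrite [LHS](deriveB (diff_derivable dTc) (diff_derivable d1)).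
    by rewrite D1 DTc Did subrr.
  have [d3 D3] := dm _ _ _ K d2.
  rewrite [LHS](deriveD (diff_derivable did) (diff_derivable d3)).
  by rewrite D3 D2 Did mul0mx addr0.
have [U [V [g [oU Ub0 UD oV [fgK gfK sg]]]]] := inverse_function oD sf Db0 df0.
exists U, V, f, g; split; split=> //.
- by rewrite /f !subrr mul0mx !subrr mul0mx addr0.
- by move=> p; exact: Ck_on_subset (sf p).
move=> x Ux; rewrite /f mulmxDl -mulmxA KP mulmx1.
by apply/rowP => j; rewrite !mxE; ring.
Qed.

(** * Calculus of complex vector-valued functions and the Lorentz product *)

(** Real directional derivatives of complex functions, matching the convention of
    [cderive]. *)
Definition cder (R : realType) (V : normedModType R) (v : V) (F : V -> complex R) (a : V) : complex R :=
  Complex ('D_v (fun x => complex.Re (F x)) a) ('D_v (fun x => complex.Im (F x)) a).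

Definition cdiff (R : realType) (V : normedModType R) (F : V -> complex R) (a : V) : Prop :=
  differentiable (fun x => complex.Re (F x)) a /\ differentiable (fun x => complex.Im (F x)) a.

Definition vdiff (R : realType) (V : normedModType R) k (F : V -> 'rV[complex R]_k) (a : V) : Prop :=
  differentiable (@revec R k \o F) a /\ differentiable (@imvec R k \o F) a.

Definition Cck (R : realType) (V : normedModType R) p (D : set V) (F : V -> complex R) : Prop :=
  Ck_on p D (fun x => complex.Re (F x)) /\ Ck_on p D (fun x => complex.Im (F x)).

Definition vCk (R : realType) (V : normedModType R) p (D : set V) k (F : V -> 'rV[complex R]_k) : Prop :=
  Ck_on p D (@revec R k \o F) /\ Ck_on p D (@imvec R k \o F).

Lemma eq_derive (R : realType) (V W : normedModType R) (v : V) (f g : V -> W) a :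
  f =1 g -> 'D_v f a = 'D_v g a.
Proof. by move=> /funext ->. Qed.

Lemma cvec_lincomb (R : realType) k (c : R) (X Y X' Y' : 'rV[R]_k) :
  cvec (c *: X + Y) (c *: X' + Y') = (c%:C)%C *: cvec X X' + cvec Y Y'.
Proof. by apply/rowP => j; rewrite !mxE; apply/eqP; rewrite eq_complex /= mul0r mul0r subr0 addr0 !eqxx. Qed.

Lemma complex_ext (R : Type) (x y : complex R) :
  complex.Re x = complex.Re y -> complex.Im x = complex.Im y -> x = y.
Proof. by case: x y => [a b] [c d] /= -> ->. Qed.

Lemma ReM' (R : realType) (x y : complex R) :
  complex.Re (x * y) = complex.Re x * complex.Re y - complex.Im x * complex.Im y.
Proof. by case: x y => [a b] [c d]. Qed.

Lemma ImM' (R : realType) (x y : complex R) :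
  complex.Im (x * y) = complex.Re x * complex.Im y + complex.Im x * complex.Re y.
Proof. by case: x y => [a b] [c d]. Qed.

Lemma ReD' (R : realType) (x y : complex R) : complex.Re (x + y) = complex.Re x + complex.Re y.
Proof. by case: x y => [a b] [c d]. Qed.

Lemma ImD' (R : realType) (x y : complex R) : complex.Im (x + y) = complex.Im x + complex.Im y.
Proof. by case: x y => [a b] [c d]. Qed.

Lemma ReN' (R : realType) (x : complex R) : complex.Re (- x) = - complex.Re x.
Proof. by case: x. Qed.

Lemma ImN' (R : realType) (x : complex R) : complex.Im (- x) = - complex.Im x.
Proof. by case: x. Qed.

Lemma ReV' (R : realType) (x : complex R) :
  complex.Re x^-1 = complex.Re x / (complex.Re x ^+ 2 + complex.Im x ^+ 2).
Proof. by case: x. Qed.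

Lemma ImV' (R : realType) (x : complex R) :
  complex.Im x^-1 = - (complex.Im x / (complex.Re x ^+ 2 + complex.Im x ^+ 2)).
Proof. by case: x => a b /=; rewrite -mulNr. Qed.

Lemma iE (R : realType) : 'i = Complex 0 1 :> complex R.
Proof. by []. Qed.

Lemma conjE (R : realType) (x : complex R) : Num.conj x = Complex (complex.Re x) (- complex.Im x).
Proof. by case: x. Qed.

Lemma cder_add (R : realType) (V : normedModType R) (v : V) (F G : V -> complex R) a :
  cdiff F a -> cdiff G a -> cder v (fun x => F x + G x) a = cder v F a + cder v G a.
Proof.
move=> [F1 F2] [G1 G2]; apply: complex_ext; rewrite ?ReD' ?ImD' /=.
  apply: etrans (deriveD (diff_derivable F1) (diff_derivable G1)).
  by apply: eq_derive => x; rewrite ReD'.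
apply: etrans (deriveD (diff_derivable F2) (diff_derivable G2)).
by apply: eq_derive => x; rewrite ImD'.
Qed.

Lemma cdiff_add (R : realType) (V : normedModType R) (F G : V -> complex R) a :
  cdiff F a -> cdiff G a -> cdiff (fun x => F x + G x) a.
Proof.
move=> [F1 F2] [G1 G2]; split.
  rewrite (_ : (fun x => _) = (fun x => complex.Re (F x)) + (fun x => complex.Re (G x))).
    exact: differentiableD.
  by apply/funext => x; rewrite ReD'.
rewrite (_ : (fun x => _) = (fun x => complex.Im (F x)) + (fun x => complex.Im (G x))).
  exact: differentiableD.
by apply/funext => x; rewrite ImD'.
Qed.

Lemma cdiff_cst (R : realType) (V : normedModType R) (c : complex R) (a : V) : cdiff (fun _ => c) a.
Proof. by split; exact: differentiable_cst. Qed.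

Lemma cder_cst (R : realType) (V : normedModType R) v (c : complex R) (a : V) :
  cder v (fun _ => c) a = 0.
Proof. by apply: complex_ext => /=; exact: derive_cst. Qed.

Lemma cder_mul (R : realType) (V : normedModType R) (v : V) (F G : V -> complex R) a :
  cdiff F a -> cdiff G a ->
  cder v (fun x => F x * G x) a = cder v F a * G a + F a * cder v G a.
Proof.
move=> [F1 F2] [G1 G2].
have M (f g : V -> R) : differentiable f a -> differentiable g a ->
   'D_v (fun x => f x * g x) a = f a * 'D_v g a + g a * 'D_v f a.
  by move=> df dg; exact: (deriveM (diff_derivable df) (diff_derivable dg)).
apply: complex_ext.
  rewrite ReD' !ReM' /=.
  rewrite (_ : (fun x => _) = (fun x => complex.Re (F x) * complex.Re (G x)) -
            (fun x => complex.Im (F x) * complex.Im (G x))); last first.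
    by apply/funext => x; rewrite ReM'.
  rewrite deriveB; last 2 first.
  - by apply: diff_derivable; exact: differentiableM.
  - by apply: diff_derivable; exact: differentiableM.
  by rewrite (M _ _ F1 G1) (M _ _ F2 G2); ring.
rewrite ImD' !ImM' /=.
rewrite (_ : (fun x => _) = (fun x => complex.Re (F x) * complex.Im (G x)) +
            (fun x => complex.Im (F x) * complex.Re (G x))); last first.
  by apply/funext => x; rewrite ImM'.
rewrite deriveD; last 2 first.
- by apply: diff_derivable; exact: differentiableM.
- by apply: diff_derivable; exact: differentiableM.
by rewrite (M _ _ F1 G2) (M _ _ F2 G1); ring.
Qed.

Lemma cdiff_mul (R : realType) (V : normedModType R) (F G : V -> complex R) a :
  cdiff F a -> cdiff G a -> cdiff (fun x => F x * G x) a.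
Proof.
move=> [F1 F2] [G1 G2]; split.
  rewrite (_ : (fun x => _) = (fun x => complex.Re (F x)) * (fun x => complex.Re (G x)) -
            (fun x => complex.Im (F x)) * (fun x => complex.Im (G x))).
    by apply: differentiableB; exact: differentiableM.
  by apply/funext => x; rewrite ReM'.
rewrite (_ : (fun x => _) = (fun x => complex.Re (F x)) * (fun x => complex.Im (G x)) +
            (fun x => complex.Im (F x)) * (fun x => complex.Re (G x))).
  by apply: differentiableD; exact: differentiableM.
by apply/funext => x; rewrite ImM'.
Qed.

Lemma cdiff_cder_sum (R : realType) (V : normedModType R) (v : V) (I : Type) (s : seq I)
    (F : I -> V -> complex R) a :
  (forall i, cdiff (F i) a) -> cdiff (fun x => \sum_(i <- s) F i x) a /\
  cder v (fun x => \sum_(i <- s) F i x) a = \sum_(i <- s) cder v (F i) a.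
Proof.
move=> dF; elim: s => [|i s [d E]].
  rewrite big_nil (_ : (fun x => _) = fun _ => 0); last by apply/funext => x; rewrite big_nil.
  by split; [exact: cdiff_cst|exact: cder_cst].
rewrite big_cons (_ : (fun x => _) = fun x => F i x + \sum_(j <- s) F j x); last first.
  by apply/funext => x; rewrite big_cons.
by split; [exact: cdiff_add|rewrite cder_add // E].
Qed.

Lemma near_eq_cder (R : realType) (V : normedModType R) (v : V) (F G : V -> complex R) a :
  (\forall x \near a, F x = G x) -> cder v F a = cder v G a.
Proof.
by move=> FG; apply: complex_ext => /=; apply: near_eq_derive; apply: filterS FG => x ->.
Qed.

Lemma near_eq_cderive (R : realType) (V : normedModType R) k (v : V) (F G : V -> 'rV[complex R]_k) a :
  (\forall x \near a, F x = G x) -> cderive v F a = cderive v G a.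
Proof.
move=> FG; rewrite /cderive (near_eq_derive (g := @revec R k \o G) v); last first.
  by apply: filterS FG => x /= ->.
rewrite (near_eq_derive (f := @imvec R k \o F) (g := @imvec R k \o G) v) //.
by apply: filterS FG => x /= ->.
Qed.

Lemma vdiffP (R : realType) (V : normedModType R) k (F : V -> 'rV[complex R]_k) a :
  vdiff F a <-> forall j, cdiff (fun x => F x 0 j) a.
Proof.
have E1 j : (fun x => complex.Re (F x 0 j)) = (fun x => (revec (F x)) 0 j).
  by apply/funext => x; rewrite mxE.
have E2 j : (fun x => complex.Im (F x 0 j)) = (fun x => (imvec (F x)) 0 j).
  by apply/funext => x; rewrite mxE.
split=> [[/differentiable_rVP F1 /differentiable_rVP F2] j|H].
  by split; rewrite ?E1 ?E2; [exact: F1|exact: F2].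
split; apply/differentiable_rVP => j; have [H1 H2] := H j.
  by rewrite E1 in H1.
by rewrite E2 in H2.
Qed.

Lemma cderive_coord (R : realType) (V : normedModType R) k (v : V) (F : V -> 'rV[complex R]_k) a j :
  vdiff F a -> (cderive v F a) 0 j = cder v (fun x => F x 0 j) a.
Proof.
move=> [F1 F2]; rewrite mxE !derive_coord //.
by apply: complex_ext; apply: eq_derive => x; rewrite /= mxE.
Qed.

Lemma lorDl (K : comNzRingType) n (Y Y' Z : 'rV[K]_(1 + n)) :
  lor (Y + Y') Z = lor Y Z + lor Y' Z.
Proof.
rewrite /lor mxE mulrDl opprD addrACA; congr (_ + _).
by rewrite -big_split; apply: eq_bigr => i _; rewrite mxE mulrDl.
Qed.

Lemma lorC (K : comNzRingType) n (Y Z : 'rV[K]_(1 + n)) : lor Y Z = lor Z Y.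
Proof. by rewrite /lor mulrC; congr (_ + _); apply: eq_bigr => i _; rewrite mulrC. Qed.

Lemma lorDr (K : comNzRingType) n (Y Z Z' : 'rV[K]_(1 + n)) :
  lor Y (Z + Z') = lor Y Z + lor Y Z'.
Proof. by rewrite lorC lorDl !(lorC Y). Qed.

Lemma lorZl (K : comNzRingType) n (c : K) (Y Z : 'rV[K]_(1 + n)) :
  lor (c *: Y) Z = c * lor Y Z.
Proof.
rewrite /lor mxE mulrDr mulrN mulrA; congr (_ + _).
by rewrite mulr_sumr; apply: eq_bigr => i _; rewrite mxE mulrA.
Qed.

Lemma lorZr (K : comNzRingType) n (c : K) (Y Z : 'rV[K]_(1 + n)) :
  lor Y (c *: Z) = c * lor Y Z.
Proof. by rewrite lorC lorZl lorC. Qed.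

Lemma lor0l (K : comNzRingType) n (Z : 'rV[K]_(1 + n)) : lor 0 Z = 0.
Proof. by rewrite -(scale0r 0) lorZl mul0r. Qed.

Lemma lor0r (K : comNzRingType) n (Z : 'rV[K]_(1 + n)) : lor Z 0 = 0.
Proof. by rewrite lorC lor0l. Qed.

Lemma lorNl (K : comNzRingType) n (Y Z : 'rV[K]_(1 + n)) : lor (- Y) Z = - lor Y Z.
Proof. by rewrite -scaleN1r lorZl mulN1r. Qed.

Lemma lorNr (K : comNzRingType) n (Y Z : 'rV[K]_(1 + n)) : lor Y (- Z) = - lor Y Z.
Proof. by rewrite lorC lorNl lorC. Qed.

Lemma lor_suml (K : comNzRingType) n (I : finType) (Y : I -> 'rV[K]_(1 + n)) Z :
  lor (\sum_i Y i) Z = \sum_i lor (Y i) Z.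
Proof.
apply: (big_ind2 (fun a b => lor a Z = b)) => //; first exact: lor0l.
by move=> a b a' b' <- <-; rewrite lorDl.
Qed.

Lemma lor_row_mx (K : comNzRingType) n (a b : K) (u w : 'rV[K]_n) :
  lor (row_mx a%:M u : 'rV[K]_(1 + n)) (row_mx b%:M w) = - (a * b) + (u *m w^T) 0 0.
Proof.
rewrite /lor (_ : 0 = lshift n (0 : 'I_1)); last exact: val_inj.
rewrite !row_mxEl !mxE eqxx !mulr1n; congr (_ + _).
by apply: eq_bigr => i _; rewrite !row_mxEr mxE.
Qed.

Lemma row_mxE1 (K : comNzRingType) n (Y : 'rV[K]_(1 + n)) :
  Y = row_mx (Y 0 0)%:M (rsubmx Y).
Proof.
rewrite -[LHS]hsubmxK; congr (row_mx _ _); apply/rowP => i; rewrite !ord1 !mxE mulr1n.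
by congr (Y _ _); apply: val_inj.
Qed.

Lemma cder_lor (R : realType) (V : normedModType R) n (v : V) (F G : V -> 'rV[complex R]_(1 + n)) a :
  vdiff F a -> vdiff G a ->
  cder v (fun x => lor (F x) (G x)) a = lor (cderive v F a) (G a) + lor (F a) (cderive v G a).
Proof.
move=> dF dG; have cF := (vdiffP _ _).1 dF; have cG := (vdiffP _ _).1 dG.
have E j := cder_mul v (cF j) (cG j).
have [d S] := cdiff_cder_sum v (index_enum 'I_n) (fun i : 'I_n => cdiff_mul (cF (rshift 1 i)) (cG (rshift 1 i))).
have dN : cdiff (fun x => (-1) * (F x 0 0 * G x 0 0)) a.
  by apply: cdiff_mul; [exact: cdiff_cst|exact: cdiff_mul].
have -> : (fun x => lor (F x) (G x)) = (fun x => (-1) * (F x 0 0 * G x 0 0) +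
   \sum_(i < n) F x 0 (rshift 1 i) * G x 0 (rshift 1 i)).
  by apply/funext => x; rewrite /lor mulN1r.
rewrite cder_add // S cder_mul; [|exact: cdiff_cst|exact: cdiff_mul].
rewrite cder_cst mul0r add0r E /lor mulN1r.
have cE j : (cder v (fun x => F x 0 j) a * G a 0 j + F a 0 j * cder v (fun x => G x 0 j) a) =
   cderive v F a 0 j * G a 0 j + F a 0 j * cderive v G a 0 j.
  by rewrite (cderive_coord v j dF) (cderive_coord v j dG).
rewrite cE (eq_bigr _ (fun i _ => etrans (E (rshift 1 i)) (cE (rshift 1 i)))).
by rewrite big_split /= opprD addrACA.
Qed.

Lemma cderive_comp (R : realType) (U V : normedModType R) k (f : U -> V)
    (F : V -> 'rV[complex R]_k) a v :
  differentiable f a -> vdiff F (f a) ->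
  cderive v (F \o f) a = cderive ('D_v f a) F (f a).
Proof.
move=> df [F1 F2].
exact: (f_equal2 (@cvec R k) (derive_comp v df F1) (derive_comp v df F2)).
Qed.

Lemma vdiff_comp (R : realType) (U V : normedModType R) k (f : U -> V)
    (F : V -> 'rV[complex R]_k) a :
  differentiable f a -> vdiff F (f a) -> vdiff (F \o f) a.
Proof.
move=> df [F1 F2]; split.
  exact: (differentiable_comp df F1).
exact: (differentiable_comp df F2).
Qed.

Lemma cderive_rV_sum (R : realType) n k (F : 'rV[R]_n -> 'rV[complex R]_k) a v :
  vdiff F a -> cderive v F a = \sum_j ((v 0 j)%:C)%C *: cderive (delta_mx 0 j) F a.
Proof.
move=> [F1 F2]; rewrite /cderive (derive_rV_sum v F1) (derive_rV_sum v F2).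
elim/big_rec3: _ => [|j X Y Z _ <-]; last exact: cvec_lincomb.
by apply/rowP => j; rewrite !mxE.
Qed.

Lemma cderive_scale (R : realType) (V : normedModType R) k (v : V) (c : V -> complex R)
    (F : V -> 'rV[complex R]_k) a :
  cdiff c a -> vdiff F a ->
  vdiff (fun x => c x *: F x) a /\
  cderive v (fun x => c x *: F x) a = cder v c a *: F a + c a *: cderive v F a.
Proof.
move=> dc dF; have cF := (vdiffP _ _).1 dF.
have E j : (fun x => (c x *: F x) 0 j) = (fun x => c x * F x 0 j).
  by apply/funext => x; rewrite mxE.
have d : vdiff (fun x => c x *: F x) a.
  by apply/vdiffP => j; rewrite E; exact: cdiff_mul.
split=> //; apply/rowP => j; rewrite cderive_coord // E cder_mul // !mxE.
by rewrite -cderive_coord // !mxE.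
Qed.

Lemma Cck_mul (R : realType) (V : normedModType R) p (D : set V) (F G : V -> complex R) :
  open D -> Cck p D F -> Cck p D G -> Cck p D (fun x => F x * G x).
Proof.
move=> oD [F1 F2] [G1 G2]; split.
  apply: (Ck_on_eq oD _ (Ck_add oD (Ck_mul oD F1 G1) (Ck_opp oD (Ck_mul oD F2 G2)))) => x _.
  by rewrite ReM'.
apply: (Ck_on_eq oD _ (Ck_add oD (Ck_mul oD F1 G2) (Ck_mul oD F2 G1))) => x _.
by rewrite ImM'.
Qed.

Lemma Cck_inv (R : realType) (V : normedModType R) p (D : set V) (F : V -> complex R) :
  open D -> (forall a, D a -> F a != 0) -> Cck p D F -> Cck p D (fun x => (F x)^-1).
Proof.
move=> oD F0 [F1 F2].
have N : Ck_on p D (fun x => (complex.Re (F x) * complex.Re (F x) + complex.Im (F x) * complex.Im (F x))^-1).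
  apply: Ck_inv => // [a Da|]; last by apply: Ck_add => //; exact: Ck_mul.
  have := F0 a Da; apply: contraNneq => /eqP; rewrite -!expr2 paddr_eq0 ?sqr_ge0 // !sqrf_eq0.
  by move=> /andP[/eqP r0 /eqP i0]; apply/eqP/complex_ext.
split.
  by apply: (Ck_on_eq oD _ (Ck_mul oD F1 N)) => x _; rewrite ReV' !expr2.
by apply: (Ck_on_eq oD _ (Ck_opp oD (Ck_mul oD F2 N))) => x _; rewrite ImV' !expr2.
Qed.

Lemma vCkP (R : realType) (V : normedModType R) p (D : set V) k (F : V -> 'rV[complex R]_k) :
  open D -> vCk p D F <-> forall j, Cck p D (fun x => F x 0 j).
Proof.
move=> oD; split=> [[F1 F2] j|H].
  split; [apply: (Ck_on_eq oD _ ((Ck_rVP p _ oD).1 F1 j))|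
          apply: (Ck_on_eq oD _ ((Ck_rVP p _ oD).1 F2 j))] => x _; by rewrite /= mxE.
split; apply/Ck_rVP => // j; have [H1 H2] := H j.
  by apply: (Ck_on_eq oD _ H1) => x _; rewrite /= mxE.
by apply: (Ck_on_eq oD _ H2) => x _; rewrite /= mxE.
Qed.

Lemma vCk_scale (R : realType) (V : normedModType R) p (D : set V) k (c : V -> complex R)
    (F : V -> 'rV[complex R]_k) :
  open D -> Cck p D c -> vCk p D F -> vCk p D (fun x => c x *: F x).
Proof.
move=> oD Cc CF; apply/(vCkP _ _ oD) => j.
have [H1 H2] := Cck_mul oD Cc ((vCkP _ _ oD).1 CF j).
by split; [apply: (Ck_on_eq oD _ H1)|apply: (Ck_on_eq oD _ H2)] => x _; rewrite mxE.
Qed.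

Lemma cvecK1 (R : realType) k (X Y : 'rV[R]_k) : revec (cvec X Y) = X.
Proof. by apply/rowP => j; rewrite !mxE. Qed.

Lemma cvecK2 (R : realType) k (X Y : 'rV[R]_k) : imvec (cvec X Y) = Y.
Proof. by apply/rowP => j; rewrite !mxE. Qed.

Lemma cvecE (R : realType) k (Z : 'rV[complex R]_k) : Z = cvec (revec Z) (imvec Z).
Proof. by apply/rowP => j; rewrite !mxE; apply: complex_ext. Qed.

Lemma vCk_cvec (R : realType) (V : normedModType R) p (D : set V) k (X Y : V -> 'rV[R]_k) :
  open D -> Ck_on p D X -> Ck_on p D Y -> vCk p D (fun a => cvec (X a) (Y a)).
Proof.
move=> oD CX CY; split.
  by apply: (Ck_on_eq oD _ CX) => x _; rewrite /= cvecK1.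
by apply: (Ck_on_eq oD _ CY) => x _; rewrite /= cvecK2.
Qed.

Lemma cderive_cvec (R : realType) (V : normedModType R) k (X Y : V -> 'rV[R]_k) v a :
  cderive v (fun a => cvec (X a) (Y a)) a = cvec ('D_v X a) ('D_v Y a).
Proof.
have E1 : 'D_v (@revec R k \o (fun a => cvec (X a) (Y a))) a = 'D_v X a.
  by apply: eq_derive => x; exact: cvecK1.
have E2 : 'D_v (@imvec R k \o (fun a => cvec (X a) (Y a))) a = 'D_v Y a.
  by apply: eq_derive => x; exact: cvecK2.
by rewrite /cderive E1 E2.
Qed.

Lemma vCk_cderive (R : realType) (V : normedModType R) p (D : set V) k
    (F : V -> 'rV[complex R]_k) v :
  open D -> vCk p.+1 D F -> vCk p D (cderive v F).
Proof. by move=> oD [[_ F1] [_ F2]]; exact: (vCk_cvec oD (F1 v) (F2 v)). Qed.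

Lemma vCk_vdiff (R : realType) (V : normedModType R) p (D : set V) k
    (F : V -> 'rV[complex R]_k) a : vCk p.+1 D F -> D a -> vdiff F a.
Proof. by move=> [[F1 _] [F2 _]] Da; split; [exact: F1|exact: F2]. Qed.

Lemma Cck_cdiff (R : realType) (V : normedModType R) p (D : set V)
    (F : V -> complex R) a : Cck p.+1 D F -> D a -> cdiff F a.
Proof. by move=> [[F1 _] [F2 _]] Da; split; [exact: F1|exact: F2]. Qed.

Lemma vschwarz (R : realType) (V : normedModType R) (D : set V) k
    (F : V -> 'rV[complex R]_k) u v a :
  open D -> vCk 2 D F -> D a ->
  cderive v (cderive u F) a = cderive u (cderive v F) a.
Proof.
move=> oD [F1 F2] Da; apply: etrans (cderive_cvec _ _ _ _) _.
apply: etrans (esym (cderive_cvec _ _ _ _)).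
exact: (f_equal2 (@cvec R k) (schwarz u v oD F1 Da) (schwarz u v oD F2 Da)).
Qed.

Lemma vCk_comp (R : realType) (V : normedModType R) p n (D : set V) (E : set 'rV[R]_n) k
    (F : 'rV[R]_n -> 'rV[complex R]_k) (f : V -> 'rV[R]_n) :
  open D -> open E -> (forall a, D a -> E (f a)) ->
  Ck_on p D f -> vCk p E F -> vCk p D (F \o f).
Proof.
move=> oD oE DE Cf [F1 F2]; split.
  exact: (Ck_comp oD oE DE Cf F1).
exact: (Ck_comp oD oE DE Cf F2).
Qed.

Lemma vCk_subset (R : realType) (V : normedModType R) p (D E : set V) k
    (F : V -> 'rV[complex R]_k) : D `<=` E -> vCk p E F -> vCk p D F.
Proof. by move=> DE [F1 F2]; split; [exact: Ck_on_subset F1|exact: Ck_on_subset F2]. Qed.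

(** * Expansion of light-cone vectors in the moving frame *)

Lemma mulmx1_swap (K : fieldType) p n (A : 'M[K]_(p, n)) (B : 'M[K]_(n, p)) :
  p = n -> A *m B = 1%:M -> B *m A = 1%:M.
Proof. by move=> e; case: n / e A B => A B; exact: mulmx1C. Qed.

(** The vectors f, n1, n2 and the rows of J form a basis adapted to the orthogonal
    splitting; the sum of the projections is the identity because a one-sided
    inverse of a square matrix is two-sided. *)
Lemma frame_identity (K : fieldType) m (f n1 n2 : 'rV[K]_(m + 3)) (J : 'M[K]_(m, m + 3))
    (Gi : 'M[K]_m) :
  [/\ f *m f^T = 1%:M, n1 *m n1^T = 1%:M & n2 *m n2^T = 1%:M] ->
  [/\ n1 *m f^T = 0, n2 *m f^T = 0 & n1 *m n2^T = 0] ->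
  [/\ J *m f^T = 0, J *m n1^T = 0 & J *m n2^T = 0] ->
  J *m J^T *m Gi = 1%:M ->
  f^T *m f + n1^T *m n1 + n2^T *m n2 + J^T *m Gi *m J = 1%:M.
Proof.
move=> [ff nn1 nn2] [n1f n2f n12] [Jf Jn1 Jn2] JG.
have tr0 p q (A : 'M[K]_(p, m + 3)) (B : 'M[K]_(q, m + 3)) : A *m B^T = 0 -> B *m A^T = 0.
  by move=> AB; rewrite -[LHS]trmxK trmx_mul trmxK AB trmx0.
pose A := col_mx f (col_mx n1 (col_mx n2 J)).
pose B := row_mx f^T (row_mx n1^T (row_mx n2^T (J^T *m Gi))).
have AB : A *m B = 1%:M.
  rewrite /A /B !mul_col_row !mul_mx_row !mul_col_mx.
  rewrite !(mulmxA _ J^T Gi) ff nn1 nn2 n1f n2f n12 Jf Jn1 Jn2 (tr0 _ _ _ _ n1f) (tr0 _ _ _ _ n2f)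
     (tr0 _ _ _ _ n12) (tr0 _ _ _ _ Jf) (tr0 _ _ _ _ Jn1) (tr0 _ _ _ _ Jn2) JG !mul0mx.
  by rewrite !row_mx0 !col_mx0 -!scalar_mx_block.
have e : (1 + (1 + (1 + m)) = m + 3)%N by rewrite addn3.
have := mulmx1_swap e AB.
by rewrite /A /B !mul_row_col !addrA.
Qed.

Section Polar.
Variables (K : fieldType) (n m : nat) (f n1 n2 : 'rV[K]_n) (J : 'M[K]_(m, n)) (Gi : 'M[K]_m).
Variables (H1 H2 : K).
Hypothesis id1 : f^T *m f + n1^T *m n1 + n2^T *m n2 + J^T *m Gi *m J = 1%:M.
Let X : 'rV[K]_(1 + n) := row_mx 1%:M f.
Let xi1 : 'rV[K]_(1 + n) := row_mx H1%:M (n1 + H1 *: f).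
Let xi2 : 'rV[K]_(1 + n) := row_mx H2%:M (n2 + H2 *: f).

Lemma lor_polar0 (w : 'rV[K]_(1 + n)) : lor w X = 0 -> w 0 0 = (rsubmx w *m f^T) 0 0.
Proof.
rewrite {1}(row_mxE1 w) lor_row_mx mulr1 => /eqP.
by rewrite addrC subr_eq0 => /eqP.
Qed.

(** For a vector w orthogonal to X = (1, f), the product with the sphere lift of a
    normal is an ordinary inner product, whatever the multiple h of X involved. *)
Lemma lor_polar1 (w : 'rV[K]_(1 + n)) (h : K) (nu : 'rV[K]_n) : lor w X = 0 ->
  lor w (row_mx h%:M (nu + h *: f)) = (rsubmx w *m nu^T) 0 0.
Proof.
move=> /lor_polar0 w0; rewrite {1}(row_mxE1 w) lor_row_mx linearD /= linearZ /= mulmxDr.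
by rewrite -scalemxAr mxE [X in _ + (_ + X)]mxE w0; ring.
Qed.

Lemma mulmx_outer p q (u : 'rV[K]_p) (x : 'rV[K]_p) (y : 'rV[K]_q) :
  u *m (x^T *m y) = (u *m x^T) 0 0 *: y.
Proof. by rewrite mulmxA {1}[u *m x^T]mx11_scalar mul_scalar_mx. Qed.

(** Modulo X, the orthogonal complement of X is spanned by the derivatives of X and
    the two sphere lifts, which are orthonormal and orthogonal to those derivatives;
    the component along X contributes nothing as X is light-like. *)
Lemma polar_product (w w' : 'rV[K]_(1 + n)) : lor w X = 0 -> lor w' X = 0 ->
  lor w w' = (rsubmx w *m J^T *m Gi *m (rsubmx w' *m J^T)^T) 0 0 +
     lor w xi1 * lor w' xi1 + lor w xi2 * lor w' xi2.
Proof.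
move=> w0 w0'; rewrite !lor_polar1 //.
rewrite {1}(row_mxE1 w) {1}(row_mxE1 w') lor_row_mx (lor_polar0 w0) (lor_polar0 w0').
set u := rsubmx w; set u' := rsubmx w'.
have -> : u *m u'^T = u *m (f^T *m f + n1^T *m n1 + n2^T *m n2 + J^T *m Gi *m J) *m u'^T.
  by rewrite id1 mulmx1.
have T (x : 'rV[K]_n) : (x *m u'^T) 0 0 = (u' *m x^T) 0 0.
  by rewrite -[x in LHS]trmxK -trmx_mul mxE.
rewrite !mulmxDr !mulmx_outer !mulmxDl -!scalemxAl trmx_mul trmxK !mulmxA.
have Dm (A B : 'M[K]_1) : (A + B) 0 0 = A 0 0 + B 0 0 by rewrite mxE.
have Zm c (A : 'M[K]_1) : (c *: A) 0 0 = c * A 0 0 by rewrite mxE.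
by rewrite !Dm !Zm !T; ring.
Qed.

(** Orthogonality to xi = xi1 - i xi2 makes the normal part of w proportional to xi,
    since i is a square root of -1. *)
Lemma polar_expand (i : K) (w : 'rV[K]_(1 + n)) : i * i = -1 ->
  lor w X = 0 -> rsubmx w *m J^T = 0 -> lor w (xi1 - i *: xi2) = 0 ->
  exists a b, w = a *: (xi1 - i *: xi2) + b *: X.
Proof.
move=> ii w0 wJ; rewrite lorDr lorNr lorZr !lor_polar1 // => /eqP.
set u := rsubmx w in wJ *; set a := (u *m n1^T) 0 0; set a2 := (u *m n2^T) 0 0.
rewrite subr_eq0 => /eqP aE.
have a2E : a2 = - i * a by rewrite aE mulrA mulNr ii opprK mul1r.
have uE : u = (u *m f^T) 0 0 *: f + a *: n1 + a2 *: n2.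
  rewrite -{1}[u]mulmx1 -id1 !mulmxDr !mulmx_outer !mulmxA wJ !mul0mx addr0.
  by [].
exists a, (w 0 0 - a * (H1 - i * H2)).
rewrite {1}(row_mxE1 w) -/u; apply/eqP.
rewrite /X /xi1 /xi2 !scale_row_mx opp_row_mx add_row_mx scale_row_mx add_row_mx.
apply/eqP; congr row_mx.
  by apply/rowP => k; rewrite ord1 !mxE /= !mulr1n; ring.
rewrite (lor_polar0 w0) -/u [LHS]uE a2E; apply/rowP => k; rewrite !mxE; ring.
Qed.

End Polar.

(** * The trace-free second fundamental form of a Wintgen frame *)

Lemma dotr_mx (R : realType) k (u v : 'rV[R]_k) : u *m v^T = (dotr u v)%:M.
Proof. by rewrite [LHS]mx11_scalar. Qed.

Lemma dotr_sum (R : realType) k (u v : 'rV[R]_k) : dotr u v = \sum_i u 0 i * v 0 i.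
Proof. by rewrite /dotr mxE; apply: eq_bigr => i _; rewrite mxE. Qed.

Lemma dotrC (R : realType) k (u v : 'rV[R]_k) : dotr u v = dotr v u.
Proof. by rewrite !dotr_sum; apply: eq_bigr => i _; rewrite mulrC. Qed.

Lemma dotrDl (R : realType) k (u u' v : 'rV[R]_k) : dotr (u + u') v = dotr u v + dotr u' v.
Proof. by rewrite /dotr mulmxDl mxE. Qed.

Lemma dotrZl (R : realType) k (c : R) (u v : 'rV[R]_k) : dotr (c *: u) v = c * dotr u v.
Proof. by rewrite /dotr -scalemxAl mxE. Qed.

Lemma dotrDr (R : realType) k (u u' v : 'rV[R]_k) : dotr v (u + u') = dotr v u + dotr v u'.
Proof. by rewrite dotrC dotrDl !(dotrC v). Qed.

Lemma dotrZr (R : realType) k (c : R) (u v : 'rV[R]_k) : dotr v (c *: u) = c * dotr v u.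
Proof. by rewrite dotrC dotrZl dotrC. Qed.

Lemma dotr_gt0 (R : realType) k (u : 'rV[R]_k) : u != 0 -> 0 < dotr u u.
Proof.
move=> u0; rewrite dotr_sum lt_def sumr_ge0 ?andbT; last by move=> i _; rewrite -expr2 sqr_ge0.
apply: contra u0 => /eqP s0; apply/eqP/rowP => i; rewrite mxE; apply/eqP.
rewrite -sqrf_eq0 expr2; apply/eqP; apply: (psumr_eq0P _ s0) => // j _.
by rewrite -expr2 sqr_ge0.
Qed.

Lemma metric_gt0 (R : realType) m n (f : 'rV[R]_m -> 'rV[R]_n) a (v : 'rV[R]_m) :
  differentiable f a -> immersive_at f a -> v != 0 -> 0 < (v *m metric f a *m v^T) 0 0.
Proof.
move=> df im v0.
have -> : v *m metric f a *m v^T = ('D_v f a) *m ('D_v f a)^T.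
  by rewrite deriveEjacobian // /metric trmx_mul !mulmxA.
by apply: dotr_gt0; apply: contra v0 => /eqP/im ->.
Qed.

Lemma metric_unit (R : realType) m n (f : 'rV[R]_m -> 'rV[R]_n) a :
  differentiable f a -> immersive_at f a -> metric f a \in unitmx.
Proof.
move=> df im; rewrite -row_free_unit -kermx_eq0 -submx0.
apply/rV_subP => v /sub_kermxP vG; have [->|v0] := eqVneq v 0; first exact: sub0mx.
by have := metric_gt0 df im v0; rewrite vG mul0mx mxE ltxx.
Qed.

Lemma metric_sym (R : realType) m n (f : 'rV[R]_m -> 'rV[R]_n) a : (metric f a)^T = metric f a.
Proof. by rewrite /metric trmx_mul trmxK. Qed.

Lemma sffD (R : realType) m n (f : 'rV[R]_m -> 'rV[R]_n) a nu nu' :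
  sff f a (nu + nu') = sff f a nu + sff f a nu'.
Proof. by apply/matrixP => i j; rewrite !mxE dotrDr. Qed.

Lemma sffZ (R : realType) m n (f : 'rV[R]_m -> 'rV[R]_n) a c nu :
  sff f a (c *: nu) = c *: sff f a nu.
Proof. by apply/matrixP => i j; rewrite !mxE dotrZr. Qed.

(** The trace-free part of <II, nu>. *)
Definition tfsff (R : realType) m n (f : 'rV[R]_m -> 'rV[R]_n) a nu : 'M[R]_m :=
  sff f a nu - mean_curv f a nu *: metric f a.

Lemma mean_curvD (R : realType) m n (f : 'rV[R]_m -> 'rV[R]_n) a nu nu' :
  mean_curv f a (nu + nu') = mean_curv f a nu + mean_curv f a nu'.
Proof. by rewrite /mean_curv /shape_op sffD mulmxDl linearD mulrDr. Qed.

Lemma mean_curvZ (R : realType) m n (f : 'rV[R]_m -> 'rV[R]_n) a c nu :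
  mean_curv f a (c *: nu) = c * mean_curv f a nu.
Proof. by rewrite /mean_curv /shape_op sffZ -scalemxAl linearZ /= mulrCA. Qed.

Lemma tfsffD (R : realType) m n (f : 'rV[R]_m -> 'rV[R]_n) a nu nu' :
  tfsff f a (nu + nu') = tfsff f a nu + tfsff f a nu'.
Proof. by rewrite /tfsff sffD mean_curvD scalerDl opprD addrACA. Qed.

Lemma tfsffZ (R : realType) m n (f : 'rV[R]_m -> 'rV[R]_n) a c nu :
  tfsff f a (c *: nu) = c *: tfsff f a nu.
Proof. by rewrite /tfsff sffZ mean_curvZ scalerBr scalerA. Qed.

(** The trace-free second fundamental form recovered from the frame: the matrix M0
    being trace-free, l is the mean curvature. *)
Lemma tfsff_shape (R : realType) m n (f : 'rV[R]_m -> 'rV[R]_n) a nu (E M0 : 'M[R]_m) l mu :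
  (0 < m)%N -> metric f a \in unitmx -> E *m metric f a *m E^T = 1%:M -> \tr M0 = 0 ->
  E *m shape_op f a nu = (l%:M + mu *: M0) *m E ->
  tfsff f a nu = mu *: ((E *m metric f a)^T *m M0 *m (E *m metric f a)).
Proof.
move=> m0; have [G gE] : exists G, metric f a = G by exists (metric f a).
have Gs : G^T = G by rewrite -gE metric_sym.
rewrite gE => uG EG tM ES.
have GE : G *m E^T *m E = 1%:M by apply: mulmx1C; rewrite mulmxA.
have S : shape_op f a nu = G *m E^T *m (l%:M + mu *: M0) *m E.
  by rewrite -mulmxA -ES mulmxA GE mul1mx.
have H : mean_curv f a nu = l.
  rewrite /mean_curv S mxtrace_mulC !mulmxA EG mul1mx.
  rewrite linearD /= linearZ /= tM mulr0 addr0.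
  by rewrite mxtrace_scalar -[l *+ m]mulr_natl mulKf // pnatr_eq0 -lt0n.
have -> : tfsff f a nu = shape_op f a nu *m G - l *: G by rewrite /tfsff H /shape_op gE mulmxKV.
rewrite S trmx_mul Gs mulmxDr mulmxDl mulmxDl.
rewrite mul_mx_scalar -!scalemxAl GE mul1mx addrAC subrr add0r.
by rewrite -!scalemxAr -!scalemxAl !mulmxA.
Qed.

Lemma munit_delta (R : realType) m k l (hk : (k < m)%N) (hl : (l < m)%N) :
  munit R m k l = delta_mx (Ordinal hk) (Ordinal hl).
Proof. by apply/matrixP => i j; rewrite !mxE. Qed.

Lemma mxtrace_delta (R : realType) m (i j : 'I_m) : \tr (delta_mx i j : 'M[R]_m) = (i == j)%:R.
Proof.
rewrite /mxtrace (bigD1 i) //= big1 => [|k ki]; first by rewrite mxE eqxx addr0.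
by rewrite mxE (negPf ki).
Qed.

Definition cmx (R : realType) p q (A B : 'M[R]_(p, q)) : 'M[complex R]_(p, q) :=
  \matrix_(i, j) Complex (A i j) (B i j).

(** The Wintgen pair of matrices, combined with coefficients p and r whose ratio is a
    square root of -1, is up to a scalar the square of a covector; this is why the
    complex second fundamental form has rank one. *)
Lemma null_square (R : realType) m (hm : (2 <= m)%N) (eps p : complex R) (mu : R) :
  eps * eps = -1 ->
  let psi : 'rV[complex R]_m := \row_j ((j == 0%N :> nat)%:R - eps * (j == 1%N :> nat)%:R) in
  let r := eps * p in
  p *: map_mx (real_complex R) (munit R m 0 1 + munit R m 1 0) +
  r *: map_mx (real_complex R) (munit R m 0 0 - munit R m 1 1) = r *: (psi^T *m psi).
Proof.
move=> ee psi r; apply/matrixP => i j; rewrite !mxE big_ord1 !mxE.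
rewrite !rmorphD !rmorphN /= !rmorph_nat /r.
move: (nat_of_ord i) (nat_of_ord j) => {}i {}j.
by case: i => [|[|i]]; case: j => [|[|j]] /=; ring: ee.
Qed.

Lemma imag_cases (R : realType) (eps : complex R) : eps * eps = -1 -> eps = 'i \/ eps = - 'i.
Proof.
move=> ee; have /eqP : (eps - 'i) * (eps + 'i) = 0.
  by rewrite -subr_sqr expr2 ee sqrCi subrr.
by rewrite mulf_eq0 subr_eq0 addr_eq0 => /orP[/eqP|/eqP]; [left|right].
Qed.

Lemma cmx_lincomb (R : realType) p q (A B : 'M[R]_(p, q)) (a1 b1 a2 b2 : R) :
  cmx (a1 *: A + b1 *: B) (- (a2 *: A + b2 *: B)) =
  Complex a1 (- a2) *: map_mx (real_complex R) A + Complex b1 (- b2) *: map_mx (real_complex R) B.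
Proof.
apply/matrixP => i j; rewrite !mxE; apply: complex_ext; rewrite ?ReD' ?ImD' ?ReM' ?ImM' /=; ring.
Qed.

Lemma sphere_frame_real (R : realType) m (f : 'rV[R]_m -> 'rV[R]_(m + 3)) a nu1 nu2 :
  differentiable f a -> immersive_at f a -> dotr (f a) (f a) = 1 ->
  (forall v, dotr ('D_v f a) (f a) = 0) -> normal_frame f a nu1 nu2 ->
  (f a)^T *m f a + nu1^T *m nu1 + nu2^T *m nu2 +
    ('J f a)^T *m invmx (metric f a) *m 'J f a = 1%:M.
Proof.
move=> df im ff fv [[n1f n1v] [n2f n2v] n11 n22 n12].
have Jz nu : (forall v, dotr ('D_v f a) nu = 0) -> 'J f a *m nu^T = 0.
  move=> H; apply/row_matrixP => i; rewrite row_mul row0 rowE -deriveEjacobian //.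
  by rewrite dotr_mx H; apply/rowP => j; rewrite !mxE mul0rn.
apply: frame_identity.
- by rewrite !dotr_mx ff n11 n22.
- by rewrite !dotr_mx n1f n2f n12; split; apply/rowP => j; rewrite !mxE mul0rn.
- split; apply: Jz => // v; rewrite dotrC; [exact: n1v|exact: n2v].
- by rewrite mulmxV //; exact: metric_unit.
Qed.

Lemma normal_expand (R : realType) m (f : 'rV[R]_m -> 'rV[R]_(m + 3)) a nu1 nu2 nu :
  differentiable f a -> immersive_at f a -> dotr (f a) (f a) = 1 ->
  (forall v, dotr ('D_v f a) (f a) = 0) -> normal_frame f a nu1 nu2 ->
  normal_at f a nu -> nu = dotr nu nu1 *: nu1 + dotr nu nu2 *: nu2.
Proof.
move=> df im ff fv nf [nuf nuv]; have I := sphere_frame_real df im ff fv nf.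
have nJ : nu *m ('J f a)^T = 0.
  apply/rowP => i; have := nuv (delta_mx 0 i); rewrite deriveEjacobian // -rowE => H.
  by rewrite [RHS]mxE -[RHS]H /dotr !mxE; apply: eq_bigr => k _; rewrite !mxE.
rewrite -{1}[nu]mulmx1 -I !mulmxDr !mulmxA nJ !mul0mx addr0 !dotr_mx nuf.
by rewrite !mul_scalar_mx scale0r add0r.
Qed.

(** The given normals are an orthogonal transform of those of the Wintgen frame, so
    their complex combination has coefficients p, r with p^2 + r^2 = 0 and
    [null_square] applies. The covector phi is e1 - eps e2 read through the metric,
    with eps = i or - i according to the orientation. *)
Lemma wintgen_conformal_form (R : realType) m (hm : (2 <= m)%N)
    (f : 'rV[R]_m -> 'rV[R]_(m + 3)) a (E : 'M[R]_m) al1 al2 l1 l2 mu nu1 nu2 :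
  differentiable f a -> immersive_at f a -> dotr (f a) (f a) = 1 ->
  (forall v, dotr ('D_v f a) (f a) = 0) ->
  wintgen_frame f a E al1 al2 l1 l2 mu -> normal_frame f a nu1 nu2 -> mu != 0 ->
  exists (q : complex R) (phi : 'rV[complex R]_m),
  [/\ q != 0,
      cmx (tfsff f a nu1) (- tfsff f a nu2) = q *: (phi^T *m phi),
      phi *m map_mx (real_complex R) (invmx (metric f a)) *m phi^T = 0,
      forall z : complex R, exists v : 'rV[R]_m, (map_mx (real_complex R) v *m phi^T) 0 0 = z
    & forall v : 'rV[R]_m, (map_mx (real_complex R) v *m phi^T) 0 0 = 0 <->
        exists2 c : 'rV[R]_m, (forall j : 'I_m, (j < 2)%N -> c 0 j = 0) & v = c *m E].
Proof.
move=> df im ff fv [EG nf E1 E2] nfn mu0.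
have m0 : (0 < m)%N := ltnW hm.
have uG := metric_unit df im.
have t1 : \tr (munit R m 0 1 + munit R m 1 0) = 0.
  by rewrite !(munit_delta _ m0 hm) !(munit_delta _ hm m0) linearD /= !mxtrace_delta addr0.
have t2 : \tr (munit R m 0 0 - munit R m 1 1) = 0.
  by rewrite !(munit_delta _ m0 m0) !(munit_delta _ hm hm) linearB /= !mxtrace_delta !eqxx subrr.
have T1 := tfsff_shape m0 uG EG t1 E1.
have T2 := tfsff_shape m0 uG EG t2 E2.
have [nn1 nn2 n11 n22 n12] := nfn.
have e1 := normal_expand df im ff fv nf nn1.
have e2 := normal_expand df im ff fv nf nn2.
set a1 := dotr nu1 al1 in e1; set b1 := dotr nu1 al2 in e1.
set a2 := dotr nu2 al1 in e2; set b2 := dotr nu2 al2 in e2.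
have [_ _ A11 A22 A12] := nf.
have A21 : dotr al2 al1 = 0 by rewrite dotrC.
have r1 : a1 * a1 + b1 * b1 = 1.
  by rewrite -n11 e1 !(dotrDl, dotrDr, dotrZl, dotrZr) A11 A22 A12 A21; ring.
have r2 : a2 * a2 + b2 * b2 = 1.
  by rewrite -n22 e2 !(dotrDl, dotrDr, dotrZl, dotrZr) A11 A22 A12 A21; ring.
have r3 : a1 * a2 + b1 * b2 = 0.
  by rewrite -n12 e1 e2 !(dotrDl, dotrDr, dotrZl, dotrZr) A11 A22 A12 A21; ring.
pose p : complex R := Complex a1 (- a2); pose r : complex R := Complex b1 (- b2).
have pr : p * p + r * r = 0.
  apply: complex_ext; rewrite ?ReD' ?ImD' ?ReM' ?ImM' /=; first by lra.
  by have := r3; lra.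
have p0 : p != 0.
  apply/eqP => p0; have [a10 a20] : a1 = 0 /\ a2 = 0.
    by case: p0 => -> /eqP; rewrite oppr_eq0 => /eqP.
  move: r1 r2 r3; rewrite a10 a20 => r1 r2 r3; nra.
have [eps epsE] : exists e : complex R, e = r / p by exists (r / p).
have ee : eps * eps = -1.
  have rr : r * r = - (p * p) by apply/eqP; rewrite -subr_eq0 opprK addrC pr.
  by rewrite epsE mulf_div rr mulNr divff // mulf_neq0.
have EG' : E *m (metric f a *m E^T) = 1%:M by rewrite mulmxA.
have rE : r = eps * p by rewrite epsE divfK.
have r0 : r != 0.
  rewrite rE; apply: mulf_neq0 => //; apply/eqP => e0; move: ee; rewrite e0 mul0r => /eqP.
  by rewrite eq_sym oppr_eq0 oner_eq0.
pose psi : 'rV[complex R]_m := \row_j ((j == 0%N :> nat)%:R - eps * (j == 1%N :> nat)%:R).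
have NS := null_square hm p mu ee.
pose EGc := map_mx (real_complex R) (E *m metric f a).
pose Gc := map_mx (real_complex R) (invmx (metric f a)).
have psiE k : psi 0 k = (k == 0%N :> nat)%:R - eps * (k == 1%N :> nat)%:R by rewrite mxE.
have psiT k : psi^T k 0 = psi 0 k by rewrite mxE.
have psi2 : psi *m psi^T = 0.
  apply/rowP => j; rewrite !ord1 mxE (bigD1 (Ordinal m0)) //= (bigD1 (Ordinal hm)) //=.
  rewrite big1 => [|k /andP[k0 k1]]; first by rewrite [RHS]mxE !psiT !psiE /=; ring: ee.
  have k0' : (k == 0%N :> nat) = false by exact: negPf k0.
  have k1' : (k == 1%N :> nat) = false by exact: negPf k1.
  by rewrite psiT psiE k0' k1' mulr0n mulr0 subr0 mulr0.
have phiE (c : 'rV[R]_m) : (map_mx (real_complex R) (c *m E) *m (psi *m EGc)^T) 0 0 =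
    real_complex R (c 0 (Ordinal m0)) - eps * real_complex R (c 0 (Ordinal hm)).
  rewrite trmx_mul mulmxA /EGc map_trmx -map_mxM /= trmx_mul metric_sym.
  rewrite -(mulmxA c) EG' mulmx1 mxE (bigD1 (Ordinal m0)) //= (bigD1 (Ordinal hm)) //=.
  rewrite big1 => [|k /andP[k0 k1]]; first by rewrite !psiT !psiE [_ 0 (Ordinal m0)]mxE [_ 0 (Ordinal hm)]mxE /=; ring.
  have k0' : (k == 0%N :> nat) = false by exact: negPf k0.
  have k1' : (k == 1%N :> nat) = false by exact: negPf k1.
  by rewrite psiT psiE k0' k1' mulr0n mulr0 subr0 mulr0.
exists ((real_complex R mu) * r), (psi *m EGc); split.
- apply: mulf_neq0; last exact: r0.
  by rewrite eq_complex /= negb_and mu0.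
- rewrite e1 e2 !tfsffD !tfsffZ T1 T2 cmx_lincomb -/p -/r.
  have NS' : p *: map_mx (real_complex R) (munit R m 0 1 + munit R m 1 0) +
      r *: map_mx (real_complex R) (munit R m 0 0 - munit R m 1 1) = r *: (psi^T *m psi).
    by rewrite rE; exact: NS.
  move: NS'; move: (munit R m 0 1 + munit R m 1 0) (munit R m 0 0 - munit R m 1 1) => M1 M2 NS'.
  have MM (M0 : 'M[R]_m) : map_mx (real_complex R) ((E *m metric f a)^T *m M0 *m (E *m metric f a)) =
      EGc^T *m map_mx (real_complex R) M0 *m EGc.
    by rewrite /EGc map_trmx; move: (E *m metric f a) => Q; rewrite !map_mxM.
  rewrite !map_mxZ /= !MM.
  transitivity (real_complex R mu *: (EGc^T *m (r *: (psi^T *m psi)) *m EGc)).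
    rewrite -NS' mulmxDr mulmxDl -!scalemxAr -!scalemxAl scalerDr !scalerA.
    by rewrite ![_ * real_complex R mu]mulrC.
  by rewrite -scalemxAr -scalemxAl scalerA trmx_mul !mulmxA.
- rewrite trmx_mul !mulmxA -(mulmxA psi) -(mulmxA psi) -/Gc.
  have -> : EGc *m Gc *m EGc^T = 1%:M.
    rewrite /EGc /Gc map_trmx -!map_mxM /= mulmxK // trmx_mul metric_sym EG'.
    exact: map_mx1.
  by rewrite mulmx1.
- move=> z; have [eE|eE] := imag_cases ee.
  + exists ((complex.Re z *: delta_mx 0 (Ordinal m0) - complex.Im z *: delta_mx 0 (Ordinal hm)) *m E).
    rewrite phiE eE !mxE /=; apply: complex_ext; rewrite ?ReD' ?ImD' ?ReN' ?ImN' ?ReM' ?ImM' /=; ring.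
  + exists ((complex.Re z *: delta_mx 0 (Ordinal m0) + complex.Im z *: delta_mx 0 (Ordinal hm)) *m E).
    rewrite phiE eE !mxE /=; apply: complex_ext; rewrite ?ReD' ?ImD' ?ReN' ?ImN' ?ReM' ?ImM' /=; ring.
- move=> v; split=> [v0|[c c0 ->]]; last first.
    by rewrite phiE !c0 // mulr0 subr0.
  have uE : metric f a *m E^T *m E = 1%:M by exact: mulmx1C EG'.
  exists (v *m (metric f a *m E^T)); last by rewrite -mulmxA uE mulmx1.
  move: v0; rewrite -{1}[v]mulmx1 -uE mulmxA phiE.
  set c := v *m _; move=> H.
  have [h0 h1] : c 0 (Ordinal m0) = 0 /\ c 0 (Ordinal hm) = 0.
    move: (congr1 (@complex.Im R) H) (congr1 (@complex.Re R) H).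
    case: (imag_cases ee) => ->; rewrite ImD' ReD' ImN' ReN' ImM' ReM' /= => h1 h2; split; lra.
  move=> [[|[|k]] // kj] _; [rewrite -[RHS]h0|rewrite -[RHS]h1]; congr (c _ _); exact: val_inj.
Qed.

(** * First- and second-order identities for maps into the sphere *)

Lemma Ck_dotr (R : realType) (V : normedModType R) p (D : set V) n (u w : V -> 'rV[R]_n) :
  open D -> Ck_on p D u -> Ck_on p D w -> Ck_on p D (fun x => dotr (u x) (w x) : R).
Proof.
move=> oD /(Ck_rVP _ _ oD) Cu /(Ck_rVP _ _ oD) Cw.
apply: (Ck_on_eq oD _ (@Ck_sum _ _ _ R D _ (index_enum 'I_n) xpredT _ oD
  (fun i _ => Ck_mul oD (Cu i) (Cw i)))) => x _.
by rewrite dotr_sum.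
Qed.

Lemma Ck_row_mx1 (R : realType) (V : normedModType R) p (D : set V) n (h : V -> R) (w : V -> 'rV[R]_n) :
  open D -> Ck_on p D h -> Ck_on p D w ->
  Ck_on p D (fun x => row_mx (h x)%:M (w x) : 'rV[R]_(1 + n)).
Proof.
move=> oD Ch /(Ck_rVP _ _ oD) Cw; apply/Ck_rVP => // j.
rewrite -(fintype.splitK j); case: (fintype.split j) => k /=.
  by apply: (Ck_on_eq oD _ Ch) => x _; rewrite row_mxEl ord1 mxE mulr1n.
by apply: (Ck_on_eq oD _ (Cw k)) => x _; rewrite row_mxEr.
Qed.

Lemma Ck_scaleR (R : realType) (V : normedModType R) p (D : set V) n (h : V -> R) (w : V -> 'rV[R]_n) :
  open D -> Ck_on p D h -> Ck_on p D w -> Ck_on p D (fun x => h x *: w x).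
Proof.
move=> oD Ch /(Ck_rVP _ _ oD) Cw; apply/Ck_rVP => // j.
by apply: (Ck_on_eq oD _ (Ck_mul oD Ch (Cw j))) => x _; rewrite mxE.
Qed.

Lemma derive_dotr (R : realType) (V : normedModType R) n (u w : V -> 'rV[R]_n) a v :
  differentiable u a -> differentiable w a ->
  'D_v (fun x => dotr (u x) (w x)) a = dotr ('D_v u a) (w a) + dotr (u a) ('D_v w a).
Proof.
move=> du dw.
have cu := (differentiable_rVP _ _).1 du; have cw := (differentiable_rVP _ _).1 dw.
have E : (fun x => dotr (u x) (w x)) =1 \sum_(i < n) ((fun x => u x 0 i) * (fun x => w x 0 i)).
  by move=> x; rewrite dotr_sum fct_sumE.
apply: etrans (eq_derive v a E) _.
rewrite derive_sum => [|i]; last by apply: derivableM; exact: diff_derivable.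
rewrite !dotr_sum -big_split; apply: eq_bigr => i _.
rewrite (deriveM (diff_derivable (cu i)) (diff_derivable (cw i))).
by rewrite -(derive_coord v i du) -(derive_coord v i dw) addrC mulrC.
Qed.

Lemma cst_derive0 (R : realType) (V : normedModType R) (D : set V) (f : V -> R) (c : R) a v :
  open D -> (forall x, D x -> f x = c) -> D a -> 'D_v f a = 0.
Proof.
move=> oD fc Da; rewrite -(derive_cst c a v); apply: near_eq_derive.
have : \forall x \near a, D x by exact: open_nbhs_nbhs.
by apply: filterS => x /fc.
Qed.

Lemma cst_cder0 (R : realType) (V : normedModType R) (D : set V) (f : V -> complex R) (c : complex R) a v :
  open D -> (forall x, D x -> f x = c) -> D a -> cder v f a = 0.
Proof.
move=> oD fc Da; rewrite -(cder_cst v c a); apply: near_eq_cder.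
have : \forall x \near a, D x by exact: open_nbhs_nbhs.
by apply: filterS => x /fc.
Qed.

Section SphereMap.
Variables (R : realType) (m n : nat) (V : set 'rV[R]_m) (f : 'rV[R]_m -> 'rV[R]_n).
Hypotheses (oV : open V) (sf : smooth_on V f).
Hypothesis (ff : forall a, V a -> dotr (f a) (f a) = 1).

Let dfa a : V a -> differentiable f a := smooth_differentiable sf (a := a).
Let ddfa v a : V a -> differentiable ('D_v f) a := smooth_differentiable (smooth_derive v sf) (a := a).

Lemma sphere_dot1 a v : V a -> dotr ('D_v f a) (f a) = 0.
Proof.
move=> Va; have := cst_derive0 v oV ff Va; rewrite (derive_dotr v (dfa Va) (dfa Va)).
by rewrite [dotr (f a) _]dotrC => h; lra.
Qed.

Lemma sphere_dot2 a v w : V a -> dotr ('D_w ('D_v f) a) (f a) = - dotr ('D_w f a) ('D_v f a).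
Proof.
move=> Va; have := cst_derive0 w oV (fun x Vx => sphere_dot1 v Vx) Va.
rewrite (derive_dotr w (ddfa v Va) (dfa Va)) [dotr ('D_v f a) _]dotrC => /eqP.
by rewrite addr_eq0 => /eqP.
Qed.

Lemma normal_dot2 (N : 'rV[R]_m -> 'rV[R]_n) a v w : smooth_on V N ->
  (forall x, V x -> normal_at f x (N x)) -> V a ->
  dotr ('D_w ('D_v f) a) (N a) = - dotr ('D_w N a) ('D_v f a).
Proof.
move=> sN nN Va; have dN := smooth_differentiable sN Va.
have H x : V x -> dotr ('D_v f x) (N x) = 0 by move=> Vx; rewrite dotrC; have [_] := nN _ Vx; exact.
have := cst_derive0 w oV H Va.
rewrite (derive_dotr w (ddfa v Va) dN) [dotr ('D_v f a) _]dotrC => /eqP.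
by rewrite addr_eq0 => /eqP.
Qed.

(** Differentiating <N, df> = 0 trades the second derivatives of f for the first
    derivatives of N; in this form only the first-order chain rule is needed to
    change coordinates. *)
Lemma sff_Jacobian (N : 'rV[R]_m -> 'rV[R]_n) a : smooth_on V N ->
  (forall x, V x -> normal_at f x (N x)) -> V a ->
  sff f a (N a) = - ('J N a *m ('J f a)^T).
Proof.
move=> sN nN Va; have dN := smooth_differentiable sN Va.
apply/matrixP => i j; rewrite mxE normal_dot2 // mxE [in RHS]mxE; congr (- _).
rewrite dotr_sum; apply: eq_bigr => k _.
have h1 := smooth_J_row i k dN; have h2 := smooth_J_row j k (dfa Va).
have h3 : ('J f a)^T k j = ('D_(delta_mx 0 j) f a) 0 k by rewrite mxE; exact: h2.
exact: (f_equal2 *%R (esym h1) (esym h3)).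
Qed.

Lemma metric_dot a i j : V a ->
  metric f a i j = dotr ('D_(delta_mx 0 i) f a) ('D_(delta_mx 0 j) f a).
Proof.
move=> Va; rewrite mxE dotr_sum; apply: eq_bigr => k _.
have h1 := smooth_J_row i k (dfa Va); have h2 := smooth_J_row j k (dfa Va).
have h3 : ('J f a)^T k j = ('D_(delta_mx 0 j) f a) 0 k by rewrite mxE; exact: h2.
exact: (f_equal2 *%R h1 h3).
Qed.

Lemma Ck_mean_curv p (N : 'rV[R]_m -> 'rV[R]_n) : (forall a, V a -> immersive_at f a) ->
  smooth_on V N -> Ck_on p V (fun a => mean_curv f a (N a) : R).
Proof.
move=> im sN.
have Cm i j : Ck_on p V (fun a => metric f a i j : R).
  apply: (Ck_on_eq oV _ (Ck_dotr oV (smooth_derive (delta_mx 0 i) sf p) (smooth_derive (delta_mx 0 j) sf p))) => a.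
  by rewrite inE => Va; rewrite metric_dot.
have Cs i j : Ck_on p V (fun a => sff f a (N a) i j : R).
  have ds := smooth_derive (delta_mx 0 i) (smooth_derive (delta_mx 0 j) sf) p.
  apply: (Ck_on_eq oV _ (Ck_dotr oV ds (sN p))) => a _.
  by rewrite mxE.
have Ci i j : Ck_on p V (fun a => invmx (metric f a) i j : R).
  by apply: Ck_invmx => // a Va; apply: metric_unit; [exact: dfa|exact: im].
have C2 (i j : 'I_m) : Ck_on p V (fun a => sff f a (N a) i j * invmx (metric f a) j i : R) by exact: Ck_mul.
have C1 (i : 'I_m) := @Ck_sum _ _ _ R V _ (index_enum 'I_m) xpredT _ oV (fun j _ => C2 i j).
have C0 := @Ck_sum _ _ _ R V _ (index_enum 'I_m) xpredT _ oV (fun i _ => C1 i).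
apply: (Ck_on_eq oV _ (Ck_mul oV (@Ck_cst _ p _ R V (m%:R^-1)) C0)) => a _.
rewrite /mean_curv /mxtrace; congr (_ * _); apply: eq_bigr => i _.
by rewrite mxE.
Qed.

Lemma Ck_mcs_lift p (N : 'rV[R]_m -> 'rV[R]_n) : (forall a, V a -> immersive_at f a) ->
  smooth_on V N -> Ck_on p V (fun a => mcs_lift f a (N a)).
Proof.
move=> im sN; have CH := Ck_mean_curv p im sN.
exact: (Ck_row_mx1 oV CH (Ck_add oV (sN p) (Ck_scaleR oV CH (sf p)))).
Qed.

(** The light-like lift (1, f). *)
Definition pos_lift (a : 'rV[R]_m) : 'rV[R]_(1 + n) := row_mx 1%:M (f a).

Lemma Ck_pos_lift p : Ck_on p V pos_lift.
Proof. exact: (Ck_row_mx1 oV (@Ck_cst _ p _ R V 1) (sf p)). Qed.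

End SphereMap.

Lemma derive_row_mx1 (R : realType) (V : normedModType R) n (w : V -> 'rV[R]_n) c a v :
  differentiable w a ->
  'D_v (fun x => row_mx c%:M (w x) : 'rV[R]_(1 + n)) a = row_mx 0%:M ('D_v w a).
Proof.
move=> dw; have cw := (differentiable_rVP _ _).1 dw.
have d : differentiable (fun x => row_mx c%:M (w x) : 'rV[R]_(1 + n)) a.
  apply/differentiable_rVP => j; rewrite -(fintype.splitK j); case: (fintype.split j) => k /=.
    rewrite (_ : (fun x => _) = fun _ => (c%:M : 'rV[R]_1) 0 k); first exact: differentiable_cst.
    by apply/funext => x; rewrite row_mxEl.
  rewrite (_ : (fun x => _) = fun x => w x 0 k); first exact: cw.
  by apply/funext => x; rewrite row_mxEr.
apply/rowP => j; rewrite derive_coord // -(fintype.splitK j); case: (fintype.split j) => k /=.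
  rewrite row_mxEl mxE mul0rn -(derive_cst ((c%:M : 'rV[R]_1) 0 k) a v).
  by apply: eq_derive => x; rewrite row_mxEl.
by rewrite row_mxEr (derive_coord v k dw); apply: eq_derive => x; rewrite row_mxEr.
Qed.

Lemma mcs_lift_lor (R : realType) m n (f : 'rV[R]_m -> 'rV[R]_n) a nu (c : R) (w : 'rV[R]_n) :
  lor (mcs_lift f a nu) (row_mx c%:M w) =
  - (mean_curv f a nu * c) + dotr nu w + mean_curv f a nu * dotr (f a) w.
Proof. by rewrite lor_row_mx -/(dotr _ _) dotrDl dotrZl addrA. Qed.

Lemma lor_cvec (R : realType) n (A B A' B' : 'rV[R]_(1 + n)) :
  lor (cvec A B) (cvec A' B') =
  Complex (lor A A' - lor B B') (lor A B' + lor B A').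
Proof.
rewrite /lor !mxE; apply: complex_ext.
  rewrite ReD' ReN' ReM' /= (raddf_sum (@complex.Re R : Rcomplex R -> R)) /=.
  rewrite (eq_bigr (fun i => A 0 (rshift 1 i) * A' 0 (rshift 1 i) - B 0 (rshift 1 i) * B' 0 (rshift 1 i))).
    by rewrite sumrB; ring.
  by move=> i _; rewrite !mxE ReM'.
rewrite ImD' ImN' ImM' /= (raddf_sum (@complex.Im R : Rcomplex R -> R)) /=.
rewrite (eq_bigr (fun i => A 0 (rshift 1 i) * B' 0 (rshift 1 i) + B 0 (rshift 1 i) * A' 0 (rshift 1 i))).
  by rewrite big_split /=; ring.
by move=> i _; rewrite !mxE ImM'.
Qed.

Lemma rc_cvec (R : realType) k (X : 'rV[R]_k) : map_mx (real_complex R) X = cvec X 0.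
Proof. by apply/rowP => j; rewrite !mxE. Qed.

Lemma cvec_rc (R : realType) k (X Y : 'rV[R]_k) :
  cvec X (- Y) = map_mx (real_complex R) X - 'i *: map_mx (real_complex R) Y.
Proof.
apply/rowP => j; rewrite !mxE; apply: complex_ext; rewrite ?ReD' ?ImD' ?ReN' ?ImN' ?ReM' ?ImM' iE /=; ring.
Qed.

(** * The differential of the Gauss map in one chart *)

Section PolarNull.
Variables (K : fieldType) (n m : nat) (f n1 n2 : 'rV[K]_n) (J : 'M[K]_(m, n)) (Gi : 'M[K]_m).
Variables (H1 H2 i : K) (phi : 'rV[K]_m).
Hypothesis ii : i * i = -1.
Hypothesis id1 : f^T *m f + n1^T *m n1 + n2^T *m n2 + J^T *m Gi *m J = 1%:M.
Let X : 'rV[K]_(1 + n) := row_mx 1%:M f.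
Let xi1 : 'rV[K]_(1 + n) := row_mx H1%:M (n1 + H1 *: f).
Let xi2 : 'rV[K]_(1 + n) := row_mx H2%:M (n2 + H2 *: f).

(** The tangential parts contribute phi Gi phi^T = 0, and the products with xi1 and
    xi2, being in the ratio i, contribute squares that cancel. *)
Lemma polar_isotropic (w w' xi : 'rV[K]_(1 + n)) (s s' : K) :
  xi = xi1 - i *: xi2 -> phi *m Gi *m phi^T = 0 ->
  lor w X = 0 -> lor w' X = 0 -> lor w xi = 0 -> lor w' xi = 0 ->
  rsubmx w *m J^T = s *: phi -> rsubmx w' *m J^T = s' *: phi -> lor w w' = 0.
Proof.
move=> -> nul wX wX' wxi wxi' c c'; rewrite (polar_product H1 H2 id1 wX wX') c c'.
rewrite -!scalemxAl linearZ /= -scalemxAr nul !scaler0 mxE add0r -/xi1 -/xi2.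
move: wxi wxi'; rewrite !lorDr !lorNr !lorZr => /eqP; rewrite subr_eq0 => /eqP -> /eqP.
by rewrite subr_eq0 => /eqP ->; rewrite mulrACA ii mulN1r addNr.
Qed.

(** The combination of wi and wj with zero tangential part is a combination of xi and
    X; pairing with u, which is orthogonal to everything but X, removes the X
    component. *)
Lemma polar_parallel (wi wj u xi : 'rV[K]_(1 + n)) (q pi pj : K) :
  xi = xi1 - i *: xi2 -> pi != 0 ->
  lor wi X = 0 -> lor wj X = 0 -> lor wi xi = 0 -> lor wj xi = 0 ->
  rsubmx wi *m J^T = (- q * pi) *: phi -> rsubmx wj *m J^T = (- q * pj) *: phi ->
  lor u wi = 0 -> lor u wj = 0 -> lor u xi = 0 -> lor u X != 0 ->
  exists l, wj = pj *: (pi^-1 *: wi) + l *: xi.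
Proof.
move=> xiE pi0 iX jX ixi jxi ci cj ui uj uxi uX.
pose w := pi *: wj - pj *: wi.
have w1 : lor w X = 0 by rewrite lorDl lorNl !lorZl iX jX !mulr0 subrr.
have w2 : rsubmx w *m J^T = 0.
  have -> : rsubmx w = pi *: rsubmx wj - pj *: rsubmx wi by apply/rowP => k; rewrite !mxE.
  rewrite mulmxBl -!scalemxAl ci cj.
  by apply/rowP => k; rewrite !mxE; ring.
have w3 : lor w (xi1 - i *: xi2) = 0 by rewrite -xiE lorDl lorNl !lorZl ixi jxi !mulr0 subrr.
have [s [t wE]] := polar_expand id1 ii w1 w2 w3.
rewrite -/xi1 -/xi2 -xiE -/X in wE.
have : lor u w = 0 by rewrite lorDr lorNr !lorZr ui uj !mulr0 subrr.
rewrite wE lorDr !lorZr uxi mulr0 add0r => /eqP; rewrite mulf_eq0 (negPf uX) orbF => /eqP t0.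
exists (pi^-1 * s); apply: (scalerI pi0).
rewrite scalerDr !scalerA (_ : _ *: wi = pj *: wi); last by congr (_ *: _); field.
rewrite (_ : _ *: xi = s *: xi); last by congr (_ *: _); field.
move: wE; rewrite /w t0 scale0r addr0 => /eqP; rewrite subr_eq => /eqP ->.
by rewrite addrC.
Qed.

End PolarNull.

(** Symmetry in two slots and antisymmetry in another two force a tensor to vanish:
    the transpositions compose to a cyclic permutation of sign -1 and order 3. *)
Lemma christoffel (K : numFieldType) (I : Type) (T : I -> I -> I -> K) :
  (forall x y z, T x y z = T y x z) -> (forall x y z, T x y z = - T z y x) ->
  forall x y z, T x y z = 0.
Proof.
move=> S A x y z; have : T x y z = - T x y z.
  by rewrite {1}A S A opprK S A S.
by move/eqP; rewrite -addr_eq0 -mulr2n mulrn_eq0 /= => /eqP.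
Qed.

Lemma cder0_lor (R : realType) (V : normedModType R) n (D : set V) (F G : V -> 'rV[complex R]_(1 + n))
    (c : complex R) a v : open D -> (forall x, D x -> lor (F x) (G x) = c) -> D a ->
  vdiff F a -> vdiff G a -> lor (cderive v F a) (G a) = - lor (F a) (cderive v G a).
Proof.
move=> oD FG Da dF dG; have := cst_cder0 v oD FG Da.
by rewrite (cder_lor v dF dG) => /eqP; rewrite addr_eq0 => /eqP.
Qed.

Definition gauss_lift (R : realType) m n (f N1 N2 : 'rV[R]_m -> 'rV[R]_n) (a : 'rV[R]_m) :
    'rV[complex R]_(1 + n) :=
  cvec (mcs_lift f a (N1 a)) (- mcs_lift f a (N2 a)).

Lemma sqri (R : realType) : 'i * 'i = -1 :> complex R.
Proof. by rewrite -expr2 sqrCi. Qed.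

Section GaussChart.
Variables (R : realType) (m : nat) (hm : (2 <= m)%N).
Variables (V : set 'rV[R]_m) (f N1 N2 : 'rV[R]_m -> 'rV[R]_(m + 3)).
Hypotheses (oV : open V) (sf : smooth_on V f).
Hypothesis (ff : forall a, V a -> dotr (f a) (f a) = 1).
Hypothesis (im : forall a, V a -> immersive_at f a).
Hypotheses (s1 : smooth_on V N1) (s2 : smooth_on V N2).
Hypothesis (nf : forall a, V a -> normal_frame f a (N1 a) (N2 a)).

Local Notation xi := (gauss_lift f N1 N2).
Local Notation Xc := (fun a => cvec (pos_lift f a) 0).
Local Notation d i := (delta_mx 0 i).

Let n1 a (Va : V a) : normal_at f a (N1 a). Proof. by have [] := nf Va. Qed.
Let n2 a (Va : V a) : normal_at f a (N2 a). Proof. by have [] := nf Va. Qed.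
Let dfa a : V a -> differentiable f a := smooth_differentiable sf (a := a).

Lemma vCk_gauss_lift p : vCk p V xi.
Proof.
apply: vCk_cvec => //; first exact: Ck_mcs_lift.
have C2 := Ck_mcs_lift oV sf p im s2.
apply: (Ck_on_eq oV _ (Ck_scaleR oV (@Ck_cst _ p _ R V (-1)) C2)) => x _.
by rewrite scaleN1r.
Qed.

Lemma vCk_pos p : vCk p V Xc.
Proof. by apply: vCk_cvec => //; [exact: Ck_pos_lift|exact: Ck_cst]. Qed.

Let dxi a (Va : V a) : vdiff xi a := vCk_vdiff (vCk_gauss_lift 1) Va.
Let ddxi v a (Va : V a) : vdiff (cderive v xi) a := vCk_vdiff (vCk_cderive v oV (vCk_gauss_lift 2)) Va.
Let dX a (Va : V a) : vdiff Xc a := vCk_vdiff (vCk_pos 1) Va.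
Let ddX v a (Va : V a) : vdiff (cderive v Xc) a := vCk_vdiff (vCk_cderive v oV (vCk_pos 2)) Va.

Lemma cderive_pos a v : V a -> cderive v Xc a = cvec (row_mx 0%:M ('D_v f a)) 0.
Proof.
move=> Va; rewrite cderive_cvec derive_row_mx1; last exact: dfa.
by rewrite (_ : 'D_v (fun _ => 0) a = 0) //; exact: derive_cst.
Qed.

Lemma cderive_pos2 a v w : V a ->
  cderive w (cderive v Xc) a = cvec (row_mx 0%:M ('D_w ('D_v f) a)) 0.
Proof.
move=> Va.
have E : \forall x \near a, cderive v Xc x = cvec (row_mx 0%:M ('D_v f x)) 0.
  have : \forall x \near a, V x by exact: open_nbhs_nbhs.
  by apply: filterS => x; exact: cderive_pos.
rewrite (near_eq_cderive w E) cderive_cvec derive_row_mx1.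
  by rewrite (_ : 'D_w (fun _ => 0) a = 0) //; exact: derive_cst.
exact: smooth_differentiable (smooth_derive v sf) Va.
Qed.

Lemma lor_gauss_real a c (w : 'rV[R]_(m + 3)) :
  lor (xi a) (cvec (row_mx c%:M w) 0) =
  Complex (lor (mcs_lift f a (N1 a)) (row_mx c%:M w)) (- lor (mcs_lift f a (N2 a)) (row_mx c%:M w)).
Proof. by rewrite /gauss_lift lor_cvec !lor0r lorNl subr0 add0r. Qed.

Lemma lor_gauss_pos a : V a -> lor (xi a) (Xc a) = 0.
Proof.
move=> Va; rewrite lor_gauss_real !mcs_lift_lor ff //.
have [-> _] := n1 Va; have [-> _] := n2 Va.
by apply: complex_ext => /=; ring.
Qed.

Lemma lor_gauss_dpos a v : V a -> lor (xi a) (cderive v Xc a) = 0.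
Proof.
move=> Va; rewrite cderive_pos // lor_gauss_real !mcs_lift_lor.
rewrite [dotr (f a) _]dotrC (sphere_dot1 oV sf ff) //.
have [_ ->] := n1 Va; have [_ ->] := n2 Va.
by apply: complex_ext => /=; ring.
Qed.

Lemma mcs_lift_gram a nu nu' : V a -> normal_at f a nu -> normal_at f a nu' ->
  lor (mcs_lift f a nu) (mcs_lift f a nu') = dotr nu nu'.
Proof.
move=> Va [h _] [h' _].
rewrite mcs_lift_lor !(dotrDr, dotrZr) ff // h (dotrC (f a)) h'; ring.
Qed.

Lemma lor_gauss_self a : V a -> lor (xi a) (xi a) = 0.
Proof.
move=> Va; have [_ _ h1 h2 h3] := nf Va; have a1 := n1 Va; have a2 := n2 Va.
rewrite lor_cvec !(lorNl, lorNr) !(lorC (mcs_lift f a (N2 a)) (mcs_lift _ _ (N1 a))) !mcs_lift_gram //.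
by rewrite h1 h2 h3; apply: complex_ext => /=; ring.
Qed.

Lemma lor_gauss_conj a : V a -> lor (xi a) (map_mx Num.conj (xi a)) = 2.
Proof.
move=> Va; have [_ _ h1 h2 h3] := nf Va; have a1 := n1 Va; have a2 := n2 Va.
have -> : map_mx Num.conj (xi a) = cvec (mcs_lift f a (N1 a)) (mcs_lift f a (N2 a)).
  by apply/rowP => j; rewrite /gauss_lift [LHS]mxE [cvec _ _ 0 j]mxE [RHS]mxE conjE /= [(- _ : 'rV__) 0 j]mxE opprK.
rewrite lor_cvec !(lorNl, lorNr) (lorC (mcs_lift f a (N2 a)) (mcs_lift _ _ (N1 a))) !mcs_lift_gram //.
by rewrite h1 h2 h3; apply: complex_ext => /=; ring.
Qed.

Lemma lor_dgauss_pos a v : V a -> lor (cderive v xi a) (Xc a) = 0.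
Proof.
move=> Va; have := cst_cder0 v oV (fun x Vx => lor_gauss_pos Vx) Va.
by rewrite (cder_lor v (dxi Va) (dX Va)) lor_gauss_dpos // addr0.
Qed.

Lemma lor_dgauss_posrc a v : V a ->
  lor (cderive v xi a) (row_mx 1%:M (map_mx (real_complex R) (f a))) = 0.
Proof.
move=> Va; apply: etrans (lor_dgauss_pos v Va); congr (lor _ _).
by rewrite -rc_cvec /pos_lift map_row_mx map_scalar_mx.
Qed.

Lemma lor_dgauss_self a v : V a -> lor (cderive v xi a) (xi a) = 0.
Proof.
move=> Va; have := cst_cder0 v oV (fun x Vx => lor_gauss_self Vx) Va.
rewrite (cder_lor v (dxi Va) (dxi Va)) [lor (xi a) _]lorC -mulr2n => /eqP.
by rewrite mulrn_eq0 /= => /eqP.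
Qed.

(** Pairing the differentials of the two lifts yields the second fundamental form;
    the mean curvature in xi_r = (H^r, n_r + H^r x) removes its trace. *)
Lemma lor_dgauss_dpos a i j : V a ->
  lor (cderive (d j) xi a) (cderive (d i) Xc a) =
  - (cmx (tfsff f a (N1 a)) (- tfsff f a (N2 a))) j i.
Proof.
move=> Va; have := cst_cder0 (d j) oV (fun x Vx => lor_gauss_dpos (d i) Vx) Va.
rewrite (cder_lor (d j) (dxi Va) (ddX (d i) Va)) => /eqP; rewrite addr_eq0 => /eqP ->; congr (- _).
rewrite cderive_pos2 // lor_gauss_real !mcs_lift_lor [dotr (f a) _]dotrC (sphere_dot2 oV sf ff) //.
have cE (P Q : 'M[R]_m) : cmx P Q j i = Complex (P j i) (Q j i) by rewrite mxE.
have nE (P : 'M[R]_m) : (- P) j i = - P j i by rewrite mxE.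
have tE nu : tfsff f a nu j i = dotr ('D_(d j) ('D_(d i) f) a) nu - mean_curv f a nu * metric f a j i.
  by rewrite /tfsff mxE nE; congr (_ - _); rewrite mxE.
rewrite -(metric_dot sf _ _ Va) ![dotr _ ('D_(d j) _ a)]dotrC cE nE !tE.
by apply: complex_ext => /=; ring.
Qed.

Local Notation rc := (map_mx (real_complex R)).

Lemma gauss_polar_id a : V a ->
  (rc (f a))^T *m rc (f a) + (rc (N1 a))^T *m rc (N1 a) + (rc (N2 a))^T *m rc (N2 a) +
    (rc ('J f a))^T *m rc (invmx (metric f a)) *m rc ('J f a) = 1%:M.
Proof.
move=> Va; rewrite !map_trmx -!map_mxM -!map_mxD.
rewrite (sphere_frame_real (dfa Va) (im Va) (ff Va) _ (nf Va)) ?map_mx1 // => v.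
exact: (sphere_dot1 oV sf ff).
Qed.

Lemma gauss_lift_rc a : xi a =
  row_mx (real_complex R (mean_curv f a (N1 a)))%:M (rc (N1 a) + real_complex R (mean_curv f a (N1 a)) *: rc (f a)) -
  'i *: row_mx (real_complex R (mean_curv f a (N2 a)))%:M (rc (N2 a) + real_complex R (mean_curv f a (N2 a)) *: rc (f a)).
Proof.
have E nu : rc (mcs_lift f a nu) = row_mx (real_complex R (mean_curv f a nu))%:M
    (rc nu + real_complex R (mean_curv f a nu) *: rc (f a)).
  by rewrite /mcs_lift map_row_mx map_scalar_mx map_mxD map_mxZ.
by rewrite /gauss_lift cvec_rc !E.
Qed.

Lemma pos_lift_rc a : Xc a = row_mx 1%:M (rc (f a)).
Proof. by rewrite /= -rc_cvec /pos_lift map_row_mx map_scalar_mx. Qed.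

Lemma dpos_coord a (w : 'rV[complex R]_(1 + (m + 3))) i : V a ->
  (rsubmx w *m (rc ('J f a))^T) 0 i = lor w (cderive (d i) Xc a).
Proof.
move=> Va; rewrite cderive_pos //.
have -> : cvec (row_mx 0%:M ('D_(d i) f a)) 0 = row_mx 0%:M (rc ('D_(d i) f a)).
  by rewrite -rc_cvec map_row_mx map_scalar_mx.
rewrite {2}(row_mxE1 w) lor_row_mx mulr0 oppr0 add0r !mxE.
apply: eq_bigr => k _; congr (_ * _); rewrite !mxE; congr (real_complex R _).
by have := smooth_J_row i k (dfa Va); rewrite mxE.
Qed.

Section AtPoint.
Variables (hwin : forall a, V a -> exists (q : complex R) (phi : 'rV[complex R]_m),
  [/\ q != 0, cmx (tfsff f a (N1 a)) (- tfsff f a (N2 a)) = q *: (phi^T *m phi),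
      phi *m rc (invmx (metric f a)) *m phi^T = 0 & phi != 0]).

Lemma dgauss_tangential a (q : complex R) (phi : 'rV[complex R]_m) i : V a ->
  cmx (tfsff f a (N1 a)) (- tfsff f a (N2 a)) = q *: (phi^T *m phi) ->
  rsubmx (cderive (d i) xi a) *m (rc ('J f a))^T = (- q * phi 0 i) *: phi.
Proof.
move=> Va E; apply/rowP => j; rewrite dpos_coord // lor_dgauss_dpos // E !mxE big_ord1 !mxE; ring.
Qed.

(** This is where the Wintgen condition enters, through the nullity of phi at every
    point of the chart. *)
Lemma gauss_isotropic a i j : V a -> lor (cderive (d i) xi a) (cderive (d j) xi a) = 0.
Proof.
move=> Va; have [q [phi [q0 E nul phi0]]] := hwin Va.
have p0 := lor_dgauss_posrc (d i) Va; have p1 := lor_dgauss_posrc (d j) Va.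
apply: (polar_isotropic (sqri R) (gauss_polar_id Va) (gauss_lift_rc a) nul p0 p1).
- exact: lor_dgauss_self.
- exact: lor_dgauss_self.
- exact: dgauss_tangential Va E.
- exact: dgauss_tangential Va E.
Qed.

(** <d_k d_i xi, d_j xi> is symmetric in i, k, and antisymmetric in i, j because
    <d_i xi, d_j xi> vanishes identically. *)
Lemma christoffel_zero a i k j : V a ->
  lor (cderive (d k) (cderive (d i) xi) a) (cderive (d j) xi a) = 0.
Proof.
move=> Va.
apply: (@christoffel _ _ (fun x y z => lor (cderive (d y) (cderive (d x) xi) a) (cderive (d z) xi a))).
  move=> x y z; apply: (congr1 (fun Y => lor Y (cderive (d z) xi a))).
  exact: (vschwarz (d x) (d y) oV (vCk_gauss_lift 2) Va).
move=> x y z; apply: etrans (cder0_lor (d y) oV (fun b Vb => gauss_isotropic x z Vb) Va (ddxi (d x) Va) (ddxi (d z) Va)) _.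
exact: (congr1 (fun t => - t) (lorC (cderive (d x) xi a) (cderive (d y) (cderive (d z) xi) a))).
Qed.

Lemma lor_ddgauss_self a i k : V a -> lor (cderive (d k) (cderive (d i) xi) a) (xi a) = 0.
Proof.
move=> Va; apply: etrans (cder0_lor (d k) oV (fun b Vb => lor_dgauss_self (d i) Vb) Va (ddxi (d i) Va) (dxi Va)) _.
by rewrite gauss_isotropic // oppr0.
Qed.

Lemma lor_ddgauss_pos a i k (q : complex R) (phi : 'rV[complex R]_m) : V a ->
  cmx (tfsff f a (N1 a)) (- tfsff f a (N2 a)) = q *: (phi^T *m phi) ->
  lor (cderive (d k) (cderive (d i) xi) a) (Xc a) = q * phi 0 i * phi 0 k.
Proof.
move=> Va E; apply: etrans (cder0_lor (d k) oV (fun b Vb => lor_dgauss_pos (d i) Vb) Va (ddxi (d i) Va) (dX Va)) _.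
by rewrite lor_dgauss_dpos // E !mxE big_ord1 !mxE opprK mulrA.
Qed.

(** The vector kappa is a rescaled d_i xi with phi_i nonzero; the test vector that
    separates X in [polar_parallel] is d_i d_i xi. *)
Lemma gauss_structure_at a (q : complex R) (phi : 'rV[complex R]_m) : V a -> q != 0 -> phi != 0 ->
  cmx (tfsff f a (N1 a)) (- tfsff f a (N2 a)) = q *: (phi^T *m phi) ->
  exists kappa : 'rV[complex R]_(1 + (m + 3)),
  [/\ forall v, exists l : complex R,
        cderive v xi a = (rc v *m phi^T) 0 0 *: kappa + l *: xi a,
      forall l : complex R, kappa <> l *: xi a,
      lor kappa kappa = 0 & lor kappa (xi a) = 0].
Proof.
move=> Va q0 phi0 E.
have [i0 p0] : exists i0, phi 0 i0 != 0.
  apply/existsP; apply: contraR phi0; rewrite negb_exists => /forallP H.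
  by apply/eqP/rowP => i; rewrite mxE; apply/eqP; have := H i; rewrite negbK.
pose kappa := (phi 0 i0)^-1 *: cderive (d i0) xi a.
have key j : exists l : complex R, cderive (d j) xi a = phi 0 j *: kappa + l *: xi a.
  apply: (polar_parallel (sqri R) (gauss_polar_id Va) (gauss_lift_rc a) p0
    (lor_dgauss_posrc (d i0) Va) (lor_dgauss_posrc (d j) Va)
    (lor_dgauss_self (d i0) Va) (lor_dgauss_self (d j) Va)
    (dgauss_tangential i0 Va E) (dgauss_tangential j Va E)
    (christoffel_zero i0 i0 i0 Va) (christoffel_zero i0 i0 j Va) (lor_ddgauss_self i0 i0 Va)).
  rewrite -(pos_lift_rc a) (lor_ddgauss_pos i0 i0 Va E).
  by rewrite !mulf_neq0.
exists kappa; split.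
- move=> v; rewrite (cderive_rV_sum v (dxi Va)).
  have [l lE] : exists l : 'I_m -> complex R, forall j, cderive (d j) xi a = phi 0 j *: kappa + l j *: xi a.
    exists (fun j => sval (cid (key j))) => j; exact: svalP (cid (key j)).
  exists (\sum_j (real_complex R (v 0 j)) * l j).
  rewrite mxE !scaler_suml -big_split /=; apply: eq_bigr => j _.
  by rewrite lE scalerDr !scalerA !mxE.
- move=> l /(congr1 (fun Y => lor Y (cderive (d i0) Xc a))).
  rewrite !lorZl lor_gauss_dpos // mulr0 lor_dgauss_dpos // E !mxE big_ord1 !mxE => /eqP.
  by rewrite mulf_eq0 invr_eq0 (negPf p0) oppr_eq0 !mulf_eq0 (negPf q0) (negPf p0).
- by rewrite lorZl lorZr gauss_isotropic // !mulr0.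
- by rewrite lorZl lor_dgauss_self // mulr0.
Qed.

End AtPoint.

(** The covector phi depends on the chosen Wintgen frame, but D^perp does not: it
    consists of the directions in which xi moves only along C xi. *)
Theorem gauss_structure a :
  (forall b, V b -> wintgen_at f b) -> (forall b, V b -> wintgen_umbilic_free_at f b) -> V a ->
  exists (phi : 'rV[complex R]_m) (kappa : 'rV[complex R]_(1 + (m + 3))),
  [/\ forall v, exists l : complex R,
        cderive v xi a = (rc v *m phi^T) 0 0 *: kappa + l *: xi a,
      forall l : complex R, kappa <> l *: xi a,
      lor kappa kappa = 0 /\ lor kappa (xi a) = 0,
      forall z : complex R, exists v : 'rV[R]_m, (rc v *m phi^T) 0 0 = z
    & forall v, Dperp f a v <-> (rc v *m phi^T) 0 0 = 0].
Proof.
move=> hw hu Va.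
have conf b (Vb : V b) E al1 al2 l1 l2 mu (w : wintgen_frame f b E al1 al2 l1 l2 mu) :=
  wintgen_conformal_form hm (dfa Vb) (im Vb) (ff Vb) (fun v => sphere_dot1 oV sf ff v Vb) w (nf Vb) (hu _ Vb _ _ _ _ _ _ w).
have nz (phi : 'rV[complex R]_m) : (forall z : complex R, exists v : 'rV[R]_m, (rc v *m phi^T) 0 0 = z) -> phi != 0.
  move=> /(_ 1)[v]; apply: contra_eq_neq => ->; rewrite trmx0 mulmx0 mxE.
  by rewrite eq_sym oner_neq0.
have hwin b : V b -> exists (q : complex R) (phi : 'rV[complex R]_m),
  [/\ q != 0, cmx (tfsff f b (N1 b)) (- tfsff f b (N2 b)) = q *: (phi^T *m phi),
      phi *m rc (invmx (metric f b)) *m phi^T = 0 & phi != 0].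
  move=> Vb; have [E [al1 [al2 [l1 [l2 [mu w]]]]]] := hw _ Vb.
  have [q [phi [q0 e nul sur _]]] := conf _ Vb _ _ _ _ _ _ w.
  by exists q, phi; split=> //; exact: nz.
have [E [al1 [al2 [l1 [l2 [mu w]]]]]] := hw _ Va.
have [q [phi [q0 e nul sur ker]]] := conf _ Va _ _ _ _ _ _ w.
have phi0 := nz _ sur.
have [kappa [k1 k2 k3 k4]] := gauss_structure_at hwin Va q0 phi0 e.
exists phi, kappa; split=> // v; split=> [|h0]; last first.
  by exists E, al1, al2, l1, l2, mu; split=> //; apply/ker.
(* A vector of D^perp for another Wintgen frame is killed by the covector phi' of that
   frame, so xi moves along C xi in its direction, which forces phi to kill it. *)
move=> [E' [al1' [al2' [l1' [l2' [mu' [w' ex]]]]]]].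
have [q' [phi' [q0' e' nul' sur' ker']]] := conf _ Va _ _ _ _ _ _ w'.
have phi0' := nz _ sur'.
have [kappa' [k1' k2' k3' k4']] := gauss_structure_at hwin Va q0' phi0' e'.
have /ker' h0' := ex; have [l' cE] := k1' v; have [l cE2] := k1 v.
apply/eqP/negPn/negP => hn.
move: cE2; rewrite cE h0' scale0r add0r => E2.
apply: (k2 (((rc v *m phi^T) 0 0)^-1 * (l' - l))).
apply: (scalerI hn); rewrite scalerA mulrA divff // mul1r scalerBl E2.
by rewrite addrK.
Qed.

End GaussChart.

(** * Independence of the chart *)

Lemma invmx_mul (K : fieldType) n (A B : 'M[K]_n) : A \in unitmx -> B \in unitmx ->
  invmx (A *m B) = invmx B *m invmx A.
Proof.
move=> uA uB; have uAB : A *m B \in unitmx by rewrite unitmx_mul uA.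
apply: (can_inj (mulKmx uAB)); rewrite mulmxV // mulmxA mulmxK // mulmxV //.
Qed.

Lemma J_comp (R : realType) m n p (f : 'rV[R]_m -> 'rV[R]_n) (g : 'rV[R]_n -> 'rV[R]_p) a :
  differentiable f a -> differentiable g (f a) -> 'J (g \o f) a = 'J f a *m 'J g (f a).
Proof.
move=> df dg; apply/row_matrixP => i; rewrite row_mul !rowE.
rewrite -(deriveEjacobian _ (differentiable_comp df dg)) (derive_comp _ df dg).
by rewrite (deriveEjacobian _ df) (deriveEjacobian _ dg).
Qed.

Lemma row_J (R : realType) m n (f : 'rV[R]_m -> 'rV[R]_n) a i :
  differentiable f a -> row i ('J f a) = 'D_(delta_mx 0 i) f a.
Proof. by move=> df; rewrite rowE -deriveEjacobian. Qed.

Lemma J_ext (R : realType) m n (f g : 'rV[R]_m -> 'rV[R]_n) a b :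
  differentiable f a -> differentiable g b -> (forall v, 'D_v f a = 'D_v g b) -> 'J f a = 'J g b.
Proof.
move=> df dg H; apply/row_matrixP => i.
exact: (etrans (row_J i df) (etrans (H _) (esym (row_J i dg)))).
Qed.

Lemma near_open_eq (R : realType) (V W : normedModType R) (D : set V) (f g : V -> W) a :
  open D -> {in D, f =1 g} -> D a -> \forall x \near a, f x = g x.
Proof.
move=> oD fg Da; have : \forall x \near a, D x by exact: open_nbhs_nbhs.
by apply: filterS => x Dx; apply: fg; rewrite inE.
Qed.

Lemma J_eq (R : realType) m n (D : set 'rV[R]_m) (f g : 'rV[R]_m -> 'rV[R]_n) a :
  open D -> {in D, f =1 g} -> D a -> differentiable f a -> 'J f a = 'J g a.
Proof.
move=> oD fg Da df; have ne := near_open_eq oD fg Da.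
by apply: J_ext => // [|v]; [exact: near_eq_differentiable ne df|exact: near_eq_derive].
Qed.

Lemma mean_curv_sff (R : realType) m n (f : 'rV[R]_m -> 'rV[R]_n) a nu S F :
  sff f a nu = S -> 'J f a = F ->
  mean_curv f a nu = m%:R^-1 * \tr (S *m invmx (F *m F^T)).
Proof. by move=> <- <-. Qed.

Lemma mean_curv_eq (R : realType) m n (D : set 'rV[R]_m) (f g : 'rV[R]_m -> 'rV[R]_n) a nu :
  open D -> {in D, f =1 g} -> D a -> differentiable f a ->
  mean_curv f a nu = mean_curv g a nu.
Proof.
move=> oD fg Da df.
have E1 v : {in D, 'D_v f =1 'D_v g}.
  by move=> x; rewrite inE => Dx; apply: near_eq_derive; exact: near_open_eq oD fg Dx.
have E2 v w : 'D_w ('D_v f) a = 'D_w ('D_v g) a.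
  by apply: near_eq_derive; exact: near_open_eq oD (E1 v) Da.
have sE h i j : sff h a nu i j = dotr ('D_(delta_mx 0 i) ('D_(delta_mx 0 j) h) a) nu by rewrite mxE.
have S : sff f a nu = sff g a nu.
  apply/matrixP => i j; apply: etrans (sE f i j) (etrans _ (esym (sE g i j))).
  exact: (congr1 (fun y => dotr y nu) (E2 _ _)).
by rewrite (mean_curv_sff S (J_eq oD fg Da df)).
Qed.

(** Both second fundamental forms are expressed by [sff_Jacobian]; the Jacobian of the
    coordinate change cancels inside the trace. *)
Lemma mean_curv_comp (R : realType) m n (V : set 'rV[R]_m) (f : 'rV[R]_m -> 'rV[R]_n)
    (N : 'rV[R]_m -> 'rV[R]_n) (U : set 'rV[R]_m) (t : 'rV[R]_m -> 'rV[R]_m) a :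
  open V -> smooth_on V f -> smooth_on V N -> (forall x, V x -> normal_at f x (N x)) ->
  open U -> smooth_on U t -> (forall x, U x -> V (t x)) -> U a ->
  'J t a \in unitmx -> immersive_at f (t a) ->
  mean_curv (f \o t) a (N (t a)) = mean_curv f (t a) (N (t a)).
Proof.
move=> oV sf sN nN oU st UV Ua ut im.
have df : differentiable f (t a) := smooth_differentiable sf (UV _ Ua).
have dN : differentiable N (t a) := smooth_differentiable sN (UV _ Ua).
have dt : differentiable t a := smooth_differentiable st Ua.
have S1 := @sff_Jacobian R m n U (f \o t) oU (smooth_comp oU oV UV st sf) (N \o t) a
   (smooth_comp oU oV UV st sN).
have S2 := sff_Jacobian oV sf sN nN (UV _ Ua).
have nN' x : U x -> normal_at (f \o t) x ((N \o t) x).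
  move=> Ux; have [h1 h2] := nN _ (UV _ Ux); split; [exact: h1|move=> v].
  apply: etrans (h2 ('D_v t x)); apply: (congr1 (dotr _)).
  exact: (derive_comp v (smooth_differentiable st Ux) (smooth_differentiable sf (UV _ Ux))).
have uG := metric_unit df im; rewrite /metric in uG.
apply: etrans (mean_curv_sff (S1 nN' Ua) (J_comp dt df)) _.
apply: etrans (esym (mean_curv_sff S2 erefl)).
rewrite (J_comp dt df) (J_comp dt dN).
move: ('J t a) ut ('J f (t a)) ('J N (t a)) uG => T ut F Q uG.
apply: (congr1 (fun y => _ * y)); rewrite !mulNmx !linearN /=; apply: (congr1 (fun y => - y)).
have -> : T *m F *m (T *m F)^T = T *m (F *m F^T) *m T^T by rewrite trmx_mul !mulmxA.
have uT : T^T \in unitmx by rewrite unitmx_tr.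
rewrite !invmx_mul ?unitmx_mul ?ut ?uG // trmx_mul.
rewrite !mulmxA mulmxK // -!mulmxA mxtrace_mulC -!mulmxA mulVmx // mulmx1.
by rewrite !mulmxA.
Qed.

Lemma J_unit_left_inverse (R : realType) p (t t' : 'rV[R]_p -> 'rV[R]_p) a :
  differentiable t a -> differentiable t' (t a) -> (\forall x \near a, t' (t x) = x) ->
  'J t a \in unitmx.
Proof.
move=> dt dt' H; have d := differentiable_comp dt dt'.
have : 'J (t' \o t) a = 1%:M.
  apply/row_matrixP => i; rewrite row_J // row1 -[RHS](derive_id a).
  exact: near_eq_derive.
move=> H1; have H2 : 'J t a *m 'J t' (t a) = 1%:M := etrans (esym (J_comp dt dt')) H1.
exact: (mulmx1_unit H2).1.
Qed.

Lemma chart_inv (T V : topologicalType) (c : chart T V) a : ccod c a ->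
  cdom c (cinv c a) /\ cfwd c (cinv c a) = a.
Proof. by move=> [p cp <-]; rewrite cfwdK. Qed.

Lemma chart_fwd (T V : topologicalType) (c : chart T V) p : cdom c p -> ccod c (cfwd c p).
Proof. by move=> cp; exists p. Qed.

Lemma chart_cod_open (T V : topologicalType) (c : chart T V) (O : set T) :
  open O -> open (ccod c `&` cinv c @^-1` O).
Proof.
move=> oO; rewrite openE => a [ca Oa]; apply: filterI.
  by apply: open_nbhs_nbhs; split=> //; exact: ccod_open.
by apply: (cinv_continuous ca); exact: open_nbhs_nbhs.
Qed.

Lemma chart_dom_open (T V : topologicalType) (c : chart T V) (O : set V) :
  open O -> open (cdom c `&` cfwd c @^-1` O).
Proof.
move=> oO; rewrite openE => p [cp Op]; apply: filterI.
  by apply: open_nbhs_nbhs; split=> //; exact: cdom_open.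
by apply: (cfwd_continuous cp); exact: open_nbhs_nbhs.
Qed.

Lemma transition (R : realType) p (T : topologicalType) (A : set (chart T 'rV[R]_p)) c d :
  smooth_manifold A -> A c -> A d ->
  let U := ccod c `&` cinv c @^-1` cdom d in let t := cfwd d \o cinv c in
  [/\ open U, smooth_on U t,
      forall a, U a -> ccod d (t a) /\ cinv d (t a) = cinv c a
    & forall a, U a -> 'J t a \in unitmx].
Proof.
move=> [_ _ _ sm] Ac Ad U t; have oU : open U by apply: chart_cod_open; exact: cdom_open.
have st : smooth_on U t by exact: sm.
have tP a : U a -> ccod d (t a) /\ cinv d (t a) = cinv c a.
  by move=> [ca da]; split; [exact: chart_fwd|rewrite /t /= cfwdK].
split=> // a Ua.
have [ct it] := tP a Ua; have [cc ca] := chart_inv Ua.1.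
pose U' := ccod d `&` cinv d @^-1` cdom c; pose t' := cfwd c \o cinv d.
have st' : smooth_on U' t' by exact: sm.
have U't : U' (t a) by split=> //; rewrite /= it.
have dt := smooth_differentiable st Ua; have dt' := smooth_differentiable st' U't.
apply: (J_unit_left_inverse dt dt').
have : \forall x \near a, U x by exact: open_nbhs_nbhs.
apply: filterS => x Ux /=; have [_ itx] := tP x Ux; rewrite /t' /= itx.
by have [] := chart_inv Ux.1.
Qed.

Section WintgenAtlas.
Variables (R : realType) (m : nat) (hm : (2 <= m)%N) (M : topologicalType).
Variables (A : set (chart M 'rV[R]_m)) (x : M -> 'rV[R]_(m + 3)) (W : set M) (n1 n2 : M -> 'rV[R]_(m + 3)).
Hypotheses (mA : smooth_manifold A) (wx : wintgen_ideal A x) (ux : wintgen_umbilic_free A x).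
Hypothesis (nf : smooth_normal_frame A x W n1 n2).

Definition chart_pre (c : chart M 'rV[R]_m) (U : set M) : set 'rV[R]_m := ccod c `&` cinv c @^-1` U.

Local Notation xi c := (gauss_lift (x \o cinv c) (n1 \o cinv c) (n2 \o cinv c)).

Let V c := chart_pre c W.

Lemma open_chart_pre c U : open U -> open (chart_pre c U).
Proof. exact: chart_cod_open. Qed.

Lemma atlas_data c : A c ->
  [/\ open (V c), smooth_on (V c) (x \o cinv c), smooth_on (V c) (n1 \o cinv c), smooth_on (V c) (n2 \o cinv c) &
   [/\ forall a, V c a -> dotr ((x \o cinv c) a) ((x \o cinv c) a) = 1,
       forall a, V c a -> immersive_at (x \o cinv c) a,
       forall a, V c a -> normal_frame (x \o cinv c) a ((n1 \o cinv c) a) ((n2 \o cinv c) a),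
       forall a, V c a -> wintgen_at (x \o cinv c) a
     & forall a, V c a -> wintgen_umbilic_free_at (x \o cinv c) a]].
Proof.
move=> Ac; have [oW s1 s2 H] := nf; have [sx Hx] := wx Ac.
split; [exact: open_chart_pre| |exact: s1|exact: s2|].
  by move=> k; apply: Ck_on_subset (sx k) => a [].
split=> a [ca Wa].
- by have [] := Hx _ ca.
- by have [] := Hx _ ca.
- exact: H.
- by have [] := Hx _ ca.
- exact: (ux Ac).
Qed.

Lemma atlas_structure c a : A c -> V c a ->
  exists (phi : 'rV[complex R]_m) (kappa : 'rV[complex R]_(1 + (m + 3))),
  [/\ forall v, exists l : complex R,
        cderive v (xi c) a = (map_mx (real_complex R) v *m phi^T) 0 0 *: kappa + l *: xi c a,
      forall l : complex R, kappa <> l *: xi c a,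
      lor kappa kappa = 0 /\ lor kappa (xi c a) = 0,
      forall z : complex R, exists v : 'rV[R]_m, (map_mx (real_complex R) v *m phi^T) 0 0 = z
    & forall v, Dperp (x \o cinv c) a v <-> (map_mx (real_complex R) v *m phi^T) 0 0 = 0].
Proof.
move=> Ac Va; have [oV sf s1 s2 [ff im fr hw hu]] := atlas_data Ac.
exact: (gauss_structure hm oV sf ff im s1 s2 fr hw hu Va).
Qed.

Lemma gauss_lift_chart c d a : A c -> A d -> V c a -> cdom d (cinv c a) ->
  xi c a = xi d (cfwd d (cinv c a)).
Proof.
move=> Ac Ad Va da.
have [oVc sfc s1c s2c [ffc imc frc _ _]] := atlas_data Ac.
have [oVd sfd s1d s2d [ffd imd frd _ _]] := atlas_data Ad.
have [oU st tP uJ] := transition mA Ac Ad.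
set U := ccod c `&` cinv c @^-1` cdom d in oU st tP uJ.
set t := cfwd d \o cinv c in st tP uJ.
pose U' := U `&` V c.
have oU' : open U' by exact: openI.
have UV y : U' y -> V d (t y).
  move=> [Uy Vy]; have [cd e] := tP _ Uy; split=> //=; rewrite [cinv d _]e.
  exact: Vy.2.
have U'a : U' a by split=> //; split=> //; exact: Va.1.
have st' : smooth_on U' t by move=> k; apply: Ck_on_subset (st k) => y [].
have Ve : V d (t a) by exact: UV.
have E (nu : M -> 'rV[R]_(m + 3)) : smooth_on (V d) (nu \o cinv d) ->
    (forall y, V d y -> normal_at (x \o cinv d) y ((nu \o cinv d) y)) ->
    mcs_lift (x \o cinv c) a (nu (cinv c a)) = mcs_lift (x \o cinv d) (t a) (nu (cinv d (t a))).
  move=> sn nn; have [_ e] := tP _ U'a.1.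
  have H : mean_curv (x \o cinv c) a (nu (cinv c a)) = mean_curv (x \o cinv d) (t a) (nu (cinv d (t a))).
    have h1 := mean_curv_comp oVd sfd sn nn oU' st' UV U'a (uJ _ U'a.1) (imd _ Ve).
    apply: etrans h1; rewrite /= e; apply: esym.
    have ee : {in U', (x \o cinv d) \o t =1 x \o cinv c}.
      by move=> y; rewrite inE => -[Uy _] /=; have [_ ->] := tP _ Uy.
    apply: (mean_curv_eq _ oU' ee U'a).
    exact: (differentiable_comp (smooth_differentiable st' U'a) (smooth_differentiable sfd Ve)).
  by rewrite /mcs_lift H /= e.
rewrite /gauss_lift; congr (cvec _ (- _)).
  by apply: (E n1 s1d) => y Vy; have [] := frd _ Vy.
by apply: (E n2 s2d) => y Vy; have [] := frd _ Vy.
Qed.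

(** Frees D^perp from the choice of a Wintgen frame, so that it can be compared
    between charts. *)
Lemma dperp_chart c a v : A c -> V c a ->
  Dperp (x \o cinv c) a v <-> exists l : complex R, cderive v (xi c) a = l *: xi c a.
Proof.
move=> Ac Va; have [phi [kappa [k1 k2 k3 k4 k5]]] := atlas_structure Ac Va.
have [l E] := k1 v; split=> [/k5 h0|[l' E']].
  by exists l; rewrite E h0 scale0r add0r.
apply/k5; apply/eqP/negPn/negP => hn.
move: E; rewrite E' => E; apply: (k2 (((map_mx (real_complex R) v *m phi^T) 0 0)^-1 * (l' - l))).
by apply: (scalerI hn); rewrite scalerA mulrA divff // mul1r scalerBl E addrK.
Qed.

(** By [dperp_chart] and the chart independence of xi, this is the chain rule. *)
Lemma dperp_transition c d a v : A c -> A d -> V c a -> cdom d (cinv c a) ->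
  Dperp (x \o cinv c) a v <->
  Dperp (x \o cinv d) (cfwd d (cinv c a)) ('D_v (cfwd d \o cinv c) a).
Proof.
move=> Ac Ad Va da.
have [oU st tP uJ] := transition mA Ac Ad.
set U := ccod c `&` cinv c @^-1` cdom d in oU st tP uJ.
set t := cfwd d \o cinv c in st tP uJ *.
have [oVc sfc s1c s2c [ffc imc frc _ _]] := atlas_data Ac.
have [oVd sfd s1d s2d [ffd imd frd _ _]] := atlas_data Ad.
have Ua : U a by split=> //; exact: Va.1.
have Vd : V d (t a) by have [cd e] := tP _ Ua; split=> //=; rewrite [cinv d _]e; exact: Va.2.
have E : cderive v (xi c) a = cderive ('D_v t a) (xi d) (t a).
  have dx : vdiff (xi d) (t a).
    exact: vCk_vdiff (vCk_gauss_lift oVd sfd imd s1d s2d 1) Vd.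
  apply: etrans (cderive_comp v (smooth_differentiable st Ua) dx).
  apply: near_eq_cderive.
  have : \forall y \near a, (U `&` V c) y by apply: open_nbhs_nbhs; split=> //; exact: openI.
  by apply: filterS => y [Uy Vy]; apply: gauss_lift_chart => //; exact: Uy.2.
have E0 := gauss_lift_chart Ac Ad Va da.
have D1 := dperp_chart v Ac Va; have D2 := dperp_chart ('D_v t a) Ad Vd.
split=> H.
  have [l El] := D1.1 H; apply: (D2.2); exists l.
  exact: (etrans (esym E) (etrans El (congr1 (fun y => l *: y) E0))).
have [l El] := D2.1 H; apply: (D1.2); exists l.
exact: (etrans E (etrans El (congr1 (fun y => l *: y) (esym E0)))).
Qed.

End WintgenAtlas.

(** * Submersions and their fibres *)

Definition toC (R : realType) (w : 'rV[R]_2) : complex R := Complex (w 0 0) (w 0 1).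
Definition toR2 (R : realType) (z : complex R) : 'rV[R]_2 :=
  \row_i (if i == 0 then complex.Re z else complex.Im z).

Lemma toC_inj (R : realType) : injective (@toC R).
Proof.
move=> u v [h0 h1]; apply/rowP => i; case: (unliftP 0 i) => [k|] ->; last exact: h0.
by rewrite (_ : lift 0 k = 1) //; apply: val_inj; rewrite /= ord1.
Qed.

Lemma toC0 (R : realType) : toC (0 : 'rV[R]_2) = 0.
Proof. by apply: complex_ext; rewrite /= mxE. Qed.

Lemma Ck_toR2 (R : realType) (V : normedModType R) p (D : set V) (F : V -> complex R) :
  open D -> Cck p D F -> Ck_on p D (fun a => toR2 (F a)).
Proof.
move=> oD [F1 F2]; apply/Ck_rVP => // j; case: (eqVneq j 0) => [->|j0].
  by apply: (Ck_on_eq oD _ F1) => x _; rewrite mxE.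
by apply: (Ck_on_eq oD _ F2) => x _; rewrite mxE (negPf j0).
Qed.

Lemma derive_toR2 (R : realType) (V : normedModType R) (F : V -> complex R) a v :
  differentiable (fun a => toR2 (F a)) a -> toC ('D_v (fun a => toR2 (F a)) a) = cder v F a.
Proof.
by move=> dF; apply: complex_ext; rewrite /= derive_coord //; apply: eq_derive => x; rewrite mxE.
Qed.

Lemma near_neq0 (R : realType) (V : topologicalType) (G : V -> R) a :
  {for a, continuous G} -> G a != 0 -> \forall x \near a, G x != 0.
Proof.
move=> cG h; apply: (cG [set x | x != 0]).
by apply: open_nbhs_nbhs; split=> //; exact: open_neq.
Qed.

Lemma open_neq0 (R : realType) (V : normedModType R) (D : set V) (F : V -> complex R) :
  open D -> Cck 0 D F -> open (D `&` [set a | F a != 0]).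
Proof.
move=> oD [F1 F2]; rewrite openE => a [Da Fa].
have nD : \forall x \near a, D x by exact: open_nbhs_nbhs.
have : complex.Re (F a) != 0 \/ complex.Im (F a) != 0.
  by move: Fa; rewrite /= eq_complex negb_and => /orP[]; [left|right].
move=> [h|h].
  have := near_neq0 (F1 _ Da) h.
  by apply: filterS2 nD => x Dx hx; split=> //=; rewrite eq_complex negb_and hx.
have := near_neq0 (F2 _ Da) h.
by apply: filterS2 nD => x Dx hx; split=> //=; rewrite eq_complex negb_and hx orbT.
Qed.

Lemma const_segment (R : realType) (V : normedModType R) k (F : V -> 'rV[complex R]_k) p u :
  (forall t : R, 0 <= t <= 1 -> vdiff F (p + t *: u)) ->
  (forall t : R, 0 <= t <= 1 -> cderive u F (p + t *: u) = 0) -> F (p + u) = F p.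
Proof.
move=> dF D0; apply/rowP => j; apply: complex_ext; apply/eqP; rewrite -subr_eq0; apply/eqP.
  have [|c /andP[c0 c1] E] := @mean_value_line R V (fun x => complex.Re (F x 0 j)) p u.
    by move=> t /dF/vdiffP/(_ j)[].
  have c01 : 0 <= c <= 1 by rewrite !ltW.
  have := congr1 (fun Y : 'rV[complex R]_k => complex.Re (Y 0 j)) (D0 _ c01).
  by rewrite (cderive_coord u j (dF _ c01)) /= mxE /= => <-.
have [|c /andP[c0 c1] E] := @mean_value_line R V (fun x => complex.Im (F x 0 j)) p u.
  by move=> t /dF/vdiffP/(_ j)[].
have c01 : 0 <= c <= 1 by rewrite !ltW.
have := congr1 (fun Y : 'rV[complex R]_k => complex.Im (Y 0 j)) (D0 _ c01).
by rewrite (cderive_coord u j (dF _ c01)) /= mxE /= => <-.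
Qed.

(** A smooth reparametrization with ramp 0 = 0, ramp 1 = 1 and values in [0, 1], so
    that curves can be defined for all times without leaving a convex set. *)
Definition ramp (R : realType) (t : R) : R := 2 * t ^+ 2 / (1 + t ^+ 4).

Lemma ramp01 (R : realType) (t : R) : 0 <= ramp t <= 1.
Proof.
have h : 0 < 1 + t ^+ 4 by rewrite ltr_pwDl // exprn_even_ge0.
rewrite /ramp; apply/andP; split.
  by apply: divr_ge0; [apply: mulr_ge0 => //; exact: sqr_ge0|exact: ltW].
rewrite ler_pdivrMr // mul1r.
by have := sqr_ge0 (t ^+ 2 - 1); nra.
Qed.

Lemma ramp_0 (R : realType) : ramp (0 : R) = 0.
Proof. by rewrite /ramp expr0n mulr0 mul0r. Qed.

Lemma ramp_1 (R : realType) : ramp (1 : R) = 1.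
Proof. by rewrite /ramp !expr1n mulr1 divff // pnatr_eq0. Qed.

Lemma smooth_ramp (R : realType) : smooth_on [set: R^o] (@ramp R : R^o -> R).
Proof.
move=> k; have oT : open [set: R^o] by exact: openT.
have C1 := @Ck_id1 R k [set: R^o].
have C2 := Ck_mul oT C1 C1; have C4 := Ck_mul oT C2 C2.
have Ci := Ck_inv oT _ (Ck_add oT (@Ck_cst R k _ R [set: R^o] 1) C4).
have Cn := Ck_mul oT (@Ck_cst R k _ R [set: R^o] 2) C2.
apply: (Ck_on_eq oT _ (Ck_mul oT Cn (Ci _))) => [t _|t _].
  by rewrite /ramp -!expr2 -exprM.
rewrite gt_eqF // ltr_pwDl // -!expr2 sqr_ge0 //.
Qed.

(** Around a point where its derivative is onto, a map can be straightened to a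
    linear projection; over the preimage of a product of balls its fibres are
    convex in the straightened coordinate, hence joined by smooth curves. *)
Lemma submersion_box (R : realType) N k (D : set 'rV[R]_N) (T : 'rV[R]_N -> 'rV[R]_k) b0
    (K : 'M[R]_(k, N)) :
  open D -> smooth_on D T -> D b0 -> K *m 'J T b0 = 1%:M ->
  exists (U : set 'rV[R]_N) (r : R) (sec : 'rV[R]_k -> 'rV[R]_N),
   [/\ open U, U b0, U `<=` D & 0 < r] /\
   [/\ forall a, U a -> ball (T b0) r (T a),
       smooth_on (ball (T b0) r) sec,
       forall w, ball (T b0) r w -> U (sec w) /\ T (sec w) = w,
       forall a w, U a -> exists v, 'D_v T a = w
     & forall a b, U a -> U b -> T a = T b -> exists c : R^o -> 'rV[R]_N,
        [/\ c 0 = a, c 1 = b, forall t, U (c t), smooth_on [set: R^o] c &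
            forall t, 'D_('D_(1 : R^o) c t) T (c t) = 0]].
Proof.
move=> oD sT Db0 KP.
have [U1 [V2 [f [g [[oU1 U1b U1D oV2 f0] [fgK gfK sf sg hf]]]]]] := straightening oD sT Db0 KP.
have [P PE] : exists P, P = 'J T b0 by exists ('J T b0).
rewrite -PE in KP hf.
have hg y : V2 y -> T (g y) = T b0 + y *m P.
  by move=> Vy; have [Ug fg] := gfK _ Vy; rewrite hf // fg.
have V20 : V2 0 by rewrite -f0; exact: (fgK _ U1b).1.
have [rho /= rho0 rhoV] := (nbhs_ballP _ _).1 (open_nbhs_nbhs (conj oV2 V20)).
have [C C0 HC] := norm_mulmx_le K.
(* In the splitting y = (y P) K + y (1 - P K) the first part is bounded by C r and
   the second by r; r is chosen so that C r + r = rho. *)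
pose r := rho / (C + 1).
have C1 : 0 < C + 1 by rewrite addr_gt0.
have r0 : 0 < r by rewrite divr_gt0.
pose Om := [set y : 'rV[R]_N | `|y *m P| < r /\ `|y *m (1%:M - P *m K)| < r].
have OmV y : Om y -> V2 y.
  move=> [h1 h2]; apply: rhoV; rewrite -ball_normE /= sub0r normrN.
  have -> : y = y *m P *m K + y *m (1%:M - P *m K) by rewrite mulmxBr mulmx1 mulmxA subrKC.
  apply: le_lt_trans (ler_normD _ _) _; have h3 := HC (y *m P).
  have h4 : C * `|y *m P| < C * r by rewrite ltr_pM2l.
  have h5 : rho = C * r + r by rewrite /r; field; rewrite gt_eqF.
  by rewrite h5; apply: ltrD => //; exact: le_lt_trans h3 h4.
have oOm : open Om.
  have H p (B : 'M[R]_(N, p)) : open [set y : 'rV[R]_N | `|y *m B| < r].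
    have cn : continuous (fun y : 'rV[R]_N => `|y *m B|).
      move=> y; apply: (@continuous_comp _ _ _ (mulmxr B) Num.norm); last exact: norm_continuous.
      exact: continuous_mulmxr.
    by apply: (open_comp (f := fun y : 'rV[R]_N => `|y *m B|) (D := [set t | t < r])) => [y _|];
      [exact: cn|exact: open_lt].
  exact: openI (H _ _) (H _ _).
pose U := U1 `&` f @^-1` Om.
have cf a : U1 a -> {for a, continuous f} by exact: (sf 0%N).
have dT a : U1 a -> differentiable T a by move=> /U1D; exact: smooth_differentiable.
exists U, r, (fun w => g ((w - T b0) *m K)); split; first split=> //.
- rewrite openE => a [Ua Oa]; apply: filterI; first exact: open_nbhs_nbhs.
  by apply: (cf a Ua); exact: open_nbhs_nbhs.
- by split=> //; rewrite /preimage /= f0 /Om /=; split; rewrite mul0mx normr0.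
- by move=> a [/U1D].
have VK w : ball (T b0) r w -> Om ((w - T b0) *m K).
  rewrite -ball_normE /= distrC => h; split.
    by rewrite -mulmxA KP mulmx1.
  by rewrite mulmxBr mulmx1 mulmxA -(mulmxA (w - _) K) KP mulmx1 subrr normr0.
split.
- by move=> a [Ua [h _]]; rewrite -ball_normE /= (hf a) // opprD addNKr normrN.
- have oB : open (ball (T b0) r) by exact: ball_open.
  apply: (smooth_comp (f := fun w => (w - T b0) *m K) oB oV2) => // [w /VK /OmV//|p].
  by apply: Ck_mulmxr => //; apply: Ck_add => //; [exact: Ck_id|exact: Ck_cst].
- move=> w /VK Ow; have [Ug fg] := gfK _ (OmV _ Ow).
  split; first by split=> //; rewrite /preimage /= fg.
  by rewrite hg; [rewrite -mulmxA KP mulmx1 subrKC|exact: OmV].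
- move=> a w [Ua Oa]; have [Vy ga] := fgK _ Ua.
  exists ('D_(w *m K) g (f a)); have dg : differentiable g (f a) by exact: smooth_differentiable sg Vy.
  have dTg : differentiable T (g (f a)) by rewrite ga; exact: dT.
  have nV : \forall y \near f a, V2 y by exact: open_nbhs_nbhs.
  have E : 'D_(w *m K) (T \o g) (f a) = w.
    rewrite (near_eq_derive (g := fun y => y *m P + T b0)); last first.
      by apply: filterS nV => y Vy'; rewrite /= hg // addrC.
    have lP (x : 'rV[R]_N) : differentiable (mulmxr P) x.
      by apply: linear_differentiable; exact: continuous_mulmxr.
    have dc : differentiable (fun _ : 'rV[R]_N => T b0) (f a) by exact: differentiable_cst.
    apply: etrans (deriveD (diff_derivable (lP (f a))) (diff_derivable dc)) _.
    rewrite derive_cst addr0 (deriveE _ (lP _)) diff_lin; last exact: continuous_mulmxr.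
    by rewrite /= -mulmxA KP mulmx1.
  by rewrite -[RHS]E (derive_comp _ dg dTg) ga.
move=> a b [Ua [a1 a2]] [Ub [b1 b2]] Tab.
have fP : f b *m P = f a *m P by apply: (addrI (T b0)); rewrite -!hf.
pose y (t : R^o) := f a + ramp t *: (f b - f a).
have yO t : Om (y t).
  have /andP[] := ramp01 (t : R); rewrite /y; move: (ramp _) => s t0 t1.
  split; first by rewrite mulmxDl -scalemxAl mulmxBl fP subrr scaler0 addr0.
  have -> : (f a + s *: (f b - f a)) *m (1%:M - P *m K) =
      (1 - s) *: (f a *m (1%:M - P *m K)) + s *: (f b *m (1%:M - P *m K)).
    by rewrite mulmxDl -scalemxAl mulmxBl scalerBr scalerBl scale1r addrA addrAC.
  apply: le_lt_trans (ler_normD _ _) _; rewrite !normrZ !ger0_norm ?subr_ge0 //.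
  have [->|tn0] := eqVneq s 0; first by rewrite subr0 mul1r mul0r addr0.
  have tp : 0 < s by rewrite lt_def tn0.
  have h1 : (1 - s) * `|f a *m (1%:M - P *m K)| <= (1 - s) * r.
    by rewrite ler_wpM2l ?subr_ge0 // ltW.
  have h2 : s * `|f b *m (1%:M - P *m K)| < s * r by rewrite ltr_pM2l.
  by apply: lt_le_trans (ler_ltD h1 h2) _; rewrite -mulrDl subrK mul1r.
have Tc t : T (g (y t)) = T a.
  rewrite hg; last exact: OmV.
  by rewrite (hf a) // /y mulmxDl -scalemxAl mulmxBl fP subrr scaler0 addr0.
have oT : open [set: R^o] by exact: openT.
have sy : smooth_on [set: R^o] y.
  move=> p; apply: Ck_add => //; first exact: Ck_cst.
  exact: (Ck_scaleR (h := fun t : R^o => ramp (t : R)) oT (smooth_ramp R p) (Ck_cst _ _ _)).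
have sgy : smooth_on [set: R^o] (g \o y).
  by apply: (smooth_comp oT oV2) => // t _; exact: OmV.
exists (g \o y); split=> //.
- by rewrite /= /y ramp_0 scale0r addr0; exact: (fgK _ Ua).2.
- by rewrite /= /y ramp_1 scale1r subrKC; exact: (fgK _ Ub).2.
- move=> t; have [Ug fg] := gfK _ (OmV _ (yO t)).
  by split=> //; rewrite /preimage /= fg.
move=> t; have [Ug _] := gfK _ (OmV _ (yO t)).
have dc : differentiable (g \o y) t by exact: smooth_differentiable sgy I.
apply: etrans (esym (derive_comp (1 : R^o) dc (dT _ Ug))) _.
apply: etrans (derive_cst (T a) t (1 : R^o)).
by apply: eq_derive => s; exact: Tc.
Qed.

(** * The Gauss map as a function on a disc *)

Section Fibration.
Variables (R : realType) (m n : nat) (V : set 'rV[R]_m) (F : 'rV[R]_m -> 'rV[complex R]_(1 + n)).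
Hypotheses (oV : open V) (CF : forall p, vCk p V F).
Hypothesis (str : forall a, V a ->
  exists (phi : 'rV[complex R]_m) (kappa : 'rV[complex R]_(1 + n)),
  [/\ forall v, exists l : complex R,
        cderive v F a = (map_mx (real_complex R) v *m phi^T) 0 0 *: kappa + l *: F a,
      forall l : complex R, kappa <> l *: F a,
      lor kappa kappa = 0 /\ lor kappa (F a) = 0
    & forall z : complex R, exists v : 'rV[R]_m, (map_mx (real_complex R) v *m phi^T) 0 0 = z]).
Hypothesis (F0 : forall a, V a -> lor (F a) (F a) = 0).
Variables (a0 : 'rV[R]_m) (j : 'I_(1 + n)).
Hypotheses (Va0 : V a0) (Fj0 : F a0 0 j != 0).

Let V1 := V `&` [set a | F a 0 j != 0].
Let Z a := (F a 0 j)^-1 *: F a.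

Let cj p : Cck p V (fun a => F a 0 j). Proof. by move: j; apply/(vCkP _ _ oV). Qed.

Let oV1 : open V1. Proof. exact: (open_neq0 oV (cj 0)). Qed.

Let CZ p : vCk p V1 Z.
Proof.
have C1 : Cck p V1 (fun a => F a 0 j).
  by have [h1 h2] := cj p; split; [apply: Ck_on_subset h1|apply: Ck_on_subset h2] => a [].
apply: vCk_scale => //; last by apply: vCk_subset (CF p) => a [].
by apply: Cck_inv => // a [].
Qed.

Let dZ a (Va : V1 a) : vdiff Z a := vCk_vdiff (CZ 1) Va.

(** Dividing by the j-th coordinate makes that coordinate of the lift constant; the
    derivative then has no component along the lift itself, and the unspecified
    multiple of F disappears. *)
Lemma normalized_str a : V1 a ->
  exists (phi : 'rV[complex R]_m) (c : 'rV[complex R]_(1 + n)),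
  [/\ forall v, cderive v Z a = (map_mx (real_complex R) v *m phi^T) 0 0 *: c,
      [/\ c != 0, c 0 j = 0, lor c c = 0 & lor c (Z a) = 0],
      forall z : complex R, exists v : 'rV[R]_m, (map_mx (real_complex R) v *m phi^T) 0 0 = z
    & forall v, (map_mx (real_complex R) v *m phi^T) 0 0 = 0 <->
        exists l : complex R, cderive v F a = l *: F a].
Proof.
move=> [Va Fa]; have [phi [kappa [k1 k2 [k3 k4] k5]]] := str Va.
have dF : vdiff F a := vCk_vdiff (CF 1) Va.
have [dj _] : cdiff (fun a => (F a 0 j)^-1) a /\ True.
  by split=> //; apply: (Cck_cdiff (D := V1) (p := 0)) => //;
   apply: Cck_inv => // [b []//|]; have [h1 h2] := cj 1; split;
   [apply: Ck_on_subset h1|apply: Ck_on_subset h2] => b [].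
(* The multiple of F cancels the j-th coordinate of kappa. *)
pose c := (F a 0 j)^-1 *: kappa - (kappa 0 j * (F a 0 j)^-1 * (F a 0 j)^-1) *: F a.
have cjz : c 0 j = 0 by rewrite !mxE; field.
exists phi, c; split => //.
- move=> v; have [l E] := k1 v.
  have [_ E2] := cderive_scale v dj dF.
  set s := _ 0 0 in E *.
  pose t := cder v (fun a => (F a 0 j)^-1) a + (F a 0 j)^-1 * l.
  have E3 : cderive v Z a = (s * (F a 0 j)^-1) *: kappa + t *: F a.
    apply: etrans E2 _; rewrite E scalerDr !scalerA /t scalerDl addrCA [s * _]mulrC.
    by [].
  have Z1 : (cderive v Z a) 0 j = 0.
    rewrite (cderive_coord v j (dZ (conj Va Fa))).
    apply: (cst_cder0 (c := 1) v oV1) => [b [Vb Fb]|]; last by split.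
    by rewrite mxE mulVf.
  have tE : t = - (s * (F a 0 j)^-1 * kappa 0 j * (F a 0 j)^-1).
    move: Z1; rewrite E3 !mxE => /eqP; rewrite addrC addr_eq0 => /eqP h.
    by apply: (mulIf Fa); rewrite h mulNr divfK.
  rewrite E3 tE /c scalerBr !scalerA scaleNr; congr (_ - _ *: _); ring.
- split=> //.
  + apply/eqP => c0; apply: (k2 (F a 0 j * (kappa 0 j * (F a 0 j)^-1 * (F a 0 j)^-1))).
    move: c0; rewrite /c => /eqP; rewrite subr_eq0 => /eqP h.
    by rewrite -scalerA -h scalerA mulfV // scale1r.
  + rewrite !(lorDl, lorDr, lorNl, lorNr, lorZl, lorZr) k3 (lorC (F a)) k4 F0 //; ring.
  + rewrite !(lorDl, lorDr, lorNl, lorNr, lorZl, lorZr) k4 F0 //; ring.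
- move=> v; have [l E] := k1 v; split=> [h|[l' E']].
    by exists l; rewrite E h scale0r add0r.
  apply/eqP/negPn/negP => hn.
  move: E; rewrite E' => E; apply: (k2 (((map_mx (real_complex R) v *m phi^T) 0 0)^-1 * (l' - l))).
  by apply: (scalerI hn); rewrite scalerA mulrA divff // mul1r scalerBl E addrK.
Qed.

Let Z_j a : V1 a -> Z a 0 j = 1. Proof. by move=> [_ Fa]; rewrite mxE mulVf. Qed.

Let Z_self a : V1 a -> lor (Z a) (Z a) = 0.
Proof. by move=> [Va _]; rewrite lorZl lorZr F0 // !mulr0. Qed.

(** The submersion h is a coordinate k of the normalized lift Z with c_k nonzero, seen
    as a planar map. Z is constant on its fibres, so Z = Zs o h with Zs = Z o sec for
    a section sec of h; since the k-th coordinate of Zs is the identity of the plane,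
    its derivative is complex linear. *)
Lemma local_fibration : exists (U : set 'rV[R]_m) (h : 'rV[R]_m -> 'rV[R]_2) (y0 : 'rV[R]_2) (r : R)
    (Zs : 'rV[R]_2 -> 'rV[complex R]_(1 + n)),
  [/\ [/\ open U, U a0, U `<=` V & 0 < r],
   [/\ smooth_on U h, forall a, U a -> ball y0 r (h a), forall w, ball y0 r w -> exists2 a, U a & h a = w,
    forall a w, U a -> exists v, 'D_v h a = w &
    forall a v, U a -> 'D_v h a = 0 <-> exists l : complex R, cderive v F a = l *: F a],
   forall a b, U a -> U b -> h a = h b -> exists g : R^o -> 'rV[R]_m,
    [/\ g 0 = a, g 1 = b, forall t, U (g t), smooth_on [set: R^o] g &
        forall t, 'D_('D_(1 : R^o) g t) h (g t) = 0],
   [/\ forall p, vCk p (ball y0 r) Zs, forall w, ball y0 r w -> Zs w 0 j = 1 /\ lor (Zs w) (Zs w) = 0,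
       forall w, ball y0 r w -> exists2 a, U a & exists2 s : complex R, s != 0 & F a = s *: Zs w &
       forall a, U a -> exists2 s : complex R, s != 0 & F a = s *: Zs (h a)]
  & forall w, ball y0 r w -> exists c : 'rV[complex R]_(1 + n),
     [/\ forall v, cderive v Zs w = toC v *: c, c != 0, c 0 j = 0, lor c c = 0 & lor c (Zs w) = 0]].
Proof.
have Va1 : V1 a0 by split.
have [phi0 [c0 [D0 [c0n _ _ _] sur0 _]]] := normalized_str Va1.
have [k ck] : exists k, c0 0 k != 0.
  apply/existsP; apply: contraR c0n; rewrite negb_exists => /forallP H.
  by apply/eqP/rowP => i; rewrite mxE; apply/eqP; have := H i; rewrite negbK.
pose h a := toR2 (Z a 0 k).
have Ck p : Cck p V1 (fun a => Z a 0 k) by move: k {ck h}; apply/(vCkP _ _ oV1).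
have sh : smooth_on V1 h by move=> p; exact: Ck_toR2.
have dh a : V1 a -> differentiable h a by exact: smooth_differentiable.
have Dh a v : V1 a -> toC ('D_v h a) = cder v (fun a => Z a 0 k) a.
  by move=> Va; exact: (derive_toR2 v (dh _ Va)).
have Dh2 a v : V1 a -> toC ('D_v h a) = (cderive v Z a) 0 k.
  by move=> Va; rewrite Dh // cderive_coord //; exact: dZ.
have sur w : exists v, 'D_v h a0 = w.
  have [v hv] := sur0 (toC w / c0 0 k); exists v; apply: toC_inj.
  by rewrite Dh2 // D0 mxE hv divfK.
have [K KP] : exists K, K *m 'J h a0 = 1%:M.
  apply/row_fullP; rewrite -sub1mx; apply/row_subP => i.
  have [v hv] := sur (row i 1%:M); rewrite -hv deriveEjacobian ?submxMl //; exact: dh.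
have [U [r [sec [[oU Ua UV r0] [bU ssec secP sU fib]]]]] := submersion_box oV1 sh Va1 KP.
have Dh0 a v : V1 a -> (forall w, exists v, 'D_v h a = w) ->
    'D_v h a = 0 <-> exists l : complex R, cderive v F a = l *: F a.
  move=> Va su; have [phi [c [D1 [cn cj0 c2 c3] _ ker]]] := normalized_str Va.
  have ckn : c 0 k != 0.
    apply/eqP => c0k; have [u hu] := su (delta_mx 0 0).
    have : toC ('D_u h a) = 0 by rewrite Dh2 // D1 mxE c0k mulr0.
    by rewrite hu => /(congr1 (@complex.Re R)) /=; rewrite mxE /= => /eqP; rewrite oner_eq0.
  split=> [E|/ker E].
    apply/ker; have : toC ('D_v h a) = 0 by rewrite E toC0.
    by rewrite Dh2 // D1 mxE => /eqP; rewrite mulf_eq0 (negPf ckn) orbF => /eqP.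
  by apply: toC_inj; rewrite toC0 Dh2 // D1 E scale0r mxE.
have Dh3 a v : U a -> 'D_v h a = 0 <-> exists l : complex R, cderive v F a = l *: F a.
  by move=> Ua'; apply: Dh0 (UV _ Ua') _ => w; exact: sU.
have DZ a v : U a -> 'D_v h a = 0 -> cderive v Z a = 0.
  move=> Ua' /(Dh3 _ _ Ua'); have [phi [c [D1 _ _ ker]]] := normalized_str (UV _ Ua').
  by move=> /ker E; rewrite D1 E scale0r.
have oB : open (ball (h a0) r) by exact: ball_open.
have oT : open [set: R^o] by exact: openT.
have Zfib a b : U a -> U b -> h a = h b -> Z a = Z b.
  move=> Ua' Ub hab; have [c [c0' c1 cU sc Dc]] := fib a b Ua' Ub hab.
  have dc t : differentiable c t by exact: smooth_differentiable sc I.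
  have dZc t : vdiff (Z \o c) t by exact: (vdiff_comp (dc t) (dZ (UV _ (cU t)))).
  have Dzc t : cderive (1 : R^o) (Z \o c) t = 0.
    apply: etrans (cderive_comp (1 : R^o) (dc t) (dZ (UV _ (cU t)))) _.
    exact: (DZ _ _ (cU t) (Dc t)).
  have := @const_segment R R^o _ (Z \o c) 0 1 (fun t _ => dZc _) (fun t _ => Dzc _).
  by rewrite add0r /= c0' c1.
have FZ a : V a -> F a 0 j != 0 -> F a = F a 0 j *: Z a by move=> _ Fa; rewrite scalerA mulfV // scale1r.
exists U, h, (h a0), r, (Z \o sec); split.
- by split=> // a /UV[].
- split=> //; first by move=> p; exact: Ck_on_subset UV (sh p).
  by move=> w /secP[Uw hw]; exists (sec w).
- exact: fib.
- split.
  + by move=> p; apply: (vCk_comp oB oV1 _ (ssec p) (CZ p)) => w /secP[/UV].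
  + by move=> w /secP[/UV Vw _]; split; [exact: Z_j|exact: Z_self].
  + move=> w /secP[Uw hw]; exists (sec w) => //; have [Vw Fw] := UV _ Uw.
    by exists (F (sec w) 0 j) => //; exact: FZ.
  + move=> a Ua'; have [Va Fa] := UV _ Ua'; exists (F a 0 j) => //.
    have [Us hs] := secP _ (bU _ Ua').
    by rewrite /= (Zfib _ _ Us Ua' hs); exact: FZ.
move=> w Bw; have [Us hs] := secP _ Bw; have Vs := UV _ Us.
have [phi [c [D1 [cn cj0 c2 c3] _ ker]]] := normalized_str Vs.
have dsec : differentiable sec w by exact: smooth_differentiable ssec Bw.
have E v : toC v = (map_mx (real_complex R) ('D_v sec w) *m phi^T) 0 0 * c 0 k.
  have Ev : v = 'D_('D_v sec w) h (sec w).
    apply: etrans (derive_comp v dsec (dh _ Vs)); apply: etrans (esym (derive_id w v)) _.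
    apply: near_eq_derive; have nB : \forall x \near w, ball (h a0) r x by exact: open_nbhs_nbhs.
    by apply: filterS nB => x /secP[_ hx]; rewrite /= hx.
  by rewrite {1}Ev Dh2 // D1 mxE.
have ckn : c 0 k != 0.
  apply/eqP => c0k; have := E (delta_mx 0 0); rewrite c0k mulr0.
  by move=> /(congr1 (@complex.Re R)) /=; rewrite mxE /= => /eqP; rewrite oner_eq0.
exists ((c 0 k)^-1 *: c); split.
- move=> v; rewrite (cderive_comp _ dsec (dZ Vs)) D1 E scalerA mulfK //.
- by rewrite scaler_eq0 invr_eq0 (negPf ckn).
- by rewrite mxE cj0 mulr0.
- by rewrite lorZl lorZr c2 !mulr0.
- by rewrite lorZl c3 mulr0.
Qed.

End Fibration.

(** * The disc as a Riemann surface *)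

Lemma rV_hausdorff (R : realType) k : hausdorff_space 'rV[R]_k.
Proof. exact: norm_hausdorff. Qed.

Lemma rV_second_countable (R : realType) k : @second_countable 'rV[R]_k.
Proof.
pose b (p : 'rV[rat]_k * nat) : set 'rV[R]_k := ball (map_mx ratr p.1 : 'rV[R]_k) (p.2.+1%:R^-1).
exists (range b).
  exact: (card_le_trans (card_image_le b setT) (countableP _)).
split; first by move=> _ [p _ <-]; exact: ball_open.
move=> x V /nbhs_ballP[e /= e0 H].
have [n n2] : exists n : nat, n.+1%:R^-1 < e / 2.
  by have [n _ /(_ n (leqnn n)) h] := near_infty_natSinv_lt (PosNum (divr_gt0 e0 (ltr0Sn R 1))); exists n.
have n0 : 0 < n.+1%:R^-1 :> R by rewrite invr_gt0.
have /choice[q qP] : forall j, exists q : rat, ratr q \in `]x 0 j - n.+1%:R^-1, x 0 j + n.+1%:R^-1[.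
  by move=> j; apply: rat_in_itvoo; rewrite ltrBlDr -addrA ltrDl addr_gt0.
pose c : 'rV[rat]_k := \row_j q j.
have xc : ball (map_mx ratr c : 'rV[R]_k) n.+1%:R^-1 x.
  split=> // i j; rewrite ord1 !mxE; have := qP j; rewrite in_itv /= => /andP[h1 h2].
  by rewrite /ball /= ltr_norml; move: (_^-1) h1 h2 => d h1 h2; apply/andP; split; lra.
exists (b (c, n)); first by split=> //; exists (c, n).
move=> y yc; apply: H.
have E : e = e / 2 + e / 2 by field.
rewrite E; apply: (ball_triangle (y := map_mx ratr c : 'rV[R]_k)).
  by apply: ball_sym; exact: le_ball (ltW n2) _ xc.
exact: le_ball (ltW n2) _ yc.
Qed.

Lemma rV_connected (R : realType) k : connected [set: 'rV[R]_k].
Proof.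
have -> : [set: 'rV[R]_k] = \bigcup_(v in [set: 'rV[R]_k]) ((fun t : R => t *: v) @` `[0, 1]%classic).
  apply/esym/seteqP; split=> // v _; exists v => //; exists 1; last by rewrite scale1r.
  by rewrite /= in_itv /= ler01 lexx.
apply: bigcup_connected.
  by exists 0 => v _; exists 0; [rewrite /= in_itv /= lexx ler01|rewrite scale0r].
move=> v _; apply: connected_continuous_connected; first exact: segment_connected.
by apply: continuous_subspaceT => t; apply: cvgZr_tmp; exact: cvg_id.
Qed.

Section Disk.
Variables (R : realType) (k : nat) (y0 : 'rV[R]_k) (r : R) (r0 : 0 < r).

(** A radial homeomorphism from the whole space onto the ball, inverse to [of_ball]. *)
Definition to_ball (w : 'rV[R]_k) : 'rV[R]_k := y0 + (r / (1 + `|w|)) *: w.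
Definition of_ball (y : 'rV[R]_k) : 'rV[R]_k := (r - `|y - y0|)^-1 *: (y - y0).

Let N0 (w : 'rV[R]_k) : 0 < 1 + `|w|. Proof. by rewrite ltr_pwDl. Qed.

Lemma to_ball_in w : ball y0 r (to_ball w).
Proof.
rewrite -ball_normE /= /to_ball opprD addNKr normrN normrZ ger0_norm ?divr_ge0 // ?ltW //.
by rewrite mulrAC ltr_pdivrMr // ltr_pM2l // ltrDr.
Qed.

Lemma to_ballK : cancel to_ball of_ball.
Proof.
move=> w; rewrite /of_ball /to_ball [y0 + _]addrC addrK normrZ ger0_norm ?divr_ge0 // ?ltW //.
rewrite scalerA (_ : _ * _ = 1) ?scale1r //; have := N0 w; set a := `|w| => a0.
have -> : r - r / (1 + a) * a = r / (1 + a) by field; rewrite gt_eqF.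
by rewrite mulVf // gt_eqF // divr_gt0.
Qed.

Lemma of_ballK y : ball y0 r y -> to_ball (of_ball y) = y.
Proof.
rewrite -ball_normE /= distrC => h; have h0 : 0 < r - `|y - y0| by rewrite subr_gt0.
rewrite /to_ball /of_ball normrZ ger0_norm ?invr_ge0 ?(ltW h0) // scalerA.
rewrite (_ : _ * _ = 1) ?scale1r ?subrKC //; move: h0; set a := `|y - y0| => a0.
by field; rewrite (gt_eqF a0) subrK gt_eqF.
Qed.

Lemma to_ball_range : to_ball @` setT = ball y0 r.
Proof.
apply/seteqP; split=> [_ [w _ <-]|y By]; first exact: to_ball_in.
by exists (of_ball y) => //; exact: of_ballK.
Qed.

Lemma to_ball_continuous w : {for w, continuous to_ball}.
Proof.
have oT : open [set: 'rV[R]_k] by exact: openT.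
have Cn : Ck_on 0 [set: 'rV[R]_k] (fun w : 'rV[R]_k => `|w| : R) by move=> x _; exact: norm_continuous.
have Ci := Ck_inv oT _ (Ck_add oT (@Ck_cst R 0 _ R setT 1) Cn).
have Cs := Ck_scaleR oT (Ck_mul oT (@Ck_cst R 0 _ R setT r) (Ci _)) (Ck_id 0 setT).
apply: (Ck_add oT (Ck_cst 0 setT y0) (Cs _)) => // x _; by rewrite gt_eqF.
Qed.

Lemma of_ball_continuous y : ball y0 r y -> {for y, continuous of_ball}.
Proof.
move=> By; have oB : open (ball y0 r) by exact: ball_open.
have Cs : Ck_on 0 (ball y0 r) (fun x : 'rV[R]_k => x - y0).
  exact: (Ck_add oB (Ck_id 0 _) (Ck_cst 0 _ (- y0))).
have Cn : Ck_on 0 (ball y0 r) (fun w : 'rV[R]_k => `|w - y0| : R).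
  by move=> x Bx; exact: (continuous_comp (Cs x Bx) (@norm_continuous _ _ _)).
have Ci := Ck_inv oB _ (Ck_add oB (@Ck_cst R 0 _ R (ball y0 r) r) (Ck_opp oB Cn)).
apply: (Ck_scaleR oB (Ci _) Cs) => // x.
by rewrite -ball_normE /= distrC => h; rewrite gt_eqF // subr_gt0.
Qed.

Lemma to_ball_open : open (to_ball @` setT).
Proof. by rewrite to_ball_range; exact: ball_open. Qed.

Definition disk_chart : chart 'rV[R]_k 'rV[R]_k :=
  Chart openT to_ball_open (fun p _ => to_ballK p) (fun p _ => @to_ball_continuous p)
    (fun a Ha => @of_ball_continuous a (eq_ind _ (fun S : set _ => S a) Ha _ to_ball_range)).

Lemma disk_cod : ccod disk_chart = ball y0 r.
Proof. exact: to_ball_range. Qed.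

End Disk.

Lemma disk_riemann_surface (R : realType) (y0 : 'rV[R]_2) (r : R) (r0 : 0 < r) :
  riemann_surface [set disk_chart y0 r0].
Proof.
have oB : open (ball y0 r) by exact: ball_open.
have E c d : [set disk_chart y0 r0] c -> [set disk_chart y0 r0] d ->
    ccod c `&` cinv c @^-1` cdom d `<=` ball y0 r /\
    {in (ball y0 r : set 'rV[R]_2), id =1 cfwd d \o cinv c}.
  move=> -> ->; split=> y; first by rewrite disk_cod => -[].
  by rewrite inE => By; rewrite /= of_ballK.
split; first split.
- exact: rV_hausdorff.
- exact: rV_second_countable.
- by move=> q; exists (disk_chart y0 r0).
- move=> c d cB dB; have [h1 h2] := E c d cB dB => p; apply: Ck_on_subset h1 _.
  exact: Ck_on_eq oB h2 (Ck_id _ _).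
move=> c d cB dB a /((E c d cB dB).1) Ba; have [_ h2] := E c d cB dB.
have ne : \forall x \near a, id x = (cfwd d \o cinv c) x.
  have : \forall x \near a, ball y0 r x by exact: open_nbhs_nbhs.
  by apply: filterS => x Bx; apply: h2; rewrite inE.
have did : differentiable (id : 'rV[R]_2 -> 'rV[R]_2) a by have [+ _] := Ck_id 1 (setT : set 'rV[R]_2); exact.
split; first exact: near_eq_differentiable ne did.
rewrite -!(near_eq_derive _ ne) !derive_id.
by apply/rowP => i; rewrite !mxE /=; ring.
Qed.

(** * The curve of mean curvature spheres *)

Section DiskCurve.
Variables (R : realType) (n : nat) (y0 : 'rV[R]_2) (r : R) (r0 : 0 < r).
Variables (Zs : 'rV[R]_2 -> 'rV[complex R]_(1 + n)) (j : 'I_(1 + n)).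
Local Notation B := (ball y0 r : set 'rV[R]_2).
Hypotheses (CZ : forall p, vCk p B Zs).
Hypotheses (Zj : forall w, B w -> Zs w 0 j = 1) (ZZ : forall w, B w -> lor (Zs w) (Zs w) = 0).
Hypothesis (Zpos : forall w, B w -> 0 < lor (Zs w) (map_mx Num.conj (Zs w))).
Hypothesis (dZ : forall w, B w -> exists c : 'rV[complex R]_(1 + n),
     [/\ forall v, cderive v Zs w = toC v *: c, c != 0, c 0 j = 0, lor c c = 0 & lor c (Zs w) = 0]).

Local Notation D := (disk_chart y0 r0).

Definition disk_curve (w : 'rV[R]_2) : cline R n := <[Zs (to_ball y0 r w)]>%VS.

Let oB : open B. Proof. exact: ball_open. Qed.

Lemma disk_smooth_curve : smooth_curve [set D] disk_curve.
Proof.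
split=> [q|q].
  by exists (Zs (to_ball y0 r q)); split=> //; [exact/ZZ/to_ball_in|exact/Zpos/to_ball_in].
exists setT, (Zs \o to_ball y0 r); split=> //; split=> //; first exact: openT.
  move=> c -> p; have sB : ccod D `&` cinv D @^-1` setT `<=` B by rewrite disk_cod => y [].
  apply: Ck_on_subset sB _; apply: (Ck_on_eq oB _ (CZ p).1) => y; rewrite inE => By.
  by rewrite /= of_ballK.
move=> c -> p; have sB : ccod D `&` cinv D @^-1` setT `<=` B by rewrite disk_cod => y [].
apply: Ck_on_subset sB _; apply: (Ck_on_eq oB _ (CZ p).2) => y; rewrite inE => By.
by rewrite /= of_ballK.
Qed.

(** Any local lift is a nowhere zero multiple of the normalized one: the factor is its
    j-th coordinate, hence differentiable. *)
Lemma disk_lift W Z : local_lift [set D] disk_curve W Z ->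
  forall a, B a -> W (of_ball y0 r a) ->
  exists (c : 'rV[complex R]_(1 + n)) (l : complex R) (dl : 'rV[R]_2 -> complex R),
  [/\ l != 0, Z (of_ball y0 r a) = l *: Zs a,
      forall v, cderive v (Z \o cinv D) a = dl v *: Zs a + (l * toC v) *: c &
      [/\ c != 0, c 0 j = 0, lor c c = 0 & lor c (Zs a) = 0]].
Proof.
move=> [oW s1 s2 gZ] a Ba Wa.
have [c [Dc c0 cj cc cz]] := dZ Ba.
pose O := ccod D `&` cinv D @^-1` W.
have oO : open O by exact: chart_cod_open.
have Oa : O a by split=> //; rewrite disk_cod.
have OB : O `<=` B by rewrite /O disk_cod => y [].
have C1 p : vCk p O (Z \o cinv D) by split; [exact: (s1 D erefl p)|exact: (s2 D erefl p)].
have E y : O y -> (Z \o cinv D) y = (Z \o cinv D) y 0 j *: Zs y.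
  move=> Oy; have By := OB _ Oy; have := gZ _ Oy.2; rewrite /disk_curve /= of_ballK //.
  move=> e; have : Z (of_ball y0 r y) \in <[Zs y]>%VS by rewrite e memv_line.
  by move=> /vlineP[k ->]; rewrite mxE Zj // mulr1.
have Cl : Cck 1 O (fun y => (Z \o cinv D) y 0 j) by move: j; apply/(vCkP _ _ oO).
have dl := Cck_cdiff Cl Oa.
have dZs : vdiff Zs a by exact: vCk_vdiff (CZ 1) Ba.
exists c, ((Z \o cinv D) a 0 j), (fun v => cder v (fun y => (Z \o cinv D) y 0 j) a); split=> //.
- apply/eqP => l0; have := gZ _ Oa.2; have := E _ Oa; rewrite l0 scale0r /= => ->.
  rewrite /disk_curve /= of_ballK // => e.
  have : Zs a \in <[0 : 'rV[complex R]_(1 + n)]>%VS by rewrite -e memv_line.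
  move=> /vlineP[k]; rewrite scaler0 => z0; have := Zj Ba; rewrite z0 mxE => /eqP.
  by rewrite eq_sym oner_eq0.
- exact: E.
move=> v; have [_ E2] := cderive_scale v dl dZs.
apply: etrans (etrans E2 _); last by rewrite Dc scalerA.
apply: near_eq_cderive; have : \forall y \near a, O y by exact: open_nbhs_nbhs.
by apply: filterS => y; exact: E.
Qed.

Lemma toC_eu : toC (eu R) = 1. Proof. by apply: complex_ext; rewrite /= !mxE. Qed.
Lemma toC_ev : toC (ev R) = 'i. Proof. by apply: complex_ext; rewrite /= !mxE. Qed.

Lemma disk_holomorphic : holomorphic_curve [set D] disk_curve.
Proof.
split; first exact: disk_smooth_curve.
move=> W Z lZ _ -> a Da Wa; have Ba : B a by rewrite -(disk_cod y0 r0).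
have [c [l [dl [l0 Zl Dl [c0 cj _ _]]]]] := disk_lift lZ Ba Wa.
split=> [|v [k]].
  exists (2^-1 * (dl (eu R) + 'i * dl (ev R)) / l).
  rewrite /d_zbar !Dl toC_eu toC_ev [Z _]Zl; apply/rowP => k; rewrite !mxE.
  transitivity (2^-1 * ((dl (eu R) + 'i * dl (ev R)) * Zs a 0 k + l * (1 + 'i * 'i) * c 0 k)); first ring.
  by rewrite sqri subrr mulr0 mul0r addr0; field.
rewrite Dl [Z _]Zl => e; apply: toC_inj; rewrite toC0.
have e1 : dl v = k * l.
  have := congr1 (fun Y : 'rV[complex R]_(1 + n) => Y 0 j) e.
  by rewrite !mxE cj Zj // mulr0 addr0 !mulr1.
move: e; rewrite scalerA e1 addrC -[X in _ = X]add0r => /addIr/eqP.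
by rewrite scaler_eq0 (negPf c0) orbF mulf_eq0 (negPf l0) => /eqP.
Qed.

Lemma disk_isotropic : one_isotropic [set D] disk_curve.
Proof.
move=> W Z lZ _ -> a Da Wa; have Ba : B a by rewrite -(disk_cod y0 r0).
have [c [l [dl [l0 Zl Dl [c0 cj cc cz]]]]] := disk_lift lZ Ba Wa.
have -> : d_z (Z \o cinv D) a = (2^-1 * (dl (eu R) - 'i * dl (ev R))) *: Zs a + l *: c.
  rewrite /d_z !Dl toC_eu toC_ev; apply/rowP => k; rewrite !mxE.
  transitivity (2^-1 * ((dl (eu R) - 'i * dl (ev R)) * Zs a 0 k + l * (1 - 'i * 'i) * c 0 k)); first ring.
  by rewrite sqri; field.
rewrite !(lorDl, lorDr, lorZl, lorZr) (lorC (Zs a) c) cc cz ZZ //; ring.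
Qed.

End DiskCurve.

(** * The space of leaves *)

Section WintgenQuotient.
Variables (R : realType) (m : nat) (hm : (2 <= m)%N) (M : topologicalType).
Variables (A : set (chart M 'rV[R]_m)) (x : M -> 'rV[R]_(m + 3)) (W : set M) (n1 n2 : M -> 'rV[R]_(m + 3)).
Hypotheses (mA : smooth_manifold A) (wx : wintgen_ideal A x) (ux : wintgen_umbilic_free A x).
Hypothesis (nf : smooth_normal_frame A x W n1 n2).
Local Notation xi c := (gauss_lift (x \o cinv c) (n1 \o cinv c) (n2 \o cinv c)).

Variables (c0 : chart M 'rV[R]_m) (Ac0 : A c0).
Variables (U0 : set 'rV[R]_m) (h : 'rV[R]_m -> 'rV[R]_2) (y0 : 'rV[R]_2) (r : R).
Local Notation V := (chart_pre c0 W).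
Hypotheses (r0 : 0 < r) (oU0 : open U0) (U0V : U0 `<=` V) (sh : smooth_on U0 h).
Hypothesis (hB : forall a, U0 a -> ball y0 r (h a)).
Hypothesis (hS : forall w, ball y0 r w -> exists2 a, U0 a & h a = w).
Hypothesis (hD : forall a w, U0 a -> exists v, 'D_v h a = w).
Hypothesis (hK : forall a v, U0 a ->
  'D_v h a = 0 <-> exists l : complex R, cderive v (xi c0) a = l *: xi c0 a).
Hypothesis (hF : forall a b, U0 a -> U0 b -> h a = h b -> exists g : R^o -> 'rV[R]_m,
    [/\ g 0 = a, g 1 = b, forall t, U0 (g t), smooth_on [set: R^o] g &
        forall t, 'D_('D_(1 : R^o) g t) h (g t) = 0]).

Local Notation D := (disk_chart y0 r0).

Definition leaf_domain : set M := cdom c0 `&` cfwd c0 @^-1` U0.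
Definition leaf_proj (q : M) : 'rV[R]_2 := of_ball y0 r (h (cfwd c0 q)).

Lemma leaf_domain_open : open leaf_domain.
Proof. exact: chart_dom_open. Qed.

Lemma leaf_domain_sub : leaf_domain `<=` W.
Proof. by move=> q [cq /U0V[_]]; rewrite /= cfwdK. Qed.

Let to_proj q : leaf_domain q -> to_ball y0 r (leaf_proj q) = h (cfwd c0 q).
Proof. by move=> [cq Uq]; rewrite /leaf_proj of_ballK //; exact: hB. Qed.

Lemma leaf_proj_onto : leaf_proj @` leaf_domain = setT.
Proof.
apply/seteqP; split=> // w _; have [a Ua ha] := hS (to_ball_in y0 r0 w).
have [ca ia] := chart_inv (U0V Ua).1.
exists (cinv c0 a); first by split=> //; rewrite /preimage /= ia.
by rewrite /leaf_proj ia ha to_ballK.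
Qed.

Section InChart.
Variables (c : chart M 'rV[R]_m) (Ac : A c).
Let O := chart_pre c leaf_domain.
Let t := cfwd c0 \o cinv c.

Let oO : open O. Proof. by apply: chart_cod_open; exact: leaf_domain_open. Qed.

Let Ot a : O a -> [/\ (ccod c `&` cinv c @^-1` cdom c0) a, U0 (t a) & chart_pre c W a].
Proof. by move=> [ca [da Ua]]; split=> //; split=> //; exact: leaf_domain_sub. Qed.

Let st : smooth_on O t.
Proof.
have [_ st _ _] := transition mA Ac Ac0.
by move=> p; apply: Ck_on_subset (st p) => a /Ot[].
Qed.

Let Ht : {in O, h \o t =1 cfwd D \o (leaf_proj \o cinv c)}.
Proof. by move=> a; rewrite inE => -[_ Ua]; rewrite /= to_proj. Qed.

Let sht : smooth_on O (h \o t).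
Proof. by apply: (smooth_comp oO oU0 _ st sh) => a /Ot[]. Qed.

Lemma leaf_proj_smooth : smooth_into [set D] O (leaf_proj \o cinv c).
Proof.
split=> [a Oa|d -> p].
  have [_ Ut _] := Ot Oa.
  apply: (@continuous_comp _ _ _ (h \o t) (of_ball y0 r)); first exact: (sht 0%N).
  by apply: of_ball_continuous; exact: hB.
by apply: (@Ck_on_subset _ _ _ _ _ O) => [a []//|]; exact: (Ck_on_eq oO Ht (sht p)).
Qed.

Lemma leaf_proj_derive a v : O a ->
  'D_v (cfwd D \o (leaf_proj \o cinv c)) a = 'D_('D_v t a) h (t a).
Proof.
move=> Oa; have [_ Ut _] := Ot Oa.
apply: etrans (derive_comp v (smooth_differentiable st Oa) (smooth_differentiable sh Ut)).
apply: near_eq_derive; have : \forall y \near a, O y by exact: open_nbhs_nbhs.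
by apply: filterS => y Oy; apply/esym/Ht; rewrite inE.
Qed.

Lemma leaf_proj_submersion a w : O a ->
  exists v, 'D_v (cfwd D \o (leaf_proj \o cinv c)) a = w.
Proof.
move=> Oa; have [Ua Ut _] := Ot Oa; have [u hu] := hD w Ut.
have [_ _ _ uJ] := transition mA Ac Ac0.
exists (u *m invmx ('J t a)); apply: etrans (leaf_proj_derive _ Oa) _.
have -> : 'D_(u *m invmx ('J t a)) t a = u.
  apply: etrans (deriveEjacobian _ (smooth_differentiable st Oa)) _.
  by apply: mulmxKV; exact: uJ.
exact: hu.
Qed.

Lemma leaf_proj_kernel a v : O a ->
  'D_v (cfwd D \o (leaf_proj \o cinv c)) a = 0 <-> Dperp (x \o cinv c) a v.
Proof.
move=> Oa; have [Ua Ut Va] := Ot Oa.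
have H1 := dperp_transition hm mA wx ux nf v Ac Ac0 Va Ua.2.
have H2 := dperp_chart hm wx ux nf ('D_v t a) Ac0 (U0V Ut).
have H3 := hK ('D_v t a) Ut.
have H4 := leaf_proj_derive v Oa.
split=> [H|/(H1.1)/(H2.1)/(H3.2) H].
  by apply/(H1.2)/(H2.2)/(H3.1); exact: (etrans (esym H4) H).
exact: etrans H4 H.
Qed.

End InChart.

(** Points on one fibre of h are joined by the curves of [local_fibration], whose
    velocity is in the kernel of dh, that is in D^perp; conversely h is constant
    along a curve tangent to D^perp. *)
Lemma leaf_fibres q s : leaf_domain q -> leaf_domain s ->
  leaf_proj q = leaf_proj s <-> same_leaf A x leaf_domain q s.
Proof.
move=> Uq Us; split=> [e|[ga [g0 g1 gU [cg sg] gD]]].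
  have hqs : h (cfwd c0 q) = h (cfwd c0 s) by rewrite -(to_proj Uq) e to_proj.
  have [g [g0 g1 gU sg Dg]] := hF Uq.2 Us.2 hqs.
  have ci t : cdom c0 (cinv c0 (g t)) /\ cfwd c0 (cinv c0 (g t)) = g t := chart_inv (U0V (gU t)).1.
  have dg t : differentiable g t by exact: smooth_differentiable sg I.
  exists (fun t => cinv c0 (g t)); split.
  - by rewrite g0 cfwdK //; exact: Uq.1.
  - by rewrite g1 cfwdK //; exact: Us.1.
  - by move=> t; have [h1 h2] := ci t; split=> //; rewrite /preimage /= h2.
  - have cgt (t : R^o) : {for t, continuous (cinv c0 \o g)}.
      apply: continuous_comp; first exact: (sg 0%N).
      by apply: cinv_continuous; exact: (U0V (gU t)).1.
    split=> [t _|d Ad]; first exact: cgt.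
    have [oU st _ _] := transition mA Ac0 Ad.
    have oS : open ([set: R^o] `&` (cinv c0 \o g) @^-1` cdom d).
      rewrite openE => t [_ Ht]; apply: filterI; first exact: filterT.
      by apply: (cgt t); apply: open_nbhs_nbhs; split=> //; exact: cdom_open.
    apply: (smooth_comp oS oU _ _ st) => [t [_ Ht]|p]; first by split=> //; exact: (U0V (gU t)).1.
    exact: Ck_on_subset (sg p).
  move=> d Ad t dt; have Vt := U0V (gU t).
  have [oU st _ _] := transition mA Ac0 Ad.
  have dtr : differentiable (cfwd d \o cinv c0) (g t).
    by apply: (smooth_differentiable st); split=> //; exact: Vt.1.
  rewrite (derive_comp (1 : R^o) (dg t) dtr).
  apply: (dperp_transition hm mA wx ux nf ('D_(1 : R^o) g t) Ac0 Ad Vt dt).1.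
  apply: (dperp_chart hm wx ux nf _ Ac0 Vt).2.
  exact: (hK _ (gU t)).1.
pose T := h \o (cfwd c0 \o ga).
have sc : smooth_on [set: R^o] (cfwd c0 \o ga).
  by move=> p; apply: Ck_on_subset (sg _ Ac0 p) => t _; split=> //; exact: (gU t).1.
have dc (t : R^o) : differentiable (cfwd c0 \o ga) t by exact: smooth_differentiable sc I.
have dh t : differentiable h (cfwd c0 (ga t)) by exact: smooth_differentiable sh (gU t).2.
have oT : open [set: R^o] by exact: openT.
have sT : smooth_on [set: R^o] (T : R^o -> 'rV[R]_2).
  by apply: (smooth_comp oT oU0 _ sc sh) => t _; exact: (gU t).2.
have DT t : 'D_(1 : R^o) (T : R^o -> 'rV[R]_2) t = 0.
  apply: etrans (derive_comp (1 : R^o) (dc t) (dh t)) _.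
  have Vt := U0V (gU t).2.
  apply: (hK _ (gU t).2).2; apply: (dperp_chart hm wx ux nf _ Ac0 Vt).1.
  have H := gD _ Ac0 t (gU t).1.
  exact: H.
have E : cvec (T 1) 0 = cvec (T 0) 0 :> 'rV[complex R]_2.
  have := @const_segment R R^o 2 (fun t => cvec (T t) 0) 0 1.
  rewrite add0r; apply=> t _.
    exact: (vCk_vdiff (p := 0) (vCk_cvec oT (sT 1) (@Ck_cst R 1 _ _ _ 0)) I).
  rewrite cderive_cvec; apply/rowP => k; rewrite !mxE.
  by apply: complex_ext; rewrite /= ?(DT _) ?derive_cst mxE.
have : T 1 = T 0 by rewrite -(cvecK1 (T 1) 0) E cvecK1.
by rewrite /T /= g0 g1 /leaf_proj => ->.
Qed.

End WintgenQuotient.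

Lemma vline_scale (K : fieldType) (vT : vectType K) (s : K) (v : vT) :
  s != 0 -> <[s *: v]>%VS = <[v]>%VS.
Proof.
move=> s0; apply/eqP; rewrite eqEsubv -!memvE memvZ ?memv_line //=.
by rewrite -[v](scalerK s0) memvZ // scalerA mulfV // scale1r memv_line.
Qed.

Theorem wintgen_gauss_map_holomorphic (R : realType) (m : nat) (hm : (2 <= m)%N)
    (M : topologicalType) (A : set (chart M 'rV[R]_m)) (x : M -> 'rV[R]_(m + 3)) :
  smooth_manifold A -> wintgen_ideal A x -> wintgen_umbilic_free A x ->
  forall (W : set M) (n1 n2 : M -> 'rV[R]_(m + 3)), smooth_normal_frame A x W n1 n2 ->
  forall p : M, W p ->
  exists U : set M, [/\ open U, U p, U `<=` W &
    exists (Mb : topologicalType) (B : set (chart Mb 'rV[R]_2))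
           (proj : M -> Mb) (g : Mb -> cline R (m + 3)),
      [/\ riemann_surface B /\ connected [set: Mb],
          smooth_map A B U proj /\ proj @` U = [set: Mb],
          (forall c d, A c -> B d -> forall a, ccod c a -> U (cinv c a) ->
             cdom d (proj (cinv c a)) ->
             (forall w, exists v, 'D_v (cfwd d \o (proj \o cinv c)) a = w) /\
             (forall v, 'D_v (cfwd d \o (proj \o cinv c)) a = 0 <->
                        Dperp (x \o cinv c) a v)) /\
          (forall q r, U q -> U r -> (proj q = proj r <-> same_leaf A x U q r)),
          forall c, A c -> forall a, ccod c a -> U (cinv c a) ->
            gauss_map (x \o cinv c) a (n1 (cinv c a)) (n2 (cinv c a)) = g (proj (cinv c a))
        & holomorphic_curve B g /\ one_isotropic B g]].
Proof.
move=> mA wx ux W n1 n2 nf p Wp.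
have [_ _ cov _] := mA; have [c0 Ac0 cp] := cov p.
have [oV sf s1 s2 [ff im fr hw hu]] := atlas_data wx ux nf Ac0.
set V := chart_pre c0 W in oV sf s1 s2 ff im fr hw hu.
pose F := gauss_lift (x \o cinv c0) (n1 \o cinv c0) (n2 \o cinv c0).
have Va0 : V (cfwd c0 p) by split; [exists p|rewrite /preimage /= cfwdK].
have CF q : vCk q V F by exact: vCk_gauss_lift.
have F0 a : V a -> lor (F a) (F a) = 0 by move=> Va; exact: (lor_gauss_self ff fr).
have Fc a : V a -> lor (F a) (map_mx Num.conj (F a)) = 2 by move=> Va; exact: (lor_gauss_conj ff fr).
have str a : V a -> exists (phi : 'rV[complex R]_m) (kappa : 'rV[complex R]_(1 + (m + 3))),
  [/\ forall v, exists l : complex R,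
        cderive v F a = (map_mx (real_complex R) v *m phi^T) 0 0 *: kappa + l *: F a,
      forall l : complex R, kappa <> l *: F a,
      lor kappa kappa = 0 /\ lor kappa (F a) = 0
    & forall z : complex R, exists v : 'rV[R]_m, (map_mx (real_complex R) v *m phi^T) 0 0 = z].
  move=> Va; have [phi [kappa [k1 k2 k3 k4 _]]] := atlas_structure hm wx ux nf Ac0 Va.
  by exists phi, kappa.
have [j Fj] : exists j, F (cfwd c0 p) 0 j != 0.
  apply: contrapT => /forallNP H; have := F0 _ Va0; have := Fc _ Va0.
  have -> : F (cfwd c0 p) = 0.
    by apply/rowP => j; rewrite [RHS]mxE; apply/eqP/negPn/negP; exact: H.
  by rewrite lor0l => /esym/eqP; rewrite pnatr_eq0.
have [U0 [h [y0 [r [Zs [[oU0 U0p U0V r0] [sh hB hS hD hK] hF [CZ ZP ZS ZU] dZ]]]]]] :=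
  local_fibration oV CF str F0 Va0 Fj.
have Zp w : ball y0 r w -> 0 < lor (Zs w) (map_mx Num.conj (Zs w)).
  move=> /ZS[a Ua [s s0 e]]; have := Fc _ (U0V _ Ua); rewrite e map_mxZ lorZl lorZr mulrA => e2.
  have ss : 0 < s * Num.conj s by rewrite mul_conjC_gt0.
  by rewrite -(pmulr_rgt0 _ ss) e2 ltr0n.
have cd c a : A c -> ccod c a -> leaf_domain c0 U0 (cinv c a) -> chart_pre c (leaf_domain c0 U0) a by [].
exists (leaf_domain c0 U0); split.
- exact: leaf_domain_open.
- by split.
- exact: (leaf_domain_sub U0V).
exists 'rV[R]_2, [set disk_chart y0 r0], (leaf_proj c0 h y0 r), (disk_curve y0 r Zs); split.
- by split; [exact: disk_riemann_surface|exact: rV_connected].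
- split; first by move=> c Ac; exact: (leaf_proj_smooth mA Ac0 r0 oU0 U0V sh hB Ac).
  exact: (leaf_proj_onto r0 U0V hS).
- split; last by move=> q s; exact: (leaf_fibres hm mA wx ux nf Ac0 r0 oU0 U0V sh hB hK hF).
  move=> c d Ac -> a ca Ua _; split=> [w|v].
    exact: (leaf_proj_submersion mA Ac0 r0 oU0 U0V sh hB hD Ac w (cd _ _ Ac ca Ua)).
  exact: (leaf_proj_kernel hm mA wx ux nf Ac0 r0 oU0 U0V sh hB hK Ac v (cd _ _ Ac ca Ua)).
- move=> c Ac a ca [dc0 U0a].
  have E := gauss_lift_chart mA wx ux nf Ac Ac0 (conj ca (leaf_domain_sub U0V (conj dc0 U0a))) dc0.
  have [s s0 e] := ZU _ U0a.
  have -> : gauss_map (x \o cinv c) a (n1 (cinv c a)) (n2 (cinv c a)) =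
     <[gauss_lift (x \o cinv c) (n1 \o cinv c) (n2 \o cinv c) a]>%VS by [].
  rewrite E /disk_curve /leaf_proj (of_ballK r0 (hB _ U0a)).
  have -> : gauss_lift (x \o cinv c0) (n1 \o cinv c0) (n2 \o cinv c0) (cfwd c0 (cinv c a)) =
    s *: Zs (h (cfwd c0 (cinv c a))) by exact: e.
  exact: vline_scale.
have Zj w : ball y0 r w -> Zs w 0 j = 1 by move=> /ZP[].
have ZZ w : ball y0 r w -> lor (Zs w) (Zs w) = 0 by move=> /ZP[].
split.
  exact: (disk_holomorphic r0 CZ Zj ZZ Zp dZ).
exact: (disk_isotropic CZ Zj ZZ dZ).
Qed.

(** * Lifts of holomorphic isotropic curves *)

Lemma cderive_plane (R : realType) k (F : 'rV[R]_2 -> 'rV[complex R]_k) a v : vdiff F a ->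
  cderive v F a = ((v 0 0)%:C)%C *: cderive (eu R) F a + ((v 0 1)%:C)%C *: cderive (ev R) F a.
Proof.
move=> dF; apply: etrans (cderive_rV_sum v dF) _; rewrite big_ord_recl big_ord1.
by rewrite (_ : lift ord0 ord0 = 1) //; exact: val_inj.
Qed.

(** The equation d_zbar = l Z solved for the derivative along the v axis. *)
Lemma cauchy_riemann (R : realType) k (U V Z : 'rV[complex R]_k) (l : complex R) (w : 'rV[R]_2) :
  2^-1 *: (U + 'i *: V) = l *: Z ->
  ((w 0 0)%:C)%C *: U + ((w 0 1)%:C)%C *: V = toC w *: U - (2 * 'i * l * ((w 0 1)%:C)%C) *: Z.
Proof.
move=> E; have VE : V = 'i *: U - (2 * 'i * l) *: Z.
  rewrite -scalerA -E scalerA; apply/rowP => j; rewrite !mxE.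
  transitivity ('i * U 0 j - 'i * U 0 j - ('i * 'i) * V 0 j); last by field.
  by rewrite sqri; ring.
have wE : toC w = ((w 0 0)%:C)%C + ((w 0 1)%:C)%C * 'i.
  by apply: complex_ext; rewrite ?ReD' ?ImD' ?ReM' ?ImM' iE /=; ring.
by rewrite wE VE; apply/rowP => j; rewrite !mxE; ring.
Qed.

Lemma lor_orth_rowP (K : fieldType) n k (P : 'M[K]_(k, 1 + n)) (Y : 'rV[K]_(1 + n)) :
  (forall i, lor Y (row i P) = 0) <-> (forall w : 'rV[K]_(1 + n), (w <= P)%MS -> lor Y w = 0).
Proof.
split=> [H w /submxP[c ->]|H i]; last by apply: H; exact: row_sub.
rewrite mulmx_sum_row lorC lor_suml big1 // => i _.
by rewrite lorZl lorC H mulr0.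
Qed.

Section HoloLift.
Variables (R : realType) (n : nat) (O : set 'rV[R]_2) (X1 X2 : 'rV[R]_2 -> 'rV[R]_(1 + n)).
Hypotheses (oO : open O) (s1 : smooth_on O X1) (s2 : smooth_on O X2).
Hypothesis (onX : forall a, O a -> [/\ lor (X1 a) (X1 a) = 1, lor (X2 a) (X2 a) = 1 & lor (X1 a) (X2 a) = 0]).
Let xi a := cvec (X1 a) (- X2 a).
Hypothesis (hol : forall a, O a -> exists l : complex R, d_zbar xi a = l *: xi a).
Hypothesis (iso : forall a, O a -> lor (d_z xi a) (d_z xi a) = 0).

Local Notation xiu := (cderive (eu R) xi).

Let sN : smooth_on O (fun a => - X2 a).
Proof.
move=> p; apply: (Ck_on_eq oO _ (Ck_scaleR oO (@Ck_cst R p _ R O (-1)) (s2 p))) => a _.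
by rewrite scaleN1r.
Qed.

Lemma vCk_lift p : vCk p O xi.
Proof. exact: (vCk_cvec oO (s1 p) (sN p)). Qed.

Let dxi a : O a -> vdiff xi a := vCk_vdiff (vCk_lift 1) (a := a).

Lemma lift_self a : O a -> lor (xi a) (xi a) = 0.
Proof.
by move=> /onX[h1 h2 h3]; rewrite lor_cvec !(lorNl, lorNr) (lorC (X2 a)) h1 h2 h3;
   apply: complex_ext => /=; ring.
Qed.

(** For a holomorphic curve the differential of a lift is complex linear
    modulo the lift. *)
Lemma holo_derive a v : O a -> exists mu : complex R,
  cderive v xi a = toC v *: xiu a + mu *: xi a.
Proof.
move=> Oa; have [l E] := hol Oa; exists (- (2 * 'i * l * ((v 0 1)%:C)%C)).
by apply: etrans (cderive_plane v (dxi Oa)) _; rewrite (cauchy_riemann v E) scaleNr.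
Qed.

Lemma lift_dself a v : O a -> lor (cderive v xi a) (xi a) = 0.
Proof.
move=> Oa; have := cder0_lor v oO (fun x Ox => lift_self Ox) Oa (dxi Oa) (dxi Oa).
rewrite [X in _ = - X]lorC => /eqP; rewrite -addr_eq0 -mulr2n mulrn_eq0 /= => /eqP.
by [].
Qed.

Lemma lift_isotropic a : O a -> lor (xiu a) (xiu a) = 0.
Proof.
move=> Oa; have [mu E] := holo_derive (ev R) Oa; rewrite toC_ev in E.
have z0 := lift_dself (eu R) Oa; have zz := lift_self Oa.
have := iso Oa; rewrite /d_z E; move: (xiu a) (xi a) z0 zz => U Z z0 zz.
have -> : 2^-1 *: (U - 'i *: ('i *: U + mu *: Z)) = U - (2^-1 * 'i * mu) *: Z.
  apply/rowP => j; rewrite !mxE.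
  transitivity (2^-1 * ((1 - 'i * 'i) * U 0 j - 'i * mu * Z 0 j)); first ring.
  by rewrite sqri; field.
by rewrite !(lorDl, lorDr, lorNl, lorNr, lorZl, lorZr) (lorC Z) z0 zz !(mulr0, oppr0, addr0, subr0).
Qed.

(** The connection form of the orthonormal pair in the direction u; subtracting it
    leaves in [lift_e1], [lift_e2] the parts of the derivatives orthogonal to X1, X2. *)
Definition lift_b a : R := lor ('D_(eu R) X1 a) (X2 a).
Definition lift_e1 a := 'D_(eu R) X1 a - lift_b a *: X2 a.
Definition lift_e2 a := 'D_(eu R) X2 a + lift_b a *: X1 a.
Definition lift_tau a : R := lor (lift_e1 a) (lift_e1 a).

Lemma lift_cderive_u a : O a -> xiu a = cvec ('D_(eu R) X1 a) (- 'D_(eu R) X2 a).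
Proof.
move=> Oa; apply: etrans (cderive_cvec _ _ _ _) _.
have dX2 : derivable X2 a (eu R) by apply: diff_derivable; exact: smooth_differentiable s2 Oa.
exact: (congr1 (cvec ('D_(eu R) X1 a)) (deriveN dX2)).
Qed.

Lemma lift_eta a : O a -> cvec (lift_e1 a) (- lift_e2 a) = xiu a - ('i * ((lift_b a)%:C)%C) *: xi a.
Proof.
move=> Oa; rewrite (lift_cderive_u Oa) /lift_e1 /lift_e2 /xi; move: ('D__ X1 a) ('D__ X2 a) => u w.
by apply/rowP => j; rewrite !mxE; apply: complex_ext; rewrite ?ReD' ?ImD' ?ReN' ?ImN' ?ReM' ?ImM' iE /=; ring.
Qed.

(** Isotropy of e1 - i e2 says that e1 and e2 have the same norm and are orthogonal. *)
Lemma lift_gram a : O a ->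
  [/\ [/\ lor (X1 a) (lift_e1 a) = 0, lor (X1 a) (lift_e2 a) = 0,
          lor (X2 a) (lift_e1 a) = 0 & lor (X2 a) (lift_e2 a) = 0],
      lor (lift_e1 a) (lift_e2 a) = 0 & lor (lift_e2 a) (lift_e2 a) = lift_tau a].
Proof.
move=> Oa; have [g1 g2 g3] := onX Oa.
pose xb x := cvec (X1 x) (X2 x).
have dxb : vdiff xb a by exact: (vCk_vdiff (p := 0) (vCk_cvec oO (s1 1) (s2 1)) Oa).
have xx x : O x -> lor (xi x) (xb x) = 2.
  by move=> /onX[h1 h2 h3]; rewrite lor_cvec !lorNl (lorC (X2 x)) h1 h2 h3; apply: complex_ext => /=; ring.
have E1 := lift_dself (eu R) Oa.
have E2 := cder0_lor (eu R) oO xx Oa (dxi Oa) dxb.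
have Exb : cderive (eu R) xb a = cvec ('D_(eu R) X1 a) ('D_(eu R) X2 a) := cderive_cvec _ _ _ _.
have E3 := lift_isotropic Oa.
rewrite Exb in E2; rewrite (lift_cderive_u Oa) in E1 E2 E3.
have bE : lift_b a = lor ('D_(eu R) X1 a) (X2 a) by [].
rewrite /lift_tau /lift_e1 /lift_e2; move: (lift_b a) bE E1 E2 E3.
move: ('D__ X1 a) ('D__ X2 a) => u w b bE.
rewrite !lor_cvec !(lorNl, lorNr) (lorC (X1 a) u) (lorC (X1 a) w) (lorC (X2 a) u) (lorC (X2 a) w) -bE.
move=> [r1 r2] [r3 r4] [r5 r6].
rewrite !(lorDl, lorDr, lorNl, lorNr, lorZl, lorZr) (lorC (X2 a) (X1 a)) g1 g2 g3.
rewrite (lorC (X1 a) u) (lorC (X1 a) w) (lorC (X2 a) u) (lorC (X2 a) w) -bE.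
rewrite (lorC w u) in r6 *.
by split; [split| |]; nra.
Qed.

(** Real and imaginary parts of [holo_derive]. *)
Lemma lift_derive a v : O a -> exists x y : R,
  'D_v X1 a = v 0 0 *: lift_e1 a + v 0 1 *: lift_e2 a + x *: X1 a + y *: X2 a /\
  'D_v X2 a = v 0 0 *: lift_e2 a - v 0 1 *: lift_e1 a + x *: X2 a - y *: X1 a.
Proof.
move=> Oa; have [mu E] := holo_derive v Oa.
have E0 : xiu a = cvec (lift_e1 a) (- lift_e2 a) + ('i * ((lift_b a)%:C)%C) *: xi a.
  by rewrite (lift_eta Oa) subrK.
have Ev : cderive v xi a = cvec ('D_v X1 a) (- 'D_v X2 a).
  apply: etrans (cderive_cvec _ _ _ _) _.
  have dX2 : derivable X2 a v by apply: diff_derivable; exact: smooth_differentiable s2 Oa.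
  exact: (congr1 (cvec ('D_v X1 a)) (deriveN dX2)).
rewrite Ev E0 in E; move: E; rewrite /xi.
move: ('D__ X1 a) ('D__ X2 a) (lift_e1 a) (lift_e2 a) => u w e1 e2.
rewrite scalerDr scalerA -addrA -scalerDl; move: (_ + mu) => nu E.
exists (complex.Re nu), (complex.Im nu); split; apply/rowP => j.
  have := congr1 (fun Y : 'rV[complex R]_(1 + n) => complex.Re (Y 0 j)) E.
  by rewrite !mxE ?ReD' ?ReM' /= => ->; ring.
have := congr1 (fun Y : 'rV[complex R]_(1 + n) => - complex.Im (Y 0 j)) E.
by rewrite !mxE ?ImD' ?ImM' /= opprK => ->; ring.
Qed.

Definition lift_frame a : 'M[R]_(4, 1 + n) :=
  \matrix_(i < 4) nth 0 [:: X1 a; X2 a; lift_e1 a; lift_e2 a] i.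

Lemma lift_frame_mul a (c : 'rV[R]_4) : c *m lift_frame a =
  c 0 (inord 0) *: X1 a + c 0 (inord 1) *: X2 a + c 0 (inord 2) *: lift_e1 a + c 0 (inord 3) *: lift_e2 a.
Proof.
rewrite mulmx_sum_row !big_ord_recl big_ord0 addr0 !addrA !rowK /=.
by congr (_ *: _ + _ *: _ + _ *: _ + _ *: _); congr (c _ _); apply: val_inj; rewrite /= inordK.
Qed.

Lemma lift_frame_sub a (x y z w : R) :
  ((x *: X1 a + y *: X2 a + z *: lift_e1 a + w *: lift_e2 a)%R <= lift_frame a)%MS.
Proof.
apply/submxP; exists (\row_(j < 4) nth 0 [:: x; y; z; w] j).
by rewrite lift_frame_mul !mxE !inordK.
Qed.

Lemma lift_frame_lor a (c : 'rV[R]_4) : O a ->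
  lor (c *m lift_frame a) (c *m lift_frame a) =
  c 0 (inord 0) ^+ 2 + c 0 (inord 1) ^+ 2 + lift_tau a * (c 0 (inord 2) ^+ 2 + c 0 (inord 3) ^+ 2).
Proof.
move=> Oa; have [g1 g2 g3] := onX Oa; have [[q1 q2 q3 q4] q5 q6] := lift_gram Oa.
have q7 : lor (lift_e1 a) (lift_e1 a) = lift_tau a by [].
rewrite lift_frame_mul; move: (X1 a) (X2 a) (lift_e1 a) (lift_e2 a) (lift_tau a) g1 g2 g3 q1 q2 q3 q4 q5 q6 q7.
move=> Y1 Y2 e1 e2 t g1 g2 g3 q1 q2 q3 q4 q5 q6 q7; rewrite !(lorDl, lorDr, lorZl, lorZr).
rewrite (lorC Y2 Y1) (lorC e1 Y1) (lorC e1 Y2) (lorC e2 Y1) (lorC e2 Y2) (lorC e2 e1).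
by rewrite g1 g2 g3 q1 q2 q3 q4 q5 q6 q7; ring.
Qed.

(** Only the derivatives in the direction u matter, by the Cauchy-Riemann equation. *)
Lemma span_mxP a (w : 'rV[R]_(1 + n)) : O a -> (w <= span_mx X1 X2 a)%MS = (w <= lift_frame a)%MS.
Proof.
move=> Oa; move: w; apply/rV_eqP/andP.
have d1 := smooth_differentiable s1 Oa; have d2 := smooth_differentiable s2 Oa.
have J1 i := row_J i d1; have J2 i := row_J i d2.
have F := lift_frame_sub a.
split.
  rewrite /span_mx !col_mx_sub; apply/and4P; split.
  - by have := F 1 0 0 0; rewrite !scale0r !addr0 scale1r.
  - by have := F 0 1 0 0; rewrite !scale0r !addr0 scale1r add0r.
  - apply/row_subP => i; have [x [y [E _]]] := lift_derive (delta_mx 0 i) Oa; rewrite J1 E.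
    by rewrite -addrA addrC addrA; exact: F.
  - apply/row_subP => i; have [x [y [_ E]]] := lift_derive (delta_mx 0 i) Oa; rewrite J2 E.
    have := F (- y) x (- (delta_mx 0 i : 'rV[R]_2) 0 1) ((delta_mx 0 i : 'rV[R]_2) 0 0).
    congr (_ <= _)%MS; move: (X1 a) (X2 a) (lift_e1 a) (lift_e2 a) => Y1 Y2 e1 e2.
    by apply/rowP => k; rewrite !mxE; ring.
have := submx_refl (span_mx X1 X2 a); rewrite {1}/span_mx !col_mx_sub => /and4P[S1 S2 S3 S4].
have D1 : ('D_(eu R) X1 a <= span_mx X1 X2 a)%MS.
  by apply: submx_trans S3; rewrite (deriveEjacobian (eu R) d1); exact: submxMl.
have D2 : ('D_(eu R) X2 a <= span_mx X1 X2 a)%MS.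
  by apply: submx_trans S4; rewrite (deriveEjacobian (eu R) d2); exact: submxMl.
apply/row_subP => i; rewrite rowK; case: i => -[|[|[|[|//]]]] hi; [exact: S1|exact: S2| |].
  by apply: addmx_sub; [exact: D1|rewrite eqmx_opp; exact: scalemx_sub].
by apply: addmx_sub; [exact: D2|exact: scalemx_sub].
Qed.

Lemma lift_frame_definite a (c : 'rV[R]_4) : O a -> 0 < lift_tau a ->
  lor (c *m lift_frame a) (c *m lift_frame a) <= 0 -> c = 0.
Proof.
move=> Oa t0; rewrite lift_frame_lor // => h.
have s (i : 'I_4) : 0 <= c 0 i ^+ 2 by exact: sqr_ge0.
have t1 : 0 <= lift_tau a * (c 0 (inord 2) ^+ 2 + c 0 (inord 3) ^+ 2).
  by apply: mulr_ge0; [exact: ltW|exact: addr_ge0].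
have t2 : lift_tau a * (c 0 (inord 2) ^+ 2 + c 0 (inord 3) ^+ 2) = 0.
  by have := s (inord 0); have := s (inord 1); lra.
have z2 : c 0 (inord 2) ^+ 2 + c 0 (inord 3) ^+ 2 = 0.
  by move/eqP: t2; rewrite mulf_eq0 gt_eqF //= => /eqP.
have zero (i : 'I_4) : c 0 i ^+ 2 <= 0.
  rewrite -(inord_val i); case: i => -[|[|[|[|//]]]] hi /=;
  have := s (inord 0); have := s (inord 1); have := s (inord 2); have := s (inord 3); lra.
by apply/rowP => i; rewrite mxE; apply/eqP; rewrite -sqrf_eq0 eq_le zero s.
Qed.

Lemma span_mx_regular a : O a ->
  (\rank (span_mx X1 X2 a) = 4%N /\ spacelike (span_mx X1 X2 a)) <-> 0 < lift_tau a.
Proof.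
move=> Oa; have H w := span_mxP w Oa.
have -> : \rank (span_mx X1 X2 a) = \rank (lift_frame a).
  by apply: eqmx_rank; apply/rV_eqP.
have free : row_free (lift_frame a) -> forall i : 'I_4, row i (lift_frame a) != 0.
  move=> fr i; apply/eqP => r0; have /row_freeP[B] := fr.
  move=> /(congr1 (row i)); rewrite row_mul r0 mul0mx => /rowP/(_ i).
  by rewrite !mxE eqxx => /esym/eqP; rewrite oner_eq0.
split=> [[rk sp]|t0].
  have e1 : row (inord 2) (lift_frame a) = lift_e1 a by rewrite rowK inordK.
  rewrite -[lift_tau a]/(lor (lift_e1 a) (lift_e1 a)) -e1; apply: sp.
    by rewrite H; exact: row_sub.
  by apply: free; apply/eqP.
have c0 c := @lift_frame_definite a c Oa t0.
split.
  apply/eqP; rewrite -[_ == _]/(row_free (lift_frame a)) -kermx_eq0 -submx0.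
  apply/rV_subP => c /sub_kermxP cQ; rewrite (c0 c) ?sub0mx // cQ lor0l //.
move=> w; rewrite H => /submxP[c ->] w0; rewrite ltNge; apply: contra w0 => /c0 ->.
by rewrite mul0mx.
Qed.

(** By complex linearity the derivative in the single direction u carries all the
    conditions on dX1 and dX2. *)
Lemma lift_orth a (y : 'rV[R]_n) : O a ->
  (forall i, lor (row_mx (1%:M : 'M[R]_1) y) (row i (span_mx X1 X2 a)) = 0) <->
  lor (xi a) (map_mx (real_complex R) (row_mx (1%:M : 'M[R]_1) y)) = 0 /\
  lor (xiu a) (map_mx (real_complex R) (row_mx (1%:M : 'M[R]_1) y)) = 0.
Proof.
move=> Oa; rewrite (lift_cderive_u Oa) !rc_cvec !lor_cvec !lor0r !subr0 !add0r !lorNl.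
have d1 := smooth_differentiable s1 Oa; have d2 := smooth_differentiable s2 Oa.
set Y := row_mx _ y; split=> [/lor_orth_rowP H|[[h1 h2] [h3 h4]]].
  have := submx_refl (span_mx X1 X2 a); rewrite {1}/span_mx !col_mx_sub => /and4P[S1 S2 S3 S4].
  have D1 : ('D_(eu R) X1 a <= span_mx X1 X2 a)%MS.
    by apply: submx_trans S3; rewrite (deriveEjacobian (eu R) d1); exact: submxMl.
  have D2 : ('D_(eu R) X2 a <= span_mx X1 X2 a)%MS.
    by apply: submx_trans S4; rewrite (deriveEjacobian (eu R) d2); exact: submxMl.
  by rewrite !(lorC _ Y) (H _ S1) (H _ S2) (H _ D1) (H _ D2) oppr0.
have k2 : lor (X2 a) Y = 0 by apply/eqP; rewrite -oppr_eq0 h2.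
have k4 : lor ('D_(eu R) X2 a) Y = 0 by apply/eqP; rewrite -oppr_eq0 h4.
apply/lor_orth_rowP => w; rewrite span_mxP // => /submxP[c ->].
rewrite lift_frame_mul lorC /lift_e1 /lift_e2; move: ('D__ X1 a) ('D__ X2 a) h3 k4 => u v h3 k4.
by rewrite !(lorDl, lorNl, lorZl) h1 k2 h3 k4 !(mulr0, oppr0, addr0).
Qed.

End HoloLift.

(** * The envelope in terms of a fixed lift *)

Lemma cdiff_lor (R : realType) (V : normedModType R) n (F G : V -> 'rV[complex R]_(1 + n)) a :
  vdiff F a -> vdiff G a -> cdiff (fun x => lor (F x) (G x)) a.
Proof.
move=> /vdiffP cF /vdiffP cG.
have [d _] := cdiff_cder_sum 0 (index_enum 'I_n) (fun i : 'I_n => cdiff_mul (cF (rshift 1 i)) (cG (rshift 1 i))).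
rewrite (_ : (fun x => lor (F x) (G x)) = (fun x => (-1) * (F x 0 0 * G x 0 0) +
   \sum_(i < n) F x 0 (rshift 1 i) * G x 0 (rshift 1 i))).
  by apply: cdiff_add => //; apply: cdiff_mul; [exact: cdiff_cst|exact: cdiff_mul].
by apply/funext => x; rewrite /lor mulN1r.
Qed.

Section EnvelopeLocal.
Variables (R : realType) (n : nat) (Mb : topologicalType) (B : set (chart Mb 'rV[R]_2)).
Variable g : Mb -> cline R n.
Hypotheses (rB : riemann_surface B) (hg : holomorphic_curve B g) (ig : one_isotropic B g).
Implicit Types (d : chart Mb 'rV[R]_2) (W : set Mb) (x : Mb -> 'rV[R]_(1 + n)).

Definition lift_dom d W : set 'rV[R]_2 := ccod d `&` cinv d @^-1` W.

Definition lift_c d x1 x2 (a : 'rV[R]_2) : 'rV[complex R]_(1 + n) :=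
  cvec ((x1 \o cinv d) a) (- (x2 \o cinv d) a).

Definition pos (y : 'rV[R]_n) : 'rV[complex R]_(1 + n) :=
  map_mx (real_complex R) (row_mx (1%:M : 'M[R]_1) y).

Lemma orthonormal_local_lift W x1 x2 : orthonormal_lift B g W x1 x2 ->
  local_lift B g W (fun q => cvec (x1 q) (- x2 q)).
Proof.
move=> [oW s1 s2 H].
have oO d : open (ccod d `&` cinv d @^-1` W) by exact: chart_cod_open.
split=> //; last by move=> q /H[].
  move=> d Bd p; apply: (Ck_on_eq (oO d) _ (s1 d Bd p)) => a _.
  by rewrite /= cvecK1.
move=> d Bd p; apply: (Ck_on_eq (oO d) _ (Ck_scaleR (oO d) (@Ck_cst R p _ R _ (-1)) (s2 d Bd p))) => a _.
by rewrite /= cvecK2 scaleN1r.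
Qed.

Lemma lift_data d W x1 x2 : B d -> orthonormal_lift B g W x1 x2 ->
  [/\ open (lift_dom d W), smooth_on (lift_dom d W) (x1 \o cinv d), smooth_on (lift_dom d W) (x2 \o cinv d),
      forall a, lift_dom d W a -> [/\ lor ((x1 \o cinv d) a) ((x1 \o cinv d) a) = 1,
         lor ((x2 \o cinv d) a) ((x2 \o cinv d) a) = 1 & lor ((x1 \o cinv d) a) ((x2 \o cinv d) a) = 0]
    & (forall a, lift_dom d W a -> exists l : complex R, d_zbar (lift_c d x1 x2) a = l *: lift_c d x1 x2 a) /\
      (forall a, lift_dom d W a -> lor (d_z (lift_c d x1 x2) a) (d_z (lift_c d x1 x2) a) = 0)].
Proof.
move=> Bd lx; have lZ := orthonormal_local_lift lx; have [oW s1 s2 H] := lx.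
have [_ hZ] := hg; split.
- exact: chart_cod_open.
- exact: s1.
- exact: s2.
- by move=> a [_ /H[h1 h2 h3 _]].
split=> a [ca Wa]; first by have [e _] := hZ _ _ lZ _ Bd _ ca Wa; exact: e.
exact: (ig lZ Bd ca Wa).
Qed.

(** Orthogonality to a sphere and to its first derivatives does not depend on the
    lift, two lifts differing by a complex factor, nor on the coordinate, the
    derivatives of a lift being combinations of the u-derivative and the lift. *)
Lemma orth_transfer d d' W W' x1 x2 x1' x2' q y : B d -> B d' ->
  orthonormal_lift B g W x1 x2 -> orthonormal_lift B g W' x1' x2' ->
  cdom d q -> cdom d' q -> W q -> W' q ->
  lor (lift_c d' x1' x2' (cfwd d' q)) (pos y) = 0 ->
  lor (cderive (eu R) (lift_c d' x1' x2') (cfwd d' q)) (pos y) = 0 ->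
  lor (lift_c d x1 x2 (cfwd d q)) (pos y) = 0 /\
  lor (cderive (eu R) (lift_c d x1 x2) (cfwd d q)) (pos y) = 0.
Proof.
move=> Bd Bd' lx lx' dq dq' Wq Wq' e0 e1.
have [oO s1 s2 onX [hX _]] := lift_data Bd lx.
have [oO' s1' s2' onX' [hX' _]] := lift_data Bd' lx'.
have [oU st tP _] := transition rB.1 Bd Bd'.
set U := _ `&` _ in oU st tP; set t := cfwd d' \o cinv d in st tP.
set a := cfwd d q; have ia : cinv d a = q by rewrite cfwdK.
have ca : ccod d a by exists q.
have Ua : U a by split=> //; rewrite /preimage /= ia.
have ta : t a = cfwd d' q by rewrite /t /= ia.
have Oa : lift_dom d W a by split=> //; rewrite /preimage /= ia.
have Ot b : U b -> W' (cinv d b) -> lift_dom d' W' (t b).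
  by move=> Ub Wb; have [ct it] := tP _ Ub; split=> //; rewrite /preimage /= it.
have Ota : lift_dom d' W' (t a) by apply: Ot => //; rewrite ia.
pose xi := lift_c d x1 x2; pose xi' := lift_c d' x1' x2'.
pose xb' b := cvec ((x1' \o cinv d') b) ((x2' \o cinv d') b).
have dxi : vdiff xi a by exact: (vCk_vdiff (vCk_lift oO s1 s2 1)).
have dxi' : vdiff xi' (t a) by exact: (vCk_vdiff (vCk_lift oO' s1' s2' 1)).
have dxb' : vdiff xb' (t a) by exact: (vCk_vdiff (p := 0) (vCk_cvec oO' (s1' 1) (s2' 1)) Ota).
have dt : differentiable t a by exact: smooth_differentiable st Ua.
have dc := vdiff_comp dt dxi'.
(* The factor is read off by pairing with the conjugate of xi', since
   <xi', conj xi'> = 2; hence it is differentiable. *)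
pose s b := 2^-1 * lor (xi b) ((xb' \o t) b).
have ds : cdiff s a by apply: cdiff_mul; [exact: cdiff_cst|apply: cdiff_lor => //; exact: vdiff_comp].
have E b : U b -> W (cinv d b) -> W' (cinv d b) -> xi b = s b *: xi' (t b).
  move=> Ub Wb Wb'; have [ct it] := tP _ Ub.
  have [_ _ _ /(_ _ Wb)[_ _ _ g1]] := lx; have [_ _ _ /(_ _ Wb')[h1 h2 h3 g2]] := lx'.
  have : xi b \in <[xi' (t b)]>%VS.
    have -> : <[xi' (t b)]>%VS = <[xi b]>%VS.
      by rewrite /xi' /lift_c /= it -[RHS]g1 g2.
    exact: memv_line.
  move=> /vlineP[k Ek]; rewrite Ek /s Ek lorZl /xi' /xb' /lift_c /= it.
  rewrite lor_cvec !lorNl (lorC (x2' _)) h1 h2 h3; congr (_ *: _).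
  have -> : Complex (1 - -1) (0 - 0) = 2 :> complex R by apply: complex_ext => /=; ring.
  by field.
have nE : \forall b \near a, xi b = s b *: (xi' \o t) b.
  have : \forall b \near a, U b /\ lift_dom d W b /\ lift_dom d W' b.
    apply: filterI; first exact: open_nbhs_nbhs.
    apply: filterI; first exact: open_nbhs_nbhs.
    apply: open_nbhs_nbhs; split; last by split=> //; rewrite /preimage /= ia.
    by apply: chart_cod_open; have [] := lx'.
  by apply: filterS => b [Ub [[_ Wb] [_ Wb']]]; exact: E.
have Y0 : lor (xi' (t a)) (pos y) = 0 by rewrite ta.
have Y1 : lor (cderive (eu R) xi' (t a)) (pos y) = 0 by rewrite ta.
have Yv w : lor (cderive w xi' (t a)) (pos y) = 0.
  have [mu ->] := holo_derive oO' s1' s2' hX' w Ota.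
  by rewrite lorDl !lorZl [X in _ * X + _]Y1 [X in _ + _ * X]Y0 !mulr0 addr0.
split; first by rewrite [lift_c _ _ _ _](nbhs_singleton nE) lorZl Y0 mulr0.
have -> : cderive (eu R) xi a = cderive (eu R) (fun b => s b *: (xi' \o t) b) a by exact: near_eq_cderive.
have [_ ->] := cderive_scale (eu R) ds dc.
rewrite lorDl !lorZl [X in _ * X + _]Y0 mulr0 add0r.
have -> : cderive (eu R) (xi' \o t) a = cderive ('D_(eu R) t a) xi' (t a) by exact: cderive_comp.
by rewrite Yv mulr0.
Qed.

Lemma envelope_orth d W x1 x2 q y : B d -> orthonormal_lift B g W x1 x2 -> cdom d q -> W q ->
  envelope B g (q, y) ->
  lor (lift_c d x1 x2 (cfwd d q)) (pos y) = 0 /\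
  lor (cderive (eu R) (lift_c d x1 x2) (cfwd d q)) (pos y) = 0.
Proof.
move=> Bd lx dq Wq [_ [d' [W' [x1' [x2' [/= Bd' dq' lx' Wq' [_ _ o]]]]]]].
have [oO' s1' s2' onX' [hX' iX']] := lift_data Bd' lx'.
have Oa : lift_dom d' W' (cfwd d' q) by split; [exists q|rewrite /preimage /= cfwdK].
have [e0 e1] := (lift_orth oO' s1' s2' hX' y Oa).1 o.
exact: orth_transfer Bd Bd' lx lx' dq dq' Wq Wq' e0 e1.
Qed.

Lemma envelopeI d W x1 x2 q y : B d -> orthonormal_lift B g W x1 x2 -> cdom d q -> W q ->
  dotr y y = 1 -> 0 < lift_tau (x1 \o cinv d) (x2 \o cinv d) (cfwd d q) ->
  lor (lift_c d x1 x2 (cfwd d q)) (pos y) = 0 ->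
  lor (cderive (eu R) (lift_c d x1 x2) (cfwd d q)) (pos y) = 0 ->
  envelope B g (q, y).
Proof.
move=> Bd lx dq Wq yy t0 e0 e1; have [oO s1 s2 onX [hX iX]] := lift_data Bd lx.
have Oa : lift_dom d W (cfwd d q) by split; [exists q|rewrite /preimage /= cfwdK].
split=> //; exists d, W, x1, x2; split=> //=.
have [rk sp] := (span_mx_regular oO s1 s2 onX hX iX Oa).2 t0.
have o := (lift_orth oO s1 s2 hX y Oa).2 (conj e0 e1).
by split.
Qed.

Lemma envelopeE q y : envelope B g (q, y) -> dotr y y = 1 /\
  exists d W x1 x2, [/\ B d, orthonormal_lift B g W x1 x2, cdom d q, W q &
    0 < lift_tau (x1 \o cinv d) (x2 \o cinv d) (cfwd d q)].
Proof.
move=> [yy [d [W [x1 [x2 [/= Bd dq lx Wq [rk sp _]]]]]]]; split=> //.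
exists d, W, x1, x2; split=> //; have [oO s1 s2 onX [hX iX]] := lift_data Bd lx.
have Oa : lift_dom d W (cfwd d q) by split; [exists q|rewrite /preimage /= cfwdK].
exact: (span_mx_regular oO s1 s2 onX hX iX Oa).1 (conj rk sp).
Qed.

End EnvelopeLocal.

(** * Wintgen frames from null covectors *)

Lemma form_sym (R : realType) m (S : 'M[R]_m) (x y : 'rV[R]_m) : S^T = S ->
  (x *m S *m y^T) 0 0 = (y *m S *m x^T) 0 0.
Proof.
move=> sS; have -> : y *m S *m x^T = (x *m S *m y^T)^T by rewrite !trmx_mul trmxK sS mulmxA.
by rewrite [RHS]mxE.
Qed.

(** A nonzero vector orthogonal to the first k < m ones exists for dimension reasons;
    normalize it and repeat. *)
Lemma orthonormal_extend (R : realType) m (G : 'M[R]_m) (e : nat -> 'rV[R]_m) k :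
  (forall v : 'rV[R]_m, v != 0 -> 0 < (v *m G *m v^T) 0 0) -> G^T = G -> (k <= m)%N ->
  (forall i j, (i < k)%N -> (j < k)%N -> (e i *m G *m (e j)^T) 0 0 = (i == j)%:R) ->
  exists2 E : 'M[R]_m, E *m G *m E^T = 1%:M & forall i : 'I_m, (i < k)%N -> row i E = e i.
Proof.
move=> pd sG; have [d dE] : exists d, d = (m - k)%N by exists (m - k)%N.
elim: d k e dE => [|d IH] k e dE km oe.
  have mk : m = k by apply/eqP; rewrite eqn_leq km andbT -subn_eq0 -dE.
  exists (\matrix_(i < m) e i) => [|i _]; last by rewrite rowK.
  apply/matrixP => i j; rewrite [RHS]mxE.
  have <- : (e i *m G *m (e j)^T) 0 0 = (i == j)%:R by apply: oe; rewrite -mk ltn_ord.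
  have -> : e i *m G *m (e j)^T = row i ((\matrix_(i < m) e i) *m G) *m (row j (\matrix_(i < m) e i))^T.
    by rewrite row_mul !rowK.
  by rewrite tr_row -row_mul -[RHS]/(row i _ 0 0); rewrite !mxE; apply: eq_bigr => l _; rewrite !mxE.
have km' : (k < m)%N by rewrite -subn_gt0 -dE.
(* The space of vectors orthogonal to e 0, ..., e (k - 1) has dimension at least
   m - k. *)
pose Q : 'M[R]_(k, m) := \matrix_(j < k) e j.
have : kermx (G *m Q^T) != 0.
  rewrite -mxrank_eq0 mxrank_ker -lt0n subn_gt0.
  by apply: leq_ltn_trans km'; exact: rank_leq_col.
move=> /rowV0Pn[v /sub_kermxP vK v0].
have vj j : (j < k)%N -> (v *m G *m (e j)^T) 0 0 = 0.
  move=> jk; have := congr1 (fun Y : 'rV[R]_k => Y 0 (Ordinal jk)) vK.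
  rewrite mulmxA [in RHS]mxE => <-; rewrite !mxE; apply: eq_bigr => l _.
  by rewrite !mxE.
pose s := (v *m G *m v^T) 0 0; have s0 : 0 < s := pd _ v0.
pose u := (Num.sqrt s)^-1 *: v.
have uj j : (j < k)%N -> (u *m G *m (e j)^T) 0 0 = 0.
  by move=> jk; rewrite -!scalemxAl mxE vj // mulr0.
have uu : (u *m G *m u^T) 0 0 = 1.
  rewrite linearZ /= -!scalemxAl -scalemxAr scalerA mxE -/s -invfM -expr2 sqr_sqrtr ?ltW //.
  by rewrite mulVf // gt_eqF.
have ju j : (j < k)%N -> (e j *m G *m u^T) 0 0 = 0.
  by move=> jk; rewrite form_sym // uj.
have [u0 [u0j u0u ju0]] : exists u : 'rV[R]_m, [/\ forall j, (j < k)%N -> (u *m G *m (e j)^T) 0 0 = 0,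
    (u *m G *m u^T) 0 0 = 1 & forall j, (j < k)%N -> (e j *m G *m u^T) 0 0 = 0] by exists u.
have [||i j|E E1 E2] := IH k.+1 (fun i => if i == k then u0 else e i).
- by rewrite subnS -dE.
- exact: km'.
- have lt x : (x < k.+1)%N -> x != k -> (x < k)%N by rewrite ltnS leq_eqVlt => /predU1P[->|//]; rewrite eqxx.
  move=> hi hj; case: (eqVneq i k) => [ei|/(lt _ hi) ik]; case: (eqVneq j k) => [ej|/(lt _ hj) jk].
  + by rewrite ei ej eqxx; exact: u0u.
  + by rewrite ei (gtn_eqF jk); exact: u0j.
  + by rewrite ej (ltn_eqF ik); exact: ju0.
  + exact: oe.
exists E => // i ik; rewrite E2 ?(ltnW ik) //; last exact: ltn_trans ik _.
by rewrite ltn_eqF.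
Qed.

(** For p + iw null, p and w have the same length and are orthogonal for the dual
    metric; after scaling their dual vectors are the first two frame vectors. *)
Lemma null_pair_frame (R : realType) m (hm : (2 <= m)%N) (G : 'M[R]_m) (p w : 'rV[R]_m) :
  (forall v : 'rV[R]_m, v != 0 -> 0 < (v *m G *m v^T) 0 0) -> G^T = G -> G \in unitmx ->
  (p *m invmx G *m p^T) 0 0 = (w *m invmx G *m w^T) 0 0 -> (p *m invmx G *m w^T) 0 0 = 0 ->
  exists (E : 'M[R]_m) (rho : R), [/\ E *m G *m E^T = 1%:M,
    p *m E^T = rho *: \row_j (j == 0%N :> nat)%:R & w *m E^T = rho *: \row_j (j == 1%N :> nat)%:R].
Proof.
move=> pd sG uG pp pw.
have sGi : (invmx G)^T = invmx G by rewrite trmx_inv sG.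
have GG (x y : 'rV[R]_m) : (x *m invmx G) *m G *m (y *m invmx G)^T = x *m invmx G *m y^T.
  by rewrite mulmxKV // trmx_mul sGi mulmxA.
have pd' (x : 'rV[R]_m) : x != 0 -> 0 < (x *m invmx G *m x^T) 0 0.
  move=> x0; rewrite -GG; apply: pd; apply: contra x0 => /eqP h.
  by rewrite -(mulmxKV uG x) h mul0mx.
pose s := (p *m invmx G *m p^T) 0 0.
have [p0|p0] := eqVneq p 0.
  have w0 : w = 0.
    apply/eqP/negPn/negP => /pd'; rewrite -pp p0 mul0mx mul0mx mxE ltxx //.
  have [//|E E1 _] := @orthonormal_extend R m G (fun _ => 0) 0 pd sG (leq0n m).
  by exists E, 0; rewrite p0 w0 !mul0mx !scale0r.
have s0 : 0 < s by exact: pd'.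
have r0 : Num.sqrt s != 0 by rewrite gt_eqF // sqrtr_gt0.
have rr : Num.sqrt s * Num.sqrt s = s by rewrite -expr2 sqr_sqrtr // ltW.
have wp : (w *m invmx G *m p^T) 0 0 = 0.
  by rewrite form_sym.
pose e i := (Num.sqrt s)^-1 *: ((if i == 0%N then p else w) *m invmx G).
have eE i j : (e i *m G *m (e j)^T) 0 0 =
   s^-1 * ((if i == 0%N then p else w) *m invmx G *m (if j == 0%N then p else w)^T) 0 0.
  by rewrite /e linearZ /= -!scalemxAl -scalemxAr scalerA mxE GG -invfM rr.
have [|E E1 E2] := @orthonormal_extend R m G e 2 pd sG hm.
  by move=> [|[|//]] [|[|//]] _ _; rewrite eE /= ?pw ?wp -?pp -/s ?mulr0 // mulVf // gt_eqF.
have pe i (im : (i < m)%N) : (i < 2)%N -> (if i == 0%N then p else w) *m E^T =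
    Num.sqrt s *: \row_(j < m) (j == i :> nat)%:R.
  move=> i2; have Ei : row (Ordinal im) E = e i by exact: E2.
  have -> : (if i == 0%N then p else w) = Num.sqrt s *: (e i *m G).
    by rewrite /e -scalemxAl mulmxKV // scalerA mulfV // scale1r.
  rewrite -scalemxAl -Ei -!row_mul E1; congr (_ *: _); apply/rowP => j.
  by rewrite !mxE eq_sym.
by exists E, (Num.sqrt s); split=> //; [exact: (pe 0%N (ltnW hm))|exact: (pe 1%N hm)].
Qed.

Lemma row_delta_outer (R : realType) m k l :
  (\row_(j < m) (j == k :> nat)%:R)^T *m (\row_(j < m) (j == l :> nat)%:R) = munit R m k l.
Proof. by apply/matrixP => i j; rewrite !mxE big_ord1 !mxE -natrM mulnb. Qed.

(** For an orthonormal frame the inverse of the metric is E^T E. *)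
Lemma shape_op_frame (R : realType) m n (f : 'rV[R]_m -> 'rV[R]_n) a nu (E N : 'M[R]_m) :
  metric f a \in unitmx -> E *m metric f a *m E^T = 1%:M -> E *m sff f a nu *m E^T = N ->
  E *m shape_op f a nu = N *m E.
Proof.
rewrite /shape_op; move: (metric f a) (sff f a nu) => G S uG EG <-.
have EE : G *m (E^T *m E) = 1%:M.
  by have := mulmx1C (etrans (mulmxA E G E^T) EG); rewrite mulmxA.
have -> : invmx G = E^T *m E by rewrite -[invmx G]mulmx1 -EE mulKmx.
by rewrite !mulmxA.
Qed.

Lemma normal_frame_rotate (R : realType) m n (f : 'rV[R]_m -> 'rV[R]_n) a nu1 nu2 (c s : R) :
  c ^+ 2 + s ^+ 2 = 1 -> normal_frame f a nu1 nu2 ->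
  normal_frame f a (c *: nu1 + s *: nu2) (c *: nu2 + (- s) *: nu1).
Proof.
move=> cs [[h1 h2] [h3 h4] h5 h6 h7].
have nD (x y : R) : normal_at f a (x *: nu1 + y *: nu2).
  split=> [|v]; rewrite dotrDl !dotrZl; first by rewrite h1 h3 !mulr0 addr0.
  by rewrite (h2 v) (h4 v) !mulr0 addr0.
split; rewrite ?[c *: nu2 + _]addrC; try exact: nD.
all: rewrite !(dotrDl, dotrDr, dotrZl, dotrZr) (dotrC nu2 nu1) h5 h6 h7; nra.
Qed.

(** A null covector p + iw whose square gives the second fundamental form, up to
    multiples of the metric, determines by [null_pair_frame] the vectors e1 and e2
    of the frame; rotating the normal plane absorbs the argument of q = q1 + i q2. *)
Lemma wintgen_of_null_form (R : realType) m (hm : (2 <= m)%N) (f : 'rV[R]_m -> 'rV[R]_(m + 3)) a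
    nu1 nu2 (a1 a2 q1 q2 : R) (p w : 'rV[R]_m) :
  differentiable f a -> immersive_at f a -> normal_frame f a nu1 nu2 ->
  (p *m invmx (metric f a) *m p^T) 0 0 = (w *m invmx (metric f a) *m w^T) 0 0 ->
  (p *m invmx (metric f a) *m w^T) 0 0 = 0 ->
  sff f a nu1 = a1 *: metric f a + (q1 *: (p^T *m p - w^T *m w) - q2 *: (p^T *m w + w^T *m p)) ->
  sff f a nu2 = a2 *: metric f a - (q2 *: (p^T *m p - w^T *m w) + q1 *: (p^T *m w + w^T *m p)) ->
  wintgen_at f a.
Proof.
move=> df im nf pp pw S1 S2; have uG := metric_unit df im.
have [E [rho [EG pE wE]]] := null_pair_frame hm (fun v => metric_gt0 df im) (metric_sym f a) uG pp pw.
(* c + i s is a unit complex number for which (c + i s) q is imaginary, so that the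
   rotated pair of normals separates the two trace-free forms. *)
have [c [s [mu [cs1 cs2 cs3]]]] : exists c s mu : R,
    [/\ c ^+ 2 + s ^+ 2 = 1, c * q1 - s * q2 = 0 & - (c * q2 + s * q1) = mu].
  pose r2 := q1 ^+ 2 + q2 ^+ 2; have r20 : 0 <= r2 by rewrite addr_ge0 ?sqr_ge0.
  have [r0|r0] := eqVneq r2 0.
    have : q1 == 0 /\ q2 == 0.
      by move/eqP: r0; rewrite /r2 paddr_eq0 ?sqr_ge0 // !sqrf_eq0 => /andP.
    by move=> [/eqP -> /eqP ->]; exists 1, 0, 0; split; ring.
  have rr : Num.sqrt r2 ^+ 2 = r2 by rewrite sqr_sqrtr.
  have s0 : Num.sqrt r2 != 0 by rewrite sqrtr_eq0 -ltNge lt_def r0.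
  exists (- q2 / Num.sqrt r2), (- q1 / Num.sqrt r2), (- (- q2 / Num.sqrt r2 * q2 + - q1 / Num.sqrt r2 * q1)).
  split=> //; last by ring.
  rewrite !expr_div_n rr !sqrrN -mulrDl addrC -/r2; exact: divff.
have out k l (x y : 'rV[R]_m) : x *m E^T = rho *: \row_j (j == k :> nat)%:R ->
    y *m E^T = rho *: \row_j (j == l :> nat)%:R -> E *m (x^T *m y) *m E^T = rho ^+ 2 *: munit R m k l.
  move=> xE yE; have -> : E *m (x^T *m y) *m E^T = (x *m E^T)^T *m (y *m E^T) by rewrite trmx_mul trmxK !mulmxA.
  rewrite xE yE -row_delta_outer; apply/matrixP => i j.
  by rewrite !mxE !big_ord1 !mxE; ring.
have form (x y z : R) : E *m (x *: metric f a + (y *: (p^T *m p - w^T *m w) + z *: (p^T *m w + w^T *m p))) *m E^T =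
    x%:M + rho ^+ 2 *: (y *: (munit R m 0 0 - munit R m 1 1) + z *: (munit R m 0 1 + munit R m 1 0)).
  rewrite !(mulmxDr, mulmxDl, mulmxBr, mulmxBl) -!scalemxAr -!scalemxAl.
  rewrite !(mulmxDr, mulmxDl, mulmxN, mulNmx) EG scalemx1.
  rewrite (out _ _ _ _ pE pE) (out _ _ _ _ wE wE) (out _ _ _ _ pE wE) (out _ _ _ _ wE pE).
  by apply/matrixP => i j; rewrite !mxE; ring.
exists E, (c *: nu1 + s *: nu2), (c *: nu2 + (- s) *: nu1), (c * a1 + s * a2), (c * a2 - s * a1), (rho ^+ 2 * mu).
split=> //; first exact: normal_frame_rotate.
  apply: shape_op_frame => //; rewrite sffD !sffZ S1 S2.
  have -> : c *: (a1 *: metric f a + (q1 *: (p^T *m p - w^T *m w) - q2 *: (p^T *m w + w^T *m p))) +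
     s *: (a2 *: metric f a - (q2 *: (p^T *m p - w^T *m w) + q1 *: (p^T *m w + w^T *m p))) =
     (c * a1 + s * a2) *: metric f a + ((c * q1 - s * q2) *: (p^T *m p - w^T *m w) + mu *: (p^T *m w + w^T *m p)).
    by rewrite -cs3; apply/matrixP => i j; rewrite !mxE; ring.
  by rewrite form cs2 scale0r add0r scalerA.
apply: shape_op_frame => //; rewrite sffD !sffZ S1 S2.
have -> : c *: (a2 *: metric f a - (q2 *: (p^T *m p - w^T *m w) + q1 *: (p^T *m w + w^T *m p))) +
   (- s) *: (a1 *: metric f a + (q1 *: (p^T *m p - w^T *m w) - q2 *: (p^T *m w + w^T *m p))) =
   (c * a2 - s * a1) *: metric f a + (mu *: (p^T *m p - w^T *m w) + (- (c * q1 - s * q2)) *: (p^T *m w + w^T *m p)).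
  by rewrite -cs3; apply/matrixP => i j; rewrite !mxE; ring.
by rewrite form cs2 oppr0 scale0r addr0 scalerA.
Qed.

Lemma outer_symmetric (K : fieldType) (I : finType) (z o : I -> K) :
  (forall i j, z i * o j = z j * o i) -> exists q, forall i j, - (z i * o j) = q * (o i * o j).
Proof.
move=> sym; have [/existsP[k nz]|] := boolP [exists k, o k != 0]; last first.
  rewrite negb_exists => /forallP H; exists 0 => i j; rewrite mul0r.
  by have /negPn/eqP -> := H j; rewrite mulr0 oppr0.
exists (- (z k / o k)) => i j.
have -> : z i = z k * o i / o k by rewrite -(sym i k) mulfK.
by field.
Qed.

Lemma complex_square_parts (R : realType) m (S1 S2 G : 'M[R]_m) (a1 a2 : R) (q : complex R) (p w : 'rV[R]_m) :
  (forall i j, Complex (S1 i j - a1 * G i j) (- (S2 i j - a2 * G i j)) =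
     q * (Complex (p 0 i) (w 0 i) * Complex (p 0 j) (w 0 j))) ->
  S1 = a1 *: G + (complex.Re q *: (p^T *m p - w^T *m w) - complex.Im q *: (p^T *m w + w^T *m p)) /\
  S2 = a2 *: G - (complex.Im q *: (p^T *m p - w^T *m w) + complex.Re q *: (p^T *m w + w^T *m p)).
Proof.
have out (x y : 'rV[R]_m) i j : (x^T *m y) i j = x 0 i * y 0 j by rewrite mxE big_ord1 !mxE.
case: q => q1 q2 E; split; apply/matrixP => i j; have [h1 h2] := E i j.
all: move: (out p p i j) (out w w i j) (out p w i j) (out w p i j).
all: move: (p^T *m p) (w^T *m w) (p^T *m w) (w^T *m p) => A1 A2 A3 A4 e1 e2 e3 e4.
  by rewrite (canRL (subrK _) h1) !mxE e1 e2 e3 e4 /=; ring.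
by rewrite (canRL (subrK _) (canRL opprK h2)) !mxE e1 e2 e3 e4 /=; ring.
Qed.

Lemma null_covector_parts (R : realType) m (S : 'M[R]_m) (p w : 'rV[R]_m) : S^T = S ->
  cvec p w *m map_mx (real_complex R) S *m (cvec p w)^T = 0 ->
  (p *m S *m p^T) 0 0 = (w *m S *m w^T) 0 0 /\ (p *m S *m w^T) 0 0 = 0.
Proof.
move=> sS; have -> : cvec p w = map_mx (real_complex R) p + 'i *: map_mx (real_complex R) w.
  by apply/rowP => j; rewrite !mxE; apply: complex_ext; rewrite ?ReD' ?ImD' ?ReM' ?ImM' iE /=; ring.
have T (A B : 'rV[complex R]_m) : (A + 'i *: B)^T = A^T + 'i *: B^T by apply/matrixP => i j; rewrite !mxE.
rewrite T !mulmxDl !mulmxDr -!scalemxAl -!scalemxAr scalerA sqri.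
have e00 (K : comNzRingType) (c : K) (A B C D : 'M[K]_1) : A + c *: C + (c *: D + (-1) *: B) = 0 ->
    A 0 0 + c * C 0 0 + (c * D 0 0 - B 0 0) = 0.
  by move=> /(congr1 (fun Y : 'M[K]_1 => Y 0 0)); rewrite !mxE mulN1r.
have Mp (X : 'M[R]_1) : (map_mx (real_complex R) X) 0 0 = real_complex R (X 0 0) by rewrite mxE.
rewrite !map_trmx -!map_mxM => /e00; rewrite !Mp (form_sym w p sS).
move: ((p *m S *m p^T) 0 0) ((w *m S *m w^T) 0 0) ((p *m S *m w^T) 0 0) => {S p w sS T e00 Mp} A B C e0.
have r1 := congr1 (@complex.Re R) e0; have r2 := congr1 (@complex.Im R) e0.
move: r1 r2; rewrite !(ReD', ReM', ReN') !(ImD', ImM', ImN') iE /=.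
by move=> r1 r2; split; lra.
Qed.

(** * The second fundamental form of the envelope *)

Section EnvelopeWintgen.
Variables (R : realType) (m : nat) (hm : (2 <= m)%N).
Variables (O : set 'rV[R]_2) (X1 X2 : 'rV[R]_2 -> 'rV[R]_(1 + (m + 3))).
Hypotheses (oO : open O) (s1 : smooth_on O X1) (s2 : smooth_on O X2).
Hypothesis (onX : forall a, O a -> [/\ lor (X1 a) (X1 a) = 1, lor (X2 a) (X2 a) = 1 & lor (X1 a) (X2 a) = 0]).
Let xi a := cvec (X1 a) (- X2 a).
Hypothesis (hol : forall a, O a -> exists l : complex R, d_zbar xi a = l *: xi a).
Hypothesis (iso : forall a, O a -> lor (d_z xi a) (d_z xi a) = 0).
Variables (U : set 'rV[R]_m) (pr : 'rV[R]_m -> 'rV[R]_2) (f : 'rV[R]_m -> 'rV[R]_(m + 3)).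
Hypotheses (oU : open U) (sp : smooth_on U pr) (sf : smooth_on U f) (UO : forall a, U a -> O (pr a)).
Hypothesis (ff : forall a, U a -> dotr (f a) (f a) = 1).
Hypothesis (im : forall a, U a -> immersive_at f a).
Local Notation xiu := (cderive (eu R) xi).
Local Notation Yc := (fun a => cvec (pos_lift f a) 0).
Local Notation d i := (delta_mx 0 i).
Local Notation rc := (map_mx (real_complex R)).
Hypothesis (orth0 : forall a, U a -> lor (xi (pr a)) (Yc a) = 0).
Hypothesis (orth1 : forall a, U a -> lor (xiu (pr a)) (Yc a) = 0).

Let dfa a : U a -> differentiable f a := smooth_differentiable sf (a := a).
Let dpr a : U a -> differentiable pr a := smooth_differentiable sp (a := a).
Let CF p : vCk p U (xi \o pr) := vCk_comp oU oO UO (sp p) (vCk_lift oO s1 s2 p).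
Let dF a : U a -> vdiff (xi \o pr) a := vCk_vdiff (CF 1) (a := a).
Let dY a : U a -> vdiff Yc a := vCk_vdiff (vCk_pos oU sf 1) (a := a).
Let ddY v a (Ua : U a) : vdiff (cderive v Yc) a := vCk_vdiff (vCk_cderive v oU (vCk_pos oU sf 2)) Ua.

Let om a (v : 'rV[R]_m) : complex R := lor (xiu (pr a)) (cderive v Yc a).

Lemma family_derive a v : U a -> exists mu : complex R,
  cderive v (xi \o pr) a = toC ('D_v pr a) *: xiu (pr a) + mu *: xi (pr a).
Proof.
move=> Ua; have dx : vdiff xi (pr a) by exact: vCk_vdiff (vCk_lift oO s1 s2 1) (UO Ua).
have [mu E] := holo_derive oO s1 s2 hol ('D_v pr a) (UO Ua).
by exists mu; apply: etrans (cderive_comp v (dpr Ua) dx) E.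
Qed.

(** Since the derivative of a sphere of the family passes through the point of the
    envelope, the sphere is tangent to the envelope there. *)
Lemma family_tangent a v : U a -> lor (xi (pr a)) (cderive v Yc a) = 0.
Proof.
move=> Ua; have := cder0_lor v oU orth0 Ua (dF Ua) (dY Ua).
have [mu E] := family_derive v Ua; rewrite E lorDl !lorZl orth0 // orth1 // !mulr0 addr0.
by move=> /esym/eqP; rewrite oppr_eq0 => /eqP.
Qed.

Lemma family_second a v w : U a ->
  lor (xi (pr a)) (cderive w (cderive v Yc) a) = - (toC ('D_w pr a) * om a v).
Proof.
move=> Ua; have := cder0_lor w oU (fun x Ux => family_tangent v Ux) Ua (dF Ua) (ddY v Ua).
have [mu E] := family_derive w Ua; rewrite E lorDl !lorZl family_tangent // mulr0 addr0.
by move=> ->; rewrite opprK.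
Qed.

(** The unit normal n for which X = (a, n + a f), as in a mean curvature sphere but
    with a in place of the mean curvature. *)
Definition env_normal (X : 'rV[R]_2 -> 'rV[R]_(1 + (m + 3))) a : 'rV[R]_(m + 3) :=
  rsubmx (X (pr a)) - X (pr a) 0 0 *: f a.

Lemma env_normalE (X : 'rV[R]_2 -> 'rV[R]_(1 + (m + 3))) a : X (pr a) = row_mx (X (pr a) 0 0)%:M (env_normal X a + X (pr a) 0 0 *: f a).
Proof. by rewrite subrK -row_mxE1. Qed.

Let lor_xi a (c : R) (w : 'rV[R]_(m + 3)) : lor (xi (pr a)) (cvec (row_mx c%:M w) 0) =
  Complex (lor (X1 (pr a)) (row_mx c%:M w)) (- lor (X2 (pr a)) (row_mx c%:M w)).
Proof. by rewrite lor_cvec !lor0r lorNl subr0 add0r. Qed.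

Let lor_X (X : 'rV[R]_2 -> 'rV[R]_(1 + (m + 3))) a (c : R) (w : 'rV[R]_(m + 3)) : lor (X (pr a)) (row_mx c%:M w) =
  - (X (pr a) 0 0 * c) + dotr (env_normal X a) w + X (pr a) 0 0 * dotr (f a) w.
Proof. by rewrite {1}env_normalE lor_row_mx -/(dotr _ _) dotrDl dotrZl addrA. Qed.

Lemma env_normal_frame a : U a -> normal_frame f a (env_normal X1 a) (env_normal X2 a).
Proof.
move=> Ua; have := orth0 Ua; rewrite lor_xi !lor_X ff // => -[h1 h2].
have h3 v : dotr (env_normal X1 a) ('D_v f a) = 0 /\ dotr (env_normal X2 a) ('D_v f a) = 0.
  have := family_tangent v Ua; rewrite (cderive_pos sf v Ua) lor_xi !lor_X.
  rewrite (dotrC (f a)) (sphere_dot1 oU sf ff v Ua) !mulr0 oppr0 !addr0 !add0r => -[h3 /eqP].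
  by rewrite oppr_eq0 => /eqP.
have e1 : dotr (env_normal X1 a) (f a) = 0 by rewrite -[RHS]h1 mulr1 addrAC addNr add0r.
have e2 : dotr (env_normal X2 a) (f a) = 0.
  by apply/eqP; rewrite -oppr_eq0; apply/eqP; rewrite -[RHS]h2 mulr1 [in RHS]addrAC addNr add0r.
have G (X X' : 'rV[R]_2 -> 'rV[R]_(1 + (m + 3))) : dotr (env_normal X a) (f a) = 0 ->
    dotr (env_normal X' a) (f a) = 0 -> dotr (env_normal X a) (env_normal X' a) = lor (X (pr a)) (X' (pr a)).
  move=> e e'; rewrite [X' (pr a)]env_normalE lor_X; move: (env_normal X a) (env_normal X' a) e e' => u u' e e'.
  rewrite !(dotrDr, dotrZr) e (dotrC (f a) u') e' ff //.
  by rewrite mulr0 mulr1 addr0 add0r addrAC addNr add0r.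
have [g1 g2 g3] := onX (UO Ua).
by split; [split=> // v; exact: (h3 v).1|split=> // v; exact: (h3 v).2| | |]; rewrite G.
Qed.

Lemma env_sff a i j : U a ->
  Complex (sff f a (env_normal X1 a) i j - X1 (pr a) 0 0 * metric f a i j)
    (- (sff f a (env_normal X2 a) i j - X2 (pr a) 0 0 * metric f a i j)) =
  - (toC ('D_(d i) pr a) * om a (d j)).
Proof.
move=> Ua; rewrite -family_second // (cderive_pos2 oU sf _ _ Ua) lor_xi !lor_X.
have S nu : sff f a nu i j = dotr ('D_(d i) ('D_(d j) f) a) nu by rewrite mxE.
rewrite !S (metric_dot sf i j Ua) (dotrC (f a)) (sphere_dot2 oU sf ff _ _ Ua).
rewrite (dotrC (env_normal X1 a)) (dotrC (env_normal X2 a)).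
by apply: complex_ext => /=; ring.
Qed.

(** By [polar_product], <d_u xi, d_u xi> is the square of the covector plus
    the squares of the products with X1 and X2; the latter are in the ratio i, as
    <d_u xi, xi> = 0, and the total vanishes by isotropy. *)
Lemma env_covector_null a : U a ->
  (\row_j om a (d j)) *m rc (invmx (metric f a)) *m (\row_j om a (d j))^T = 0.
Proof.
move=> Ua; have id1 := gauss_polar_id oU sf ff im env_normal_frame Ua.
have iso2 := lift_isotropic oO s1 s2 onX hol iso (UO Ua).
have self := lift_dself oO s1 s2 onX (eu R) (UO Ua).
have EX (X : 'rV[R]_2 -> 'rV[R]_(1 + (m + 3))) : rc (X (pr a)) = row_mx (real_complex R (X (pr a) 0 0))%:M
    (rc (env_normal X a) + real_complex R (X (pr a) 0 0) *: rc (f a)).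
  by rewrite {1}env_normalE map_row_mx map_scalar_mx map_mxD map_mxZ.
have EY : cvec (pos_lift f a) 0 = row_mx 1%:M (rc (f a)).
  by rewrite -rc_cvec map_row_mx map_scalar_mx.
have := orth1 Ua; rewrite EY => wX.
have := polar_product (real_complex R (X1 (pr a) 0 0)) (real_complex R (X2 (pr a) 0 0)) id1 wX wX.
rewrite -!EX iso2; set t := rsubmx _ *m _.
have -> : \row_j om a (d j) = t by apply/rowP => j; rewrite mxE (dpos_coord sf _ _ Ua).
move=> e; apply/rowP => k; rewrite !ord1 [RHS]mxE.
have : lor (xiu (pr a)) (xi (pr a)) = 0 by exact: self.
rewrite /xi cvec_rc lorDr lorNr lorZr => /eqP; rewrite subr_eq0 => /eqP e2.
move: e e2; move: (lor _ (rc (X1 _))) (lor _ (rc (X2 _))) ((t *m _ *m _) 0 0) => u1 u2 u3 e e2.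
by rewrite e e2 mulrACA sqri mulN1r subrK.
Qed.

(** The form dz (x) omega is symmetric, so dz is proportional to omega. *)
Lemma env_sff_square a : U a -> exists q : complex R, forall i j,
  Complex (sff f a (env_normal X1 a) i j - X1 (pr a) 0 0 * metric f a i j)
    (- (sff f a (env_normal X2 a) i j - X2 (pr a) 0 0 * metric f a i j)) =
  q * (om a (d i) * om a (d j)).
Proof.
move=> Ua; have E i j := env_sff i j Ua.
have sym nu i j : sff f a nu i j = sff f a nu j i.
  by rewrite !mxE; exact: (congr1 (fun Y => dotr Y nu) (schwarz (d j) (d i) oU (sf 2) Ua)).
have gsym i j : metric f a i j = metric f a j i by rewrite -{1}metric_sym mxE.
have [|q qE] := @outer_symmetric _ _ (fun i => toC ('D_(d i) pr a)) (fun i => om a (d i)).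
  move=> i j; apply: oppr_inj; apply: etrans (esym (E i j)) _; apply: etrans (E j i).
  by rewrite (sym (env_normal X1 a)) (sym (env_normal X2 a)) gsym.
by exists q => i j; exact: etrans (E i j) (qE i j).
Qed.

(** The normals are n_r = b_r - a_r f for the family X_r = (a_r, b_r). The multiples
    of the metric are a_r, and the covector is <d_u xi, dY>. *)
Theorem envelope_wintgen a : U a -> wintgen_at f a.
Proof.
move=> Ua; have [q E] := env_sff_square Ua; have nul := env_covector_null Ua.
have [p [w omE]] : exists p w, \row_j om a (d j) = cvec p w.
  by exists (revec (\row_j om a (d j))), (imvec (\row_j om a (d j))); exact: cvecE.
rewrite omE in nul.
have sGi : (invmx (metric f a))^T = invmx (metric f a) by rewrite trmx_inv metric_sym.
have [pp pw] := null_covector_parts sGi nul.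
have om_j j : om a (d j) = Complex (p 0 j) (w 0 j).
  by have := congr1 (fun Y : 'rV[complex R]_m => Y 0 j) omE; rewrite /= !mxE.
have [|S1 S2] := @complex_square_parts R m (sff f a (env_normal X1 a)) (sff f a (env_normal X2 a)) (metric f a)
    (X1 (pr a) 0 0) (X2 (pr a) 0 0) q p w.
  by move=> i j; rewrite -!om_j; exact: E.
have H := wintgen_of_null_form hm (dfa Ua) (im Ua) (env_normal_frame Ua) pp pw.
exact: (H _ _ _ _ S1 S2).
Qed.

End EnvelopeWintgen.

(** A lift chosen at one point serves nearby, because the envelope conditions can be
    tested with any lift ([envelope_orth]). *)
Theorem envelope_param_wintgen (R : realType) (m : nat) (hm : (2 <= m)%N) (Mb : topologicalType)
    (B : set (chart Mb 'rV[R]_2)) (g : Mb -> cline R (m + 3))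
    (U : set 'rV[R]_m) (F : 'rV[R]_m -> Mb * 'rV[R]_(m + 3)) :
  riemann_surface B -> holomorphic_curve B g -> one_isotropic B g ->
  envelope_param B g U F -> (forall a, U a -> immersive_at (snd \o F) a) ->
  wintgen_ideal_on U (snd \o F).
Proof.
move=> rB hg ig [oU [[cF sF] sf] _ _ img] im.
have env a : U a -> envelope B g ((F a).1, (F a).2).
  move=> Ua; have [S Sop SE] := img U oU (fun _ h => h).
  have : (F @` U) (F a) by exists a.
  by rewrite SE -surjective_pairing => -[].
split=> // a Ua; have [ff [d [W [x1 [x2 [Bd lx da Wa t0]]]]]] := envelopeE hg ig (env _ Ua).
split=> //; first exact: im.
have [Oop s1 s2 onX [hX iX]] := lift_data hg ig Bd lx.
pose U' := U `&` (fst \o F) @^-1` (cdom d `&` W).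
have oW : open W by have [] := lx.
have oU' : open U'.
  rewrite openE => b [Ub Hb]; apply: filterI; first exact: open_nbhs_nbhs.
  by apply: (cF b Ub); apply: open_nbhs_nbhs; split=> //; apply: openI => //; exact: cdom_open.
have U'U : U' `<=` U by move=> b [].
have sp : smooth_on U' (cfwd d \o (fst \o F)).
  by move=> p; apply: Ck_on_subset (sF d Bd p) => b [Ub [db _]].
have sf' : smooth_on U' (snd \o F) by move=> p; exact: Ck_on_subset U'U (sf p).
have UO b : U' b -> lift_dom d W ((cfwd d \o (fst \o F)) b).
  by move=> [Ub [db Wb]]; split; [exists (F b).1|rewrite /preimage /= cfwdK].
have orth b (U'b : U' b) := envelope_orth rB hg ig Bd lx U'b.2.1 U'b.2.2 (env b U'b.1).
have posE b : pos (F b).2 = cvec (pos_lift (snd \o F) b) 0 by rewrite /pos rc_cvec.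
apply: (envelope_wintgen hm Oop s1 s2 onX hX iX oU' sp sf' UO _ _ _ _ (a := a)).
- by move=> b /U'U Ub; have [] := envelopeE hg ig (env _ Ub).
- by move=> b /U'U; exact: im.
- by move=> b U'b; rewrite -posE; exact: (orth b U'b).1.
- by move=> b U'b; rewrite -posE; exact: (orth b U'b).2.
- by split.
Qed.

(** * The envelope as a submanifold *)

Lemma derive_affine_line (R : realType) (V W : normedModType R) (f : V -> W) a v c :
  (forall t : R, f (t *: v + a) = t *: c + f a) -> 'D_v f a = c.
Proof.
move=> fc; rewrite -[RHS](derive_id (0 : W) c).
have E : (fun t : R => t^-1 *: (f (t *: v + a) - f a)) = (fun t : R => t^-1 *: (id (t *: c + 0) - id (0 : W))).
  by apply/funext => t; rewrite fc addrK addr0 subr0.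
exact: (congr1 (fun G : R -> W => lim (G @ 0^')) E).
Qed.

Lemma lin_differentiable (R : realType) N k (A : 'M[R]_(N, k)) (z : 'rV[R]_N) :
  differentiable (fun z : 'rV[R]_N => z *m A) z.
Proof.
have : differentiable (mulmxr A) z by apply: linear_differentiable; exact: continuous_mulmxr.
by [].
Qed.

Lemma derive_lin (R : realType) N k (A : 'M[R]_(N, k)) (z v : 'rV[R]_N) :
  'D_v (fun z : 'rV[R]_N => z *m A) z = v *m A.
Proof.
rewrite (deriveE _ (lin_differentiable A z)).
exact: (congr1 (fun h : _ -> _ => h v) (diff_lin (f := mulmxr A) z (@continuous_mulmxr R N k A))).
Qed.

Lemma Ck_lor (R : realType) (V : normedModType R) p (D : set V) n (F G : V -> 'rV[R]_(1 + n)) :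
  open D -> Ck_on p D F -> Ck_on p D G -> Ck_on p D (fun x => lor (F x) (G x) : R).
Proof.
move=> oD /(Ck_rVP _ _ oD) CF /(Ck_rVP _ _ oD) CG.
have C i : Ck_on p D (fun x => F x 0 i * G x 0 i) by exact: Ck_mul.
exact: (Ck_add oD (Ck_opp oD (C 0)) (@Ck_sum R p V R D _ (index_enum 'I_n) xpredT
  (fun i x => F x 0 (rshift 1 i) * G x 0 (rshift 1 i)) oD (fun i _ => C (rshift 1 i)))).
Qed.

Section EnvelopeChart.
Variables (R : realType) (m : nat).
Local Notation n := (m + 3)%N.
Variables (O : set 'rV[R]_2) (X1 X2 : 'rV[R]_2 -> 'rV[R]_(1 + n)).
Hypotheses (oO : open O) (s1 : smooth_on O X1) (s2 : smooth_on O X2).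
Hypothesis (onX : forall a, O a -> [/\ lor (X1 a) (X1 a) = 1, lor (X2 a) (X2 a) = 1 & lor (X1 a) (X2 a) = 0]).
Let xi a := cvec (X1 a) (- X2 a).
Hypothesis (hol : forall a, O a -> exists l : complex R, d_zbar xi a = l *: xi a).
Hypothesis (iso : forall a, O a -> lor (d_z xi a) (d_z xi a) = 0).

(** The projections to the parameter z and to the point y are kept as matrices, so
    that their smoothness and derivatives are those of linear maps. *)
Definition lpr : 'M[R]_(2 + n, 2) := lsubmx 1%:M.
Definition rpr : 'M[R]_(2 + n, n) := rsubmx 1%:M.

Lemma lprE (z : 'rV[R]_(2 + n)) : z *m lpr = lsubmx z.
Proof. by rewrite /lpr mulmx_lsub mulmx1. Qed.
Lemma rprE (z : 'rV[R]_(2 + n)) : z *m rpr = rsubmx z.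
Proof. by rewrite /rpr mulmx_rsub mulmx1. Qed.

Definition pos_row (y : 'rV[R]_n) : 'rV[R]_(1 + n) := row_mx 1%:M y.

Definition env_dom : set 'rV[R]_(2 + n) :=
  [set z | O (z *m lpr) /\ 0 < lift_tau X1 X2 (z *m lpr)].

(** The five equations: y is on the unit sphere, and (1, y) is orthogonal to the four
    vectors X1, X2, d_u X1, d_u X2. *)
Definition env_eqn (k : nat) (z : 'rV[R]_(2 + n)) : R :=
  let a := z *m lpr in let Y := pos_row (z *m rpr) in
  nth 0 [:: dotr (z *m rpr) (z *m rpr); lor (X1 a) Y; lor (X2 a) Y;
            lor ('D_(eu R) X1 a) Y; lor ('D_(eu R) X2 a) Y] k.

Definition env_map (z : 'rV[R]_(2 + n)) : 'rV[R]_5 := \row_k env_eqn k z.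

Definition env_value : 'rV[R]_5 := \row_k (k == 0%N :> nat)%:R.

Lemma lift_tau_continuous : Ck_on 0 O (lift_tau X1 X2 : 'rV[R]_2 -> R).
Proof.
have D1 := smooth_derive (eu R) s1 0%N.
have Cb := Ck_lor oO D1 (s2 0%N).
have CN := Ck_scaleR oO (@Ck_cst R 0 _ R O (-1)) (Ck_scaleR oO Cb (s2 0%N)).
have C1 : Ck_on 0 O (lift_e1 X1 X2).
  by apply: (Ck_on_eq oO _ (Ck_add oO D1 CN)) => a _; rewrite scaleN1r.
exact: (Ck_lor oO C1 C1).
Qed.

Lemma env_dom_open : open env_dom.
Proof.
rewrite openE => z [Oz tz].
have cl : {for z, continuous (fun z : 'rV[R]_(2 + n) => z *m lpr)} by exact: continuous_mulmxr.
have no : \forall a \near z *m lpr, O a /\ 0 < lift_tau X1 X2 a.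
  apply: filterI; first exact: open_nbhs_nbhs.
  have H : nbhs (lift_tau X1 X2 (z *m lpr)) [set t : R | 0 < t].
    by apply: open_nbhs_nbhs; split=> //; exact: open_gt.
  exact: (lift_tau_continuous Oz H).
exact: (cl _ no).
Qed.

Lemma env_map_smooth : smooth_on env_dom env_map.
Proof.
move=> p; have oD := env_dom_open; apply/Ck_rVP => // j.
have Cid := Ck_id p env_dom.
have Cl := Ck_mulmxr lpr oD Cid; have Cr := Ck_mulmxr rpr oD Cid.
have CY := Ck_row_mx1 oD (@Ck_cst R p _ R env_dom 1) Cr.
have H (X : 'rV[R]_2 -> 'rV[R]_(1 + n)) : smooth_on O X ->
    Ck_on p env_dom (fun z => lor (X (z *m lpr)) (pos_row (z *m rpr)) : R).
  move=> sX; apply: (Ck_lor oD _ CY).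
  by apply: (Ck_comp oD oO _ Cl (sX p)) => z [].
have E (k : 'I_5) : (fun z => env_map z 0 k) = env_eqn k by apply/funext => z; rewrite mxE.
rewrite E; case: j => -[|[|[|[|[|//]]]]] hj; rewrite /env_eqn /=.
- exact: (Ck_dotr oD Cr Cr).
- exact: H.
- exact: H.
- exact: (H _ (smooth_derive (eu R) s1)).
- exact: (H _ (smooth_derive (eu R) s2)).
Qed.

Lemma env_mapP z : env_dom z ->
  env_map z = env_value <-> [/\ dotr (z *m rpr) (z *m rpr) = 1,
    lor (xi (z *m lpr)) (pos (z *m rpr)) = 0 & lor (cderive (eu R) xi (z *m lpr)) (pos (z *m rpr)) = 0].
Proof.
move=> [Oz tz]; rewrite (lift_cderive_u X1 s2 Oz) /pos rc_cvec !lor_cvec !lor0r !subr0 !add0r !lorNl.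
split=> [E|[yy [h1 h2] [h3 h4]]].
  have H (k : 'I_5) : env_eqn k z = (k == 0%N :> nat)%:R.
    by have := congr1 (fun Y : 'rV[R]_5 => Y 0 k) E; rewrite !mxE.
  have := (H (inord 0), H (inord 1), H (inord 2), H (inord 3), H (inord 4)).
  by rewrite /env_eqn !inordK //= => -[[[[-> ->] ->] ->] ->]; rewrite oppr0.
have k2 := oppr_inj (etrans h2 (esym (oppr0 _))); have k4 := oppr_inj (etrans h4 (esym (oppr0 _))).
apply/rowP => -[[|[|[|[|[|//]]]]] hk]; rewrite !mxE /env_eqn /=.
all: assumption.
Qed.

Let vert (de : 'rV[R]_n) : 'rV[R]_(2 + n) := row_mx 0 de.

Lemma derive_vert_lor (X : 'rV[R]_2 -> 'rV[R]_(1 + n)) z (de : 'rV[R]_n) :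
  'D_(vert de) (fun z => lor (X (z *m lpr)) (pos_row (z *m rpr)) : R) z = dotr (rsubmx (X (z *m lpr))) de.
Proof.
apply: derive_affine_line => t.
have -> : (t *: vert de + z) *m lpr = z *m lpr.
  by rewrite mulmxDl -scalemxAl [vert de *m _]lprE row_mxKl scaler0 add0r.
have -> : (t *: vert de + z) *m rpr = t *: de + z *m rpr.
  by rewrite mulmxDl -scalemxAl [vert de *m _]rprE row_mxKr.
have lorE (y : 'rV[R]_n) : lor (X (z *m lpr)) (pos_row y) = - X (z *m lpr) 0 0 + dotr (rsubmx (X (z *m lpr))) y.
  by rewrite {1}[X _]row_mxE1 lor_row_mx mulr1.
by rewrite !lorE dotrDr dotrZr addrCA.
Qed.

Lemma derive_vert_sphere z (de : 'rV[R]_n) :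
  'D_(vert de) (fun z => dotr (z *m rpr) (z *m rpr) : R) z = 2 * dotr (z *m rpr) de.
Proof.
have dr := lin_differentiable rpr z.
apply: etrans (derive_dotr (vert de) dr dr) _.
have -> : 'D_(vert de) (fun z => z *m rpr) z = de.
  by apply: etrans (derive_lin rpr z (vert de)) _; rewrite rprE row_mxKr.
by rewrite dotrC -mulr2n mulr_natl.
Qed.

(** Moving only y, the differentials of the equations are the products with y and
    with the vector parts of the four vectors. A linear relation among them is a
    combination Z of the four vectors proportional to (1, y); as (1, y) is
    light-like and the vectors span a spacelike subspace, the relation is trivial. *)
Lemma env_map_submersion z : env_dom z -> env_map z = env_value ->
  exists K : 'M[R]_(5, 2 + n), K *m 'J env_map z = 1%:M.
Proof.
move=> Dz eqz; have [Oz tz] := Dz.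
have de := smooth_differentiable env_map_smooth Dz.
have dk (k : 'I_5) de' : ('D_(vert de') env_map z) 0 k = 'D_(vert de') (env_eqn k) z.
  by rewrite derive_coord //; apply: eq_derive => x; rewrite mxE.
have vals (k : 'I_5) : env_eqn k z = (k == 0%N :> nat)%:R.
  by have := congr1 (fun Y : 'rV[R]_5 => Y 0 k) eqz; rewrite !mxE.
have := (vals (inord 0), vals (inord 1), vals (inord 2), vals (inord 3), vals (inord 4)).
rewrite /env_eqn !inordK //= => -[[[[yy e1] e2] e3] e4].
set a := z *m lpr in Oz tz e1 e2 e3 e4; set y := z *m rpr in yy e1 e2 e3 e4.
apply/row_fullP; rewrite /row_full -mxrank_tr -[_ == _]/(row_free _) -kermx_eq0 -submx0; apply/rV_subP => c /sub_kermxP cJ.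
pose c_ k := c 0 (inord k).
pose Z := c_ 1%N *: X1 a + c_ 2%N *: X2 a + c_ 3%N *: 'D_(eu R) X1 a + c_ 4%N *: 'D_(eu R) X2 a.
have Zy0 : forall de' : 'rV[R]_n, dotr ((2 * c_ 0%N) *: y + rsubmx Z) de' = 0.
  move=> de'.
  have : ('D_(vert de') env_map z *m c^T) 0 0 = 0.
    rewrite (deriveEjacobian _ de) -mulmxA.
    have JT : 'J env_map z *m c^T = 0 by apply: trmx_inj; rewrite trmx_mul trmxK cJ trmx0.
    by rewrite JT mulmx0 mxE.
  rewrite mxE !big_ord_recl big_ord0 addr0 ![('D_(vert de') env_map z) 0 _]dk !mxE.
  rewrite /env_eqn /= derive_vert_sphere (derive_vert_lor X1) (derive_vert_lor X2).
  rewrite (derive_vert_lor ('D_(eu R) X1)) (derive_vert_lor ('D_(eu R) X2)).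
  have lk k (i : 'I_5) : nat_of_ord i = k -> c 0 i = c_ k by move=> <-; rewrite /c_ inord_val.
  rewrite (lk 0%N ord0) // (lk 1%N (lift _ _)) // (lk 2%N (lift _ (lift _ _))) //.
  rewrite (lk 3%N (lift _ (lift _ (lift _ _)))) // (lk 4%N (lift _ (lift _ (lift _ (lift _ _))))) //.
  have rsD (Y Y' : 'rV[R]_(1 + n)) : rsubmx (Y + Y') = rsubmx Y + rsubmx Y' by apply/rowP => k; rewrite !mxE.
  have rsZ x (Y : 'rV[R]_(1 + n)) : rsubmx (x *: Y) = x *: rsubmx Y by apply/rowP => k; rewrite !mxE.
  rewrite dotrDl /Z !rsD !rsZ -/a -/y => e; rewrite -[RHS]e {e}.
  move: (rsubmx (X1 a)) (rsubmx (X2 a)) (rsubmx _) (rsubmx _) => r1 r2 r3 r4.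
  by rewrite !(dotrDl, dotrZl); ring.
have Zr : rsubmx Z = - ((2 * c_ 0%N) *: y).
  apply/eqP; rewrite -subr_eq0 opprK addrC; apply/negPn/negP => /dotr_gt0.
  by rewrite Zy0 ltxx.
have ZY : lor Z (pos_row y) = 0.
  by rewrite /Z !(lorDl, lorZl) e1 e2 e3 e4 !mulr0 !addr0.
have Z0 : Z = - (2 * c_ 0%N) *: pos_row y.
  rewrite [LHS]row_mxE1 Zr /pos_row scale_row_mx; congr row_mx; last by rewrite scaleNr.
  move: ZY; rewrite {1}[Z]row_mxE1 lor_row_mx mulr1 Zr -/(dotr _ _) -scaleNr dotrZl yy mulr1.
  by move=> /eqP; rewrite addrC subr_eq0 => /eqP <-; rewrite scalemx1.
have ZZ : lor Z Z = 0 by rewrite {2}Z0 lorZr ZY mulr0.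
pose b := lift_b X1 X2 a.
(* The coordinates of Z in the orthogonal frame X1, X2, e1, e2, obtained from
   d_u X1 = e1 + b X2 and d_u X2 = e2 - b X1. *)
pose q : 'rV[R]_4 := \row_(k < 4) nth 0 [:: c_ 1%N - b * c_ 4%N; c_ 2%N + b * c_ 3%N; c_ 3%N; c_ 4%N] k.
have Zq : Z = q *m lift_frame X1 X2 a.
  rewrite lift_frame_mul !mxE !inordK //= /lift_e1 /lift_e2 -/b /Z.
  move: ('D_(eu R) X1 a) ('D_(eu R) X2 a) => u w.
  by apply/rowP => k; rewrite !mxE; ring.
have q0 : q = 0.
  apply: (lift_frame_definite oO s1 s2 onX hol iso Oz tz).
  by rewrite -Zq ZZ.
have qk (k : 'I_4) : nth 0 [:: c_ 1%N - b * c_ 4%N; c_ 2%N + b * c_ 3%N; c_ 3%N; c_ 4%N] k = 0.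
  by have := congr1 (fun Y : 'rV[R]_4 => Y 0 k) q0; rewrite !mxE.
have := (qk (inord 0), qk (inord 1), qk (inord 2), qk (inord 3)); rewrite !inordK //= => -[[[h1 h2] h3] h4].
have k1 : c_ 1%N = 0 by move: h1; rewrite h4 mulr0 subr0.
have k2 : c_ 2%N = 0 by move: h2; rewrite h3 mulr0 addr0.
have k0 : c_ 0%N = 0.
  have : Z 0 0 = 0 by rewrite Zq q0 mul0mx mxE.
  have p0 : pos_row y 0 0 = 1.
    by rewrite (_ : 0 = lshift n (0 : 'I_1)) ?row_mxEl ?mxE //; exact: val_inj.
  by rewrite Z0 mxE p0 mulr1 => /eqP; rewrite oppr_eq0 mulf_eq0 pnatr_eq0 /= => /eqP.
have -> : c = 0 by apply/rowP => i; rewrite mxE -(inord_val i); case: i => -[|[|[|[|[|//]]]]] hi /=.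
exact: sub0mx.
Qed.

End EnvelopeChart.

Lemma kernel_basis (R : fieldType) N k m (P : 'M[R]_(N, k)) (K : 'M[R]_(k, N)) :
  (N - k)%N = m -> K *m P = 1%:M ->
  exists (Q : 'M[R]_(m, N)) (Q' : 'M[R]_(N, m)), [/\ Q *m Q' = 1%:M, Q *m P = 0
     & forall u : 'rV[R]_N, u *m P = 0 -> exists s, u = s *m Q].
Proof.
move=> e KP; have rk : \rank (kermx P) = m.
  by rewrite mxrank_ker -e; congr subn; apply/eqP/row_fullP; exists K.
case: m / rk e => _.
have /row_freeP[Q' QQ'] := row_base_free (kermx P).
exists (row_base (kermx P)), Q'; split=> // [|u uP].
  by apply/sub_kermxP; rewrite eq_row_base.
by apply/submxP; rewrite eq_row_base; apply/sub_kermxP.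
Qed.

(** In the straightened coordinates the envelope is the kernel of the linear map P, and
    a basis of that kernel gives the parametrization. It is a homeomorphism onto an
    open part of the envelope because the straightening map f is continuous. *)
Theorem envelope_submanifold (R : realType) (m : nat) (Mb : topologicalType)
    (B : set (chart Mb 'rV[R]_2)) (g : Mb -> cline R (m + 3)) :
  riemann_surface B -> holomorphic_curve B g -> one_isotropic B g ->
  forall p, envelope B g p ->
  exists (U : set 'rV[R]_m) (F : 'rV[R]_m -> Mb * 'rV[R]_(m + 3)),
    envelope_param B g U F /\ (F @` U) p.
Proof.
move=> rB hg ig [q0 y0] env0; have [yy0 [d [W [x1 [x2 [Bd lx dq Wq t0]]]]]] := envelopeE hg ig env0.
have [oO s1 s2 onX [hX iX]] := lift_data hg ig Bd lx.
pose O := lift_dom d W; pose X1 := x1 \o cinv d; pose X2 := x2 \o cinv d.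
pose N := (2 + (m + 3))%N.
pose D := env_dom O X1 X2 : set 'rV[R]_N.
have oD : open D by exact: (env_dom_open oO s1 s2).
have sT : smooth_on D (env_map X1 X2) by exact: (env_map_smooth oO s1 s2).
have chartD z : D z -> [/\ ccod d (z *m lpr R m), cdom d (cinv d (z *m lpr R m)),
    W (cinv d (z *m lpr R m)) & cfwd d (cinv d (z *m lpr R m)) = z *m lpr R m].
  by move=> [[cz Wz] _]; have [h1 h2] := chart_inv cz.
have envP z : D z -> env_map X1 X2 z = env_value R <->
    envelope B g (cinv d (z *m lpr R m), z *m rpr R m).
  move=> Dz; have [cz dz Wz ez] := chartD _ Dz; have H := env_mapP s2 Dz.
  split=> [/H.1[h1 h2 h3]|e].
    by apply: (envelopeI hg ig Bd lx dz Wz h1); rewrite ez //; exact: Dz.2.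
  have [h1 h2] := envelope_orth rB hg ig Bd lx dz Wz e.
  by apply/H; rewrite ez in h1 h2; have [h3 _] := e.
pose b0 : 'rV[R]_N := row_mx (cfwd d q0) y0.
have b0l : b0 *m lpr R m = cfwd d q0 by rewrite lprE row_mxKl.
have b0r : b0 *m rpr R m = y0 by rewrite rprE row_mxKr.
have Db0 : D b0.
  by split; rewrite ?b0l //; split; [exists q0|rewrite /preimage /= cfwdK].
have T0 : env_map X1 X2 b0 = env_value R by apply: (envP _ Db0).2; rewrite b0l b0r (cfwdK dq).
have [K KP] := env_map_submersion oO s1 s2 onX hX iX Db0 T0.
have [U1 [V2 [f [G [[oU1 U1b U1D oV2 f0] [fgK gfK sf sG hf]]]]]] := straightening oD sT Db0 KP.
have [P PE] : exists P, P = 'J (env_map X1 X2) b0 by exists ('J (env_map X1 X2) b0).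
rewrite -PE T0 in KP hf.
have Nm : (N - 5)%N = m by rewrite /N addnC -addnA addnK.
have [Q [Q' [QQ' QP Qker]]] := kernel_basis Nm KP.
pose U := [set s : 'rV[R]_m | V2 (s *m Q)].
have oU : open U.
  by apply: (open_comp (f := fun s : 'rV[R]_m => s *m Q)) => // s _; exact: continuous_mulmxr.
(* The parametrization in the coordinates (z, y). *)
pose H s := G (s *m Q).
have HU s : U s -> U1 (H s) /\ f (H s) = s *m Q by exact: gfK.
have HD s : U s -> D (H s) by move=> /HU[/U1D].
have HT s : U s -> env_map X1 X2 (H s) = env_value R.
  by move=> /HU[Us e]; rewrite hf // e -mulmxA QP mulmx0 addr0.
have sH : smooth_on U H.
  by apply: (smooth_comp oU oV2 _ _ sG) => // p; apply: Ck_mulmxr => //; exact: Ck_id.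
pose F s := (cinv d (H s *m lpr R m), H s *m rpr R m).
have sl : smooth_on U (fun s => H s *m lpr R m) by move=> p; exact: Ck_mulmxr (sH p).
have sr : smooth_on U (fun s => H s *m rpr R m) by move=> p; exact: Ck_mulmxr (sH p).
have dH s : U s -> differentiable H s by exact: smooth_differentiable.
have dl s : U s -> differentiable (fun s => H s *m lpr R m) s by exact: smooth_differentiable.
have Dl s v : U s -> 'D_v (fun s => H s *m lpr R m) s = 'D_v H s *m lpr R m.
  move=> Us; apply: etrans (derive_comp v (dH _ Us) (lin_differentiable (lpr R m) (H s))) _.
  exact: derive_lin.
have Dr s v : U s -> 'D_v (fun s => H s *m rpr R m) s = 'D_v H s *m rpr R m.
  move=> Us; apply: etrans (derive_comp v (dH _ Us) (lin_differentiable (rpr R m) (H s))) _.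
  exact: derive_lin.
have z0 (z : 'rV[R]_N) : z *m lpr R m = 0 -> z *m rpr R m = 0 -> z = 0.
  by rewrite lprE rprE => h1 h2; rewrite -[z]hsubmxK h1 h2 row_mx0.
have zinj (z z' : 'rV[R]_N) : z *m lpr R m = z' *m lpr R m -> z *m rpr R m = z' *m rpr R m -> z = z'.
  by rewrite !lprE !rprE => h1 h2; rewrite -[z]hsubmxK h1 h2 hsubmxK.
have HI s s' : H s = H s' -> U s -> U s' -> s = s'.
  move=> e Us Us'; have [_ h1] := HU _ Us; have [_ h2] := HU _ Us'.
  by rewrite -[s]mulmx1 -[s']mulmx1 -QQ' !mulmxA -h1 -h2 e.
have cF s : U s -> {for s, continuous (fst \o F)}.
  move=> Us; have [cz _ _ _] := chartD _ (HD _ Us).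
  apply: (@continuous_comp _ _ _ (fun s => H s *m lpr R m) (cinv d)); first exact: (sl 0%N).
  exact: cinv_continuous.
exists U, F; split; last first.
  exists 0; first by rewrite /U /= mul0mx -f0; exact: (fgK _ U1b).1.
  by rewrite /F /H mul0mx -f0 (fgK _ U1b).2 b0l b0r cfwdK.
split=> //.
- split=> //; split=> [s Us|d' Bd' p]; first exact: cF.
  have [oT st _ _] := transition rB.1 Bd Bd'.
  have oU' : open (U `&` (fst \o F) @^-1` cdom d').
    rewrite openE => s [Us Hs]; apply: filterI; first exact: open_nbhs_nbhs.
    by apply: (cF s Us); apply: open_nbhs_nbhs; split=> //; exact: cdom_open.
  apply: (Ck_comp oU' oT _ _ (st p)) => [s [Us Hs]|].
    by split=> //; have [] := chartD _ (HD _ Us).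
  by apply: Ck_on_subset (sl p) => s [].
- move=> s Us d' Bd' dd' v D1 D2; have [cz dz Wz ez] := chartD _ (HD _ Us).
  have [oT st tP uJ] := transition rB.1 Bd Bd'.
  have dt : differentiable (cfwd d' \o cinv d) (H s *m lpr R m).
    by apply: (smooth_differentiable st); split.
  have Hl : 'D_v H s *m lpr R m = 0.
    rewrite -(Dl _ v Us); have := etrans (esym (derive_comp v (dl _ Us) dt)) D1.
    rewrite (deriveEjacobian _ dt) => h.
    by rewrite -(mulmxK (uJ (H s *m lpr R m) (conj cz dd')) ('D_v _ s)) h mul0mx.
  have H0 : 'D_v H s = 0 by apply: z0 => //; apply: etrans (esym (Dr _ v Us)) D2.
  have df : differentiable f (H s) by apply: (smooth_differentiable sf); have [] := HU _ Us.
  have : v *m Q = 0.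
    have nU : \forall x \near s, U x by exact: open_nbhs_nbhs.
    have E : 'D_v (f \o H) s = v *m Q.
      apply: etrans (derive_lin Q s v); apply: near_eq_derive.
      by apply: filterS nU => x /HU[].
    have := derive_comp v (dH _ Us) df; rewrite E H0 => ->.
    by rewrite (deriveE _ df) linear0.
  by move=> vQ; rewrite -[v]mulmx1 -QQ' mulmxA vQ mul0mx.
- move=> s s'; rewrite !inE => Us Us' [e1 e2]; apply: HI => //; apply: zinj => //.
  have [cz dz Wz ez] := chartD _ (HD _ Us); have [cz' dz' Wz' ez'] := chartD _ (HD _ Us').
  by rewrite -ez -ez' e1.
move=> V oV VU.
(* On the envelope f z Q' recovers the parameter. *)
pose Om := [set z | U1 z /\ V (f z *m Q')].
have oOm : open Om.
  rewrite openE => z [Uz Vz]; apply: filterI; first exact: open_nbhs_nbhs.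
  have cz : {for z, continuous (fun z => f z *m Q')} by exact: (Ck_mulmxr Q' oU1 (sf 0%N)).
  by apply: cz; exact: open_nbhs_nbhs.
exists [set x | cdom d x.1 /\ Om (row_mx (cfwd d x.1) x.2)].
  rewrite openE => -[q y] [/= dq' Oz].
  have [e /= e0 eB] := (nbhs_ballP _ _).1 (open_nbhs_nbhs (conj oOm Oz)).
  exists ([set q' | cdom d q' /\ ball (cfwd d q) e (cfwd d q')], ball y e); first split=> /=.
  - apply: filterI; first by apply: open_nbhs_nbhs; split=> //; exact: cdom_open.
    by apply: (cfwd_continuous dq'); exact: nbhsx_ballx.
  - exact: nbhsx_ballx.
  move=> [q' y'] [/= [dq'' [_ h1]] [_ h2]]; split=> //; apply: eB; split=> // i j.
  rewrite -(fintype.splitK j); case: (fintype.split j) => k /=.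
    by rewrite !row_mxEl; exact: h1.
  by rewrite !row_mxEr; exact: h2.
apply/seteqP; split=> [_ [s Vs <-]|[q y] [[/= dq' [Uz Vz]] e]].
  have Us := VU _ Vs; have [cz dz Wz ez] := chartD _ (HD _ Us); have [U1s fs] := HU _ Us.
  split; last exact: (envP _ (HD _ Us)).1 (HT _ Us).
  split=> //=; rewrite ez lprE rprE hsubmxK.
  by split=> //; rewrite fs -mulmxA QQ' mulmx1.
set z := row_mx _ y in Uz Vz.
have zl : z *m lpr R m = cfwd d q by rewrite lprE row_mxKl.
have zr : z *m rpr R m = y by rewrite rprE row_mxKr.
have Tz : env_map X1 X2 z = env_value R by apply: (envP _ (U1D _ Uz)).2; rewrite zl zr (cfwdK dq').
have [s fE] : exists s, f z = s *m Q.
  by apply: Qker; apply: (addrI (env_value R)); rewrite -hf // Tz addr0.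
have sE : f z *m Q' = s by rewrite fE -mulmxA QQ' mulmx1.
exists s; first by rewrite -sE.
by rewrite /F /H -fE (fgK _ Uz).2 zl zr cfwdK.
Qed.

(** * The main theorem *)

Theorem theorem1p2 (R : realType) (m : nat) (hm : (2 <= m)%N) :
  (* (i) *)
  (forall (M : topologicalType) (A : set (chart M 'rV[R]_m))
          (x : M -> 'rV[R]_(m + 3)),
     smooth_manifold A -> wintgen_ideal A x -> wintgen_umbilic_free A x ->
     forall (W : set M) (n1 n2 : M -> 'rV[R]_(m + 3)),
     smooth_normal_frame A x W n1 n2 ->
     forall p : M, W p ->
     exists U : set M, [/\ open U, U p, U `<=` W &
       exists (Mb : topologicalType) (B : set (chart Mb 'rV[R]_2))
              (proj : M -> Mb) (g : Mb -> cline R (m + 3)),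
         (* the Riemann surface Mb is the space of leaves of D^perp on U *)
         [/\ riemann_surface B /\ connected [set: Mb],
             smooth_map A B U proj /\ proj @` U = [set: Mb],
             (forall c d, A c -> B d -> forall a, ccod c a -> U (cinv c a) ->
                cdom d (proj (cinv c a)) ->
                (forall w, exists v, 'D_v (cfwd d \o (proj \o cinv c)) a = w) /\
                (forall v, 'D_v (cfwd d \o (proj \o cinv c)) a = 0 <->
                           Dperp (x \o cinv c) a v)) /\
             (forall q r, U q -> U r ->
                (proj q = proj r <-> same_leaf A x U q r)),
             (* the Gauss map factors through Mb *)
             forall c, A c -> forall a, ccod c a -> U (cinv c a) ->
               gauss_map (x \o cinv c) a (n1 (cinv c a)) (n2 (cinv c a)) =
               g (proj (cinv c a))
           & holomorphic_curve B g /\ one_isotropic B g]]) /\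
  (* (ii) *)
  (forall (Mb : topologicalType) (B : set (chart Mb 'rV[R]_2))
          (g : Mb -> cline R (m + 3)),
     riemann_surface B -> holomorphic_curve B g -> one_isotropic B g ->
     (* the envelope is an m-dimensional submanifold of Mb x R^(m+3) *)
     (forall p, envelope B g p ->
        exists (U : set 'rV[R]_m) (F : 'rV[R]_m -> Mb * 'rV[R]_(m + 3)),
          envelope_param B g U F /\ (F @` U) p) /\
     (* the parametrizations on which the map (q, [Y]) |-> [Y] is an immersion
        cover exactly the regular points *)
     (forall (U : set 'rV[R]_m) (F : 'rV[R]_m -> Mb * 'rV[R]_(m + 3)),
        envelope_param B g U F ->
        (forall a, U a -> immersive_at (snd \o F) a) ->
        wintgen_ideal_on U (snd \o F))).
Proof.
split=> [M A x mA wx ux W n1 n2 nf p Wp|Mb B g rB hg ig].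
  exact: (wintgen_gauss_map_holomorphic hm mA wx ux nf Wp).
split; first exact: envelope_submanifold rB hg ig.
by move=> U F; exact: (envelope_param_wintgen hm rB hg ig).
Qed.
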